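(* Let $P$ be the uniform distribution on the square region $J=[0,1]\times[0,1]$ with vertices $(0,0),(1,0),(1,1),(0,1)$. Assume that for every optimal set of four-means for $P$ there is a line of symmetry $\ell$ of the square (one of the two diagonals or one of the lines $x_1=\frac12$, $x_2=\frac12$) such that two of the four points lie on $\ell$ and the other two lie on opposite sides of $\ell$ and are equidistant from $\ell$. Then the set $\{(\frac14,\frac14),(\frac34,\frac34),(\frac34,\frac14),(\frac14,\frac34)\}$ is the unique optimal set of four-means for $P$, with quantization error $V_4(P)=0.0416667$ (decimal approximation, i.e. $|V_4(P)-0.0416667|<10^{-7}$).
   Context: The uniform distribution on $J$ is the Borel probability measure with density $1$ on $J$ and $0$ elsewhere with respect to Lebesgue measure. For a Borel probability measure $P$ on $\mathbb R^d$ and $n\ge1$, the $n$th quantization error is $V_n(P)=\inf\{\int \min_{a\in\alpha}\|x-a\|^2\,dP(x):\alpha\subset\mathbb R^d,\ \mathrm{card}(\alpha)\le n\}$, where $\|\cdot\|$ is the Euclidean norm. A set $\alpha$ with $\mathrm{card}(\alpha)\le n$ attaining the infimum is called an optimal set of $n$-means; for absolutely continuous $P$ it has exactly $n$ elements. *)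

(* Defs.v *)
From HB Require Import structures.
From mathcomp Require Import all_boot all_order all_algebra finmap.
From mathcomp Require Import all_classical all_reals all_analysis.
From mathcomp Require Import measurable_realfun.

Set Implicit Arguments.
Unset Strict Implicit.
Unset Printing Implicit Defensive.

Import Order.TTheory GRing.Theory Num.Theory.
Import numFieldNormedType.Exports.

Local Open Scope classical_set_scope.
Local Open Scope ring_scope.

(* The product sigma-algebra carried by [plane R] is the Borel one. *)
Definition plane (R : realType) := (measurableTypeR R * measurableTypeR R)%type.

(* The canonical norm on a product type is the sup norm, hence this one. *)
Definition enorm (R : realType) (x : plane R) : R :=
  Num.sqrt (x.1 ^+ 2 + x.2 ^+ 2).

Definition edist (R : realType) (x y : plane R) : R :=
  enorm (x.1 - y.1, x.2 - y.2).

Definition unit_square (R : realType) : set (plane R) :=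
  [set x | 0 <= x.1 <= 1 /\ 0 <= x.2 <= 1].

Definition uniform_square (R : realType) (A : set (plane R)) : \bar R :=
  (\int[@lebesgue_measure R \x @lebesgue_measure R]_(x in A) (\1_(@unit_square R) x)%:E)%E.

Section uniform_square.
Context {R : realType}.
Local Notation J := (@unit_square R).

Lemma unit_squareE : J = `[0, 1] `*` `[0, 1].
Proof.
by apply/seteqP; split=> x /=; rewrite !in_itv.
Qed.

Lemma measurable_unit_square : measurable J.
Proof. by rewrite unit_squareE; apply: measurableX. Qed.

Lemma measurable_unit_square_pdf :
  measurable_fun setT (EFin \o (\1_J : plane R -> R)).
Proof.
apply/measurable_EFinP; apply: measurable_indic.
exact: measurable_unit_square.
Qed.

Let uniform_square0 : @uniform_square R set0 = 0%E.
Proof. by rewrite /uniform_square integral_set0. Qed.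

Let uniform_square_ge0 A : (0 <= @uniform_square R A)%E.
Proof. by apply: integral_ge0 => x _; rewrite lee_fin. Qed.

Let uniform_square_sigma_additive : semi_sigma_additive (@uniform_square R).
Proof.
move=> /= F mF tF mUF; rewrite /uniform_square; apply: cvg_toP.
  apply: ereal_nondecreasing_is_cvgn => m n mn.
  apply: lee_sum_nneg_natr => // k _ _.
  by apply: integral_ge0 => x _; rewrite lee_fin.
rewrite ge0_integral_bigcup//=.
  apply: measurable_funTS; exact: measurable_unit_square_pdf.
Qed.

HB.instance Definition _ := isMeasure.Build _ _ _ (@uniform_square R)
  uniform_square0 uniform_square_ge0 uniform_square_sigma_additive.

Let uniform_square_setT : @uniform_square R setT = 1%E.
Proof.
rewrite /uniform_square integral_indic//; last exact: measurable_unit_square.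
rewrite setIT unit_squareE.
rewrite [LHS]product_measure1E//=.
by rewrite lebesgue_measure_itv/= lte_fin ltr01 oppr0 adde0 mule1.
Qed.

HB.instance Definition _ := @Measure_isProbability.Build _ _ R
  (@uniform_square R) uniform_square_setT.

End uniform_square.

(* The neutral element +oo makes the minimum over the empty set infinite. *)
Definition distortion (R : realType) (P : probability (plane R) R)
    (alpha : {fset plane R}) : \bar R :=
  (\int[P]_x \big[Order.min/+oo]_(a <- alpha) (edist x a ^+ 2)%:E)%E.

Definition quantization_error (R : realType) (P : probability (plane R) R)
    (n : nat) : \bar R :=
  ereal_inf [set distortion P alpha | alpha in
    [set alpha : {fset plane R} | (#|` alpha| <= n)%N]].

Definition optimal_means (R : realType) (P : probability (plane R) R)
    (n : nat) (alpha : {fset plane R}) : Prop :=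
  (#|` alpha| <= n)%N /\ distortion P alpha = quantization_error P n.

(* The triple (a, b, c) encodes the line of equation a x_1 + b x_2 = c. *)
Definition line_form (R : realType) (l : R * R * R) (x : plane R) : R :=
  l.1.1 * x.1 + l.1.2 * x.2 - l.2.

Definition line (R : realType) (l : R * R * R) : set (plane R) :=
  [set x | line_form l x = 0].

Definition opposite_sides (R : realType) (l : R * R * R) (x y : plane R) :=
  line_form l x < 0 < line_form l y \/ line_form l y < 0 < line_form l x.

Definition dist_to_set (R : realType) (x : plane R) (A : set (plane R)) : R :=
  inf [set edist x y | y in A].

Definition square_symmetry_lines (R : realType) : seq (R * R * R) :=
  [:: (1, -1, 0); (1, 1, 1); (1, 0, 2^-1); (0, 1, 2^-1)].

Definition two_on_two_across (R : realType) (l : R * R * R)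
    (alpha : {fset plane R}) : Prop :=
  exists p q r s : plane R,
    [/\ alpha = [fset p; q; r; s]%fset,
        p != q, line l p /\ line l q,
        opposite_sides l r s
      & dist_to_set r (line l) = dist_to_set s (line l)].

(* Main.v *)
(** In the coordinates [u = x + y - 1], [v = y - x] the square becomes the diamond
    [|u| + |v| <= 1] and squared distances double, so a four-point set beats the grid iff the
    integral of its squared distance function over the diamond ([energy]) is below [1/6].

    Suppose that two centres [(a, 0)], [(b, 0)] lie on the axis of a diagonal and the others are
    [(c, h)], [(d, -h)].  First [c = d]: otherwise one axis centre, say [(b, 0)], has a cell whose
    upper half reflects into its lower half, and as its centroid lies on the axis by optimality,
    the cell is either everything on its side of the bisector of the axis centres or useless;
    comparing with discs around the remaining three centres, the energy is then above [1/6].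
    For [c = d] three lower bounds cover all parameters: by columns (each axis cell is estimated
    by a tent function), by columns with the axis centres replaced by a half-axis, and by rows;
    the remaining polynomial inequalities in two variables are checked by verified bisection.
    Equality forces the grid.

    If the line of symmetry is [y = 1/2], the two centres on it do no better than the whole line,
    which costs [1/12], and each of the others gains less than [1/48].

    An optimal set exists by compactness.  Clamping an optimal set to the square keeps it
    optimal, so the clamped set is the grid; as the grid is interior, nothing was moved. *)

Require Import Defs.
From HB Require Import structures.
From Stdlib Require Import BinInt.
From mathcomp Require Import all_boot all_order all_algebra finmap.
From mathcomp Require Import all_classical all_reals all_analysis.
From mathcomp Require Import ring lra measurable_realfun ssrZ.
Import Order.TTheory GRing.Theory Num.Theory.
Import numFieldNormedType.Exports.
Delimit Scope nat_scope with N.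
Local Open Scope classical_set_scope.
Local Open Scope ring_scope.

Set Implicit Arguments.
Unset Strict Implicit.
Unset Printing Implicit Defensive.

(** Voronoi cells are never integrated exactly. Each lower bound fixes a base distance and subtracts
    positive parts of affine gains, so that powers of [pos] serve as antiderivatives however the
    cells meet the boundary. For [c = d] the tent and row bounds are exact at the grid; the
    half-axis bound is strict and only serves parameters away from it. The polynomials left by the
    exact bounds vanish to second order at the grid, where no bisection can decide their sign; there
    they are written as squares with positive weights.

    The main obstacle is that the hypothesis equates the distances of the two outer centres from the
    line but does not relate the feet of their perpendiculars: [c] and [d] are independent. For
    [c != d] the squared distance function is not even in [v], and the estimates by half columns
    break down; the variational argument needs only the reflection of one cell.

    The threshold [1 / 6] is four times the value [1 / 24] of the grid: one factor two comes from
    the area, the other from the squared distances. *)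

(** * Affine substitution for the Lebesgue integral *)

Section affine_substitution.
Local Open Scope ereal_scope.
Context {R : realType}.
Local Notation mu := (@lebesgue_measure R).

(** Lebesgue measure is [a] times its own image under [x |-> a x + b], because the two agree on
    half-open intervals. *)
Lemma integral_affine (a b : R) (f : R -> \bar R) : (0 < a)%R ->
  measurable_fun setT f -> (forall x, 0 <= f x) ->
  \int[mu]_x f x = a%:E * \int[mu]_x f (a * x + b)%R.
Proof.
move=> a0 mf f0.
pose phi : measurableTypeR R -> measurableTypeR R := fun x => (a * x + b)%R.
have mphi : measurable_fun setT phi.
  by apply: measurable_funD => //; exact: measurable_funM.
pose an : {nonneg R} := NngNum (ltW a0).
have muE A : measurable A ->
    mu A = mscale an (pushforward mu phi) A.
  apply: lebesgue_measure_unique => _ [[c d]] _ <-.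
  change (mu `]c, d]%classic = a%:E * mu (phi @^-1` `]c, d]%classic)).
  rewrite (_ : phi @^-1` _ = `](c - b) / a, (d - b) / a]%classic)%R; last first.
    apply/seteqP; split => x /=; rewrite !in_itv/= /phi => /andP[h1 h2];
    apply/andP; split.
    - by rewrite ltr_pdivrMr// ltrBlDr mulrC.
    - by rewrite ler_pdivlMr// lerBrDr mulrC.
    - by move: h1; rewrite ltr_pdivrMr// ltrBlDr mulrC.
    - by move: h2; rewrite ler_pdivlMr// lerBrDr mulrC.
  rewrite !lebesgue_measure_itv/= !lte_fin ltr_pM2r ?invr_gt0// ltrD2r.
  case: ifPn => _; last by rewrite mule0.
  rewrite -!EFinB -EFinM; congr EFin; field; exact: lt0r_neq0.
rewrite (@eq_measure_integral _ _ _ _ (mscale an (pushforward mu phi))); last first.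
  by move=> A mA _; exact: muE.
by rewrite ge0_integral_mscale// ge0_integral_pushforward.
Qed.

Lemma integral_oppE (f : R -> \bar R) :
  measurable_fun setT f -> (forall x, 0 <= f x) ->
  \int[mu]_x f x = \int[mu]_x f (- x)%R.
Proof.
move=> mf f0.
rewrite -[RHS](@ge0_integral_pushforward _ _ (measurableTypeR R) (measurableTypeR R) _ (-%R) _ _ setT)//.
by apply: eq_measure_integral => A mA _; rewrite [RHS]lebesgue_measureN.
Qed.

End affine_substitution.

(** * The positive part and the derivatives of its powers *)

Section positive_part.
Context {R : realType}.
Implicit Types x y : R.

Definition pos x : R := Num.max x 0.

Lemma pos_ge0 x : 0 <= pos x. Proof. by rewrite /pos le_max lexx orbT. Qed.
Lemma pos_ge x : x <= pos x. Proof. by rewrite /pos le_max lexx. Qed.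
Lemma ge0_pos x : 0 <= x -> pos x = x. Proof. exact: max_idPl. Qed.
Lemma le0_pos x : x <= 0 -> pos x = 0. Proof. exact: max_idPr. Qed.
Lemma pos_le x y : x <= y -> 0 <= y -> pos x <= y.
Proof. by rewrite /pos ge_max => -> ->. Qed.

Lemma le_pos x y : x <= y -> pos x <= pos y.
Proof. by move=> xy; rewrite pos_le ?pos_ge0// (le_trans xy)// pos_ge. Qed.

Lemma pos_mul x : pos x * x = pos x ^+ 2.
Proof.
have [x0|/ltW x0] := leP 0 x; first by rewrite ge0_pos// expr2.
by rewrite le0_pos// mul0r expr0n.
Qed.

Lemma continuous_pos : continuous pos.
Proof.
move=> x; have -> : pos = (fun y => (y + `|y|) / 2).
  by apply/funext => y; rewrite /pos maxr_absE subr0 addr0.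
apply: cvgM; last exact: cvg_cst.
by apply: cvgD; [exact: cvg_id | exact: norm_continuous].
Qed.

Lemma is_derive_pos_sqr x : is_derive x 1 (fun y => pos y ^+ 2) (2 * pos x).
Proof.
have [x0|x0|<-] := ltgtP 0 x.
- rewrite ge0_pos ?ltW//.
  apply: (@near_eq_is_derive _ _ _ (fun y => y ^+ 2)).
    near=> y; rewrite ge0_pos// ltW//; near: y; exact: lt_nbhsr.
  by apply: is_derive_eq; rewrite /GRing.scale /=; ring.
- rewrite le0_pos ?ltW// mulr0.
  apply: (@near_eq_is_derive _ _ _ (cst 0)).
  near=> y; rewrite /= le0_pos ?expr0n// ltW//; near: y; exact: lt_nbhsl.
(* At the kink, [pos y ^ 2 = pos y * y] exhibits [pos] itself as the continuous slope function. *)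
- rewrite le0_pos// mulr0; apply/is_derive1_caratheodory; exists pos; split.
  + by move=> z; rewrite (le0_pos (lexx 0)) expr0n/= !subr0 pos_mul.
  + exact: continuous_pos.
  + exact: le0_pos.
Unshelve. all: by end_near. Qed.

Lemma is_derive_pos_cube x : is_derive x 1 (fun y => pos y ^+ 3) (3 * pos x ^+ 2).
Proof.
have -> : (fun y => pos y ^+ 3) = (fun y => pos y ^+ 2) * id.
  by apply/funext => y; rewrite fctE /= exprSr !expr2 -!mulrA pos_mul expr2.
have d2 := is_derive_pos_sqr x.
by apply: is_derive_eq; rewrite /GRing.scale /= -!pos_mul; ring.
Qed.

End positive_part.

(** * Syntax-directed derivation and continuity *)

Section derivation_rules.
Context {R : realType}.
Implicit Types (f g : R -> R) (x a b : R).

Lemma is_derive1_cst c x : is_derive x 1 (fun=> c : R) (0 : R).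
Proof. exact: is_derive_cst. Qed.

Lemma is_derive1_id x : is_derive x 1 (fun y : R => y) (1 : R).
Proof. exact: is_derive_id. Qed.

Lemma is_derive1D f g x a b : is_derive x 1 f a -> is_derive x 1 g b ->
  is_derive x 1 (fun y => f y + g y) (a + b).
Proof. exact: is_deriveD. Qed.

Lemma is_derive1N f x a : is_derive x 1 f a -> is_derive x 1 (fun y => - f y) (- a).
Proof. exact: is_deriveN. Qed.

Lemma is_derive1M f g x a b : is_derive x 1 f a -> is_derive x 1 g b ->
  is_derive x 1 (fun y => f y * g y) (f x * b + g x * a).
Proof. exact: is_deriveM. Qed.

Lemma is_derive1X f n x a : is_derive x 1 f a ->
  is_derive x 1 (fun y => f y ^+ n) (n%:R * f x ^+ n.-1 * a).
Proof.
move=> fa; have -> : (fun y => f y ^+ n) = f ^+ n.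
  by apply/funext => y; rewrite exprfctE.
exact: is_deriveX.
Qed.

Lemma is_derive1_pos_sqr f x a : is_derive x 1 f a ->
  is_derive x 1 (fun y => pos (f y) ^+ 2) (2 * pos (f x) * a).
Proof.
exact: (@is_derive1_comp _ (fun y => pos y ^+ 2) f x _ _ (is_derive_pos_sqr (f x))).
Qed.

Lemma is_derive1_pos_cube f x a : is_derive x 1 f a ->
  is_derive x 1 (fun y => pos (f y) ^+ 3) (3 * pos (f x) ^+ 2 * a).
Proof.
exact: (@is_derive1_comp _ (fun y => pos y ^+ 3) f x _ _ (is_derive_pos_cube (f x))).
Qed.

Lemma continuous_cst' (c : R) : continuous (fun _ : R => c).
Proof. by move=> x; exact: cvg_cst. Qed.

Lemma continuous_id' : continuous (fun x : R => x).
Proof. by move=> x; exact: cvg_id. Qed.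

Lemma continuousD' f g : continuous f -> continuous g ->
  continuous (fun x => f x + g x).
Proof. by move=> cf cg x; apply: cvgD; [exact: cf|exact: cg]. Qed.

Lemma continuousN' f : continuous f -> continuous (fun x => - f x).
Proof. by move=> cf x; apply: cvgN; exact: cf. Qed.

Lemma continuousM' f g : continuous f -> continuous g ->
  continuous (fun x => f x * g x).
Proof. by move=> cf cg x; apply: cvgM; [exact: cf|exact: cg]. Qed.

Lemma continuousX' f n : continuous f -> continuous (fun x => f x ^+ n).
Proof.
move=> cf; elim: n => [|n ih].
  by under eq_fun do rewrite expr0; exact: continuous_cst'.
by under eq_fun do rewrite exprS; exact: continuousM'.
Qed.

Lemma continuous_pos' f : continuous f -> continuous (fun x => pos (f x)).
Proof. by move=> cf x; apply: continuous_comp; [exact: cf|exact: continuous_pos]. Qed.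

End derivation_rules.

(** Lets the rules produce the derivative in whatever form they like and leaves an algebraic
    identity. *)
Lemma is_derive1_eq (R : realType) (f : R -> R) (x a b : R) :
  is_derive x 1 f a -> a = b -> is_derive x 1 f b.
Proof. by move=> ? <-. Qed.

(* [is_derive] is a class: plain [apply] would start a diverging instance search. *)
Ltac derive1_rec := lazymatch goal with
  | |- is_derive _ _ (fun y => _ + _) _ =>
      notypeclasses refine (is_derive1D _ _); derive1_rec
  | |- is_derive _ _ (fun y => - _) _ =>
      notypeclasses refine (is_derive1N _); derive1_rec
  | |- is_derive _ _ (fun y => _ * _) _ =>
      notypeclasses refine (is_derive1M _ _); derive1_rec
  | |- is_derive _ _ (fun y => pos _ ^+ 2) _ =>
      notypeclasses refine (is_derive1_pos_sqr _); derive1_rec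
  | |- is_derive _ _ (fun y => pos _ ^+ 3) _ =>
      notypeclasses refine (is_derive1_pos_cube _); derive1_rec
  | |- is_derive _ _ (fun y => _ ^+ _) _ =>
      notypeclasses refine (is_derive1X _ _); derive1_rec
  | |- is_derive ?x _ ( *%R ?k) _ =>
      notypeclasses refine (is_derive1M (is_derive1_cst k x) (is_derive1_id x))
  | |- is_derive ?x _ ( +%R ?k) _ =>
      notypeclasses refine (is_derive1D (is_derive1_cst k x) (is_derive1_id x))
  | |- is_derive ?x _ -%R _ => notypeclasses refine (is_derive1N (is_derive1_id x))
  | |- is_derive _ _ (fun y => y) _ => notypeclasses refine (is_derive1_id _)
  | |- is_derive _ _ _ _ => notypeclasses refine (is_derive1_cst _ _)
  end.

Ltac derive1 := intros; notypeclasses refine (is_derive1_eq _ _);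
  [derive1_rec | cbv beta; simpl predn].

Ltac continuity := cbv beta; lazymatch goal with
  | |- continuous (fun y => _ + _) => apply: continuousD'; continuity
  | |- continuous (fun y => - _) => apply: continuousN'; continuity
  | |- continuous (fun y => _ * _) => apply: continuousM'; continuity
  | |- continuous (fun y => _ ^+ _) => apply: continuousX'; continuity
  | |- continuous (fun y => pos _) => apply: continuous_pos'; continuity
  | |- continuous ( *%R _) => apply: continuousM'; continuity
  | |- continuous ( +%R _) => apply: continuousD'; continuity
  | |- continuous -%R => apply: continuousN'; continuity
  | |- continuous (fun y => y) => exact: continuous_id'
  | |- continuous _ => exact: continuous_cst'
  end.

(** * Integrals bounded below through antiderivatives *)

Section integral_bounds.
Context {R : realType}.
Local Notation mu := (@lebesgue_measure R).
Implicit Types (F f : R -> R) (g : R -> \bar R) (a b c E : R).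

Lemma integral_antiderivative F f a b : a <= b ->
  (forall x : R, is_derive x 1 F (f x)) -> continuous f ->
  (\int[mu]_(x in `[a, b]) (f x)%:E = (F b - F a)%:E)%E.
Proof.
rewrite le_eqVlt => /predU1P[<- _ _|ab dF cf].
  by rewrite set_itv1 integral_set1 subrr.
have cF : continuous F.
  move=> x; apply/differentiable_continuous/derivable1_diffP.
  by have [] := dF x.
rewrite (@continuous_FTC2 _ f F a b ab).
- by rewrite EFinB.
- by apply: continuous_subspaceT => x; exact: cf.
- split.
  + by move=> x _; have [] := dF x.
  + by apply: cvg_at_right_filter; exact: cF.
  + by apply: cvg_at_left_filter; exact: cF.
- by move=> x _; rewrite derive1E; have [_ ->] := dF x.
Qed.

(** A lower bound [f] may be negative while [g] is not, so the comparison passes through [pos f].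
    Only interior points are compared, since the bounds on columns and rows are available there
    only; removing the end points does not change the integrals. *)
Lemma le_integral_antiderivative F f g a b : a <= b ->
  (forall x : R, is_derive x 1 F (f x)) -> continuous f ->
  measurable_fun `[a, b] g -> (forall x, (a <= x <= b)%R -> (0 <= g x)%E) ->
  (forall x, (a < x < b)%R -> ((f x)%:E <= g x)%E) ->
  ((F b - F a)%:E <= \int[mu]_(x in `[a, b]) g x)%E.
Proof.
move=> ab dF cf mg g0 fg.
have cp : continuous (fun x => pos (f x)) by exact: continuous_pos'.
have ci (h : R -> R) : continuous h -> mu.-integrable `[a, b] (EFin \o h).
  move=> ch; apply: continuous_compact_integrable; first exact: segment_compact.
  by apply: continuous_subspaceT => x; exact: ch.
rewrite -(integral_antiderivative ab dF cf).
apply: (@le_trans _ _ (\int[mu]_(x in `[a, b]) (pos (f x))%:E)%E).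
  apply: le_integral => //; [exact: ci|exact: ci|].
  by move=> x _; rewrite lee_fin pos_ge.
have mp : measurable_fun setT (EFin \o (fun x => pos (f x))).
  apply/measurable_EFinP; exact: continuous_measurable_fun.
have sub : `]a, b[%classic `<=` `[a, b]%classic := @subset_itv_oo_cc _ _ a b.
rewrite (@integral_itv_bndoo _ a b (EFin \o (fun x => pos (f x))) true false); last first.
  exact: measurable_funS mp.
rewrite (@integral_itv_bndoo _ a b g true false); last exact: measurable_funS mg.
apply: ge0_le_integral => //.
- by move=> x _; rewrite lee_fin pos_ge0.
- exact: measurable_funS mp.
- exact: measurable_funS mg.
- move=> x /=; rewrite in_itv/= => xab.
  have /andP[ax xb] := xab.
  have [f0|/ltW f0] := leP 0 (f x); first by rewrite ge0_pos// fg.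
  by rewrite le0_pos// g0// !ltW.
Qed.

Lemma integral_itv_cat g a b c : a <= b -> b <= c ->
  measurable_fun `[a, c] g -> (forall x, (a <= x <= c)%R -> (0 <= g x)%E) ->
  (\int[mu]_(x in `[a, c]) g x =
   \int[mu]_(x in `[a, b]) g x + \int[mu]_(x in `[b, c]) g x)%E.
Proof.
move=> ab bc mg g0.
have ac := le_trans ab bc.
have E : `[a, c]%classic = `[a, b[%classic `|` `[b, c]%classic :> set R.
  by rewrite -itv_bndbnd_setU// bnd_simp.
rewrite E ge0_integral_setU.
- rewrite (@integral_itv_bndo_bndc _ _ _ g)//.
  by apply: measurable_funS mg => // x /=; rewrite !in_itv/= => /andP[-> /ltW/le_trans]; apply.
- exact: measurable_itv.
- exact: measurable_itv.
- by rewrite -E.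
- by move=> x; rewrite -E /= in_itv/=; exact: g0.
- apply/disj_setPS => x [/=]; rewrite !in_itv/= => /andP[_ xb] /andP[bx _].
  by move: (lt_le_trans xb bx); rewrite ltxx.
Qed.

End integral_bounds.

(** * Integration over the diamond by columns *)

Section diamond.
Context {R : realType}.
Local Notation mu := (@lebesgue_measure R).
Implicit Types (f g : plane R -> R) (a b c E u v : R).

Definition diamond : set (plane R) := [set z | `|z.1| + `|z.2| <= 1].

Lemma measurable_diamond : measurable diamond.
Proof.
have mn : measurable_fun setT (fun z : plane R => `|z.1| + `|z.2|).
  by apply: measurable_funD; exact: measurableT_comp.
have -> : diamond = (fun z : plane R => `|z.1| + `|z.2|) @^-1` `]-oo, 1].
  by apply/seteqP; split => z /=; rewrite in_itv.
by rewrite -[X in measurable X]setTI; exact: mn.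
Qed.

Definition column f u : \bar R :=
  (\int[mu]_(v in `[(- (1 - `|u|))%R, (1 - `|u|)%R]) (f (u, v))%:E)%E.

Definition energy f : \bar R := (\int[mu]_(u in `[(-1)%R, 1%R]) column f u)%E.

Definition dia_fun f : plane R -> \bar R := (EFin \o f) \_ diamond.

Lemma column_dia f u : column f u = (\int[mu]_v dia_fun f (u, v))%E.
Proof.
rewrite /column [LHS]integral_mkcond; apply: eq_integral => v _.
rewrite /dia_fun !patchE /=.
have -> : (v \in `[- (1 - `|u|), 1 - `|u|]%classic) = ((u, v) \in diamond).
  by apply/idP/idP; rewrite !inE /= in_itv/= => h;
     move: h; rewrite -ler_norml lerBrDl.
by [].
Qed.

Section measurable_integrand.
Variable f : plane R -> R.
Hypothesis mf : measurable_fun setT f.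
Hypothesis f0 : forall z, 0 <= f z.

Lemma measurable_dia_fun : measurable_fun setT (dia_fun f).
Proof.
apply/(measurable_restrictT _ measurable_diamond).
by apply: measurable_funTS; exact/measurable_EFinP.
Qed.

Lemma dia_fun_ge0 z : (0 <= dia_fun f z)%E.
Proof. by apply: erestrict_ge0 => y _; rewrite lee_fin. Qed.

Lemma measurable_column : measurable_fun setT (column f).
Proof.
rewrite (_ : column f = fubini_F mu (dia_fun f)).
  by apply: measurable_fun_fubini_tonelli_F; [exact: measurable_dia_fun|exact: dia_fun_ge0].
by apply/funext => u; rewrite column_dia.
Qed.

Lemma column_ge0 u : (0 <= column f u)%E.
Proof. by apply: integral_ge0 => v _; rewrite lee_fin. Qed.

Lemma energyE : energy f = (\int[mu]_u column f u)%E.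
Proof.
rewrite /energy [LHS]integral_mkcond; apply: eq_integral => u _.
rewrite patchE; case: ifPn => //; rewrite notin_setE /= in_itv/= -ler_norml => /negP.
rewrite -ltNge => u1; rewrite /column set_itv_ge ?integral_set0//.
by rewrite bnd_simp -ltNge; lra.
Qed.

Lemma energy_fubini : energy f = (\int[mu \x mu]_z dia_fun f z)%E.
Proof.
rewrite energyE fubini_tonelli1; [|exact: measurable_dia_fun|exact: dia_fun_ge0].
by apply: eq_integral => u _; rewrite column_dia.
Qed.

Lemma measurable_section u : measurable_fun setT (fun v => (f (u, v))%:E).
Proof.
apply/measurable_EFinP; apply: (measurableT_comp mf).
exact: measurable_pair1.
Qed.

Lemma column_ge F (g : R -> R) u : -1 <= u <= 1 ->
  (forall v : R, is_derive v 1 F (g v)) -> continuous g ->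
  (forall v, - (1 - `|u|) < v < 1 - `|u| -> g v <= f (u, v)) ->
  ((F (1 - `|u|) - F (- (1 - `|u|)))%:E <= column f u)%E.
Proof.
rewrite -ler_norml => u1 dF cg gf; apply: (le_integral_antiderivative _ dF cg) => //.
- by lra.
- exact: measurable_funTS (measurable_section u).
- by move=> v _; rewrite lee_fin.
Qed.

Lemma column_ge_split F1 F2 (g1 g2 : R -> R) u c :
  - (1 - `|u|) <= c <= 1 - `|u| ->
  (forall v : R, is_derive v 1 F1 (g1 v)) ->
  (forall v : R, is_derive v 1 F2 (g2 v)) -> continuous g1 -> continuous g2 ->
  (forall v, - (1 - `|u|) < v < c -> g1 v <= f (u, v)) ->
  (forall v, c < v < 1 - `|u| -> g2 v <= f (u, v)) ->
  ((F1 c - F1 (- (1 - `|u|)) + (F2 (1 - `|u|) - F2 c))%:E <= column f u)%E.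
Proof.
move=> /andP[c1 c2] d1 d2 k1 k2 h1 h2; rewrite /column.
have mfs a b : measurable_fun `[a, b] (fun v => (f (u, v))%:E).
  exact: measurable_funTS (measurable_section u).
rewrite (integral_itv_cat c1 c2)//; last by move=> v _; rewrite lee_fin.
rewrite EFinD leeD//.
- by apply: (le_integral_antiderivative c1 d1 k1) => // v _; rewrite lee_fin.
- by apply: (le_integral_antiderivative c2 d2 k2) => // v _; rewrite lee_fin.
Qed.

Lemma column_ge_even F (g : R -> R) u : -1 <= u <= 1 ->
  (forall v, f (u, - v) = f (u, v)) ->
  (forall v : R, is_derive v 1 F (g v)) -> continuous g ->
  (forall v, 0 < v < 1 - `|u| -> g v <= f (u, v)) ->
  ((2 * (F (1 - `|u|) - F 0))%:E <= column f u)%E.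
Proof.
rewrite -ler_norml => u1 fe dF cg gf.
have -> : 2 * (F (1 - `|u|) - F 0) = - F (- 0) - - F (- - (1 - `|u|)) + (F (1 - `|u|) - F 0).
  by rewrite oppr0 !opprK; ring.
apply: (@column_ge_split (fun v => - F (- v)) F (fun v => g (- v)) g) => //.
- by apply/andP; split; lra.
- move=> v.
  have := is_derive1N (@is_derive1_comp _ F -%R v _ _ (dF (- v)) (is_deriveNid v 1)).
  by rewrite mulrN1 opprK.
- by move=> v; apply: continuous_comp; [exact: opp_continuous|exact: cg].
- by move=> v /andP[h1 h2]; rewrite -fe gf//; apply/andP; split; lra.
Qed.

Definition columns_ge a b E := (E%:E <= \int[mu]_(u in `[a, b]) column f u)%E.

Lemma columns_ge_antiderivative F (g : R -> R) a b : a <= b ->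
  (forall u : R, is_derive u 1 F (g u)) -> continuous g ->
  (forall u, a < u < b -> ((g u)%:E <= column f u)%E) ->
  columns_ge a b (F b - F a).
Proof.
move=> ab dF cg gf; apply: (le_integral_antiderivative ab dF cg) => //.
- exact: measurable_funTS measurable_column.
- by move=> u _; exact: column_ge0.
Qed.

Lemma columns_ge_cat a b c E E' : a <= b -> b <= c ->
  columns_ge a b E -> columns_ge b c E' -> columns_ge a c (E + E').
Proof.
move=> ab bc h h'; rewrite /columns_ge (integral_itv_cat ab bc).
- by rewrite EFinD leeD.
- exact: measurable_funTS measurable_column.
- by move=> u _; exact: column_ge0.
Qed.

End measurable_integrand.

(** The diamond is symmetric in its two coordinates, so Tonelli's theorem applies. This is how rows
    are treated as columns. *)
Lemma energy_swap f : measurable_fun setT f -> (forall z, 0 <= f z) ->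
  energy f = energy (fun z => f (z.2, z.1)).
Proof.
move=> mf f0.
have ms : measurable_fun setT (fun z : plane R => f (z.2, z.1)).
  by apply: (measurableT_comp mf); exact: measurable_swap.
rewrite energy_fubini// energyE// fubini_tonelli2; [|exact: measurable_dia_fun|exact: dia_fun_ge0].
apply: eq_integral => v _; rewrite column_dia; apply: eq_integral => u _.
rewrite /dia_fun !patchE /=.
by have -> : ((u, v) \in diamond) = ((v, u) \in diamond)
  by apply/idP/idP; rewrite !inE /diamond/= addrC.
Qed.

Lemma le_energy f g : measurable_fun setT f -> measurable_fun setT g ->
  (forall z, 0 <= f z) -> (forall z, diamond z -> f z <= g z) ->
  (energy f <= energy g)%E.
Proof.
move=> mf mg f0 fg.
have g0 z : diamond z -> 0 <= g z by move=> /fg; exact: le_trans.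
rewrite /energy; apply: ge0_le_integral => //.
- by move=> u _; exact: column_ge0.
- exact: measurable_funTS (measurable_column mf f0).
(* [g] is known to be nonnegative on the diamond only; its truncation at zero has the same columns
   there and is nonnegative everywhere. *)
- apply: (@eq_measurable_fun _ _ _ _ _ (column (fun z => Num.max (g z) 0))).
    move=> u _; apply: eq_integral => v; rewrite inE /= in_itv/= -ler_norml => uv.
    by rewrite (max_idPl _)// g0// /diamond/=; lra.
  apply: measurable_funTS; apply: measurable_column; last by move=> z; rewrite le_max lexx orbT.
  exact: measurable_maxr.
- move=> u _; apply: ge0_le_integral => //.
  + by move=> v _; rewrite lee_fin.
  + exact: measurable_funTS (measurable_section mf u).
  + exact: measurable_funTS (measurable_section mg u).
  + move=> v /=; rewrite in_itv/= -ler_norml => uv.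
    by rewrite lee_fin fg// /diamond/=; lra.
Qed.

Lemma energyD f g : measurable_fun setT f -> measurable_fun setT g ->
  (forall z, 0 <= f z) -> (forall z, 0 <= g z) ->
  energy (fun z => f z + g z) = (energy f + energy g)%E.
Proof.
move=> mf mg f0 g0.
have ms := measurable_funD mf mg.
rewrite !energy_fubini//; last by move=> z; exact: addr_ge0.
rewrite -ge0_integralD//.
- apply: eq_integral => z _; rewrite /dia_fun !patchE /=.
  by case: ifPn; rewrite ?adde0.
- by move=> z _; exact: dia_fun_ge0.
- exact: measurable_dia_fun.
- by move=> z _; exact: dia_fun_ge0.
- exact: measurable_dia_fun.
Qed.

End diamond.

(** * From the square to the diamond *)

Section square.
Context {R : realType}.
Local Notation mu := (@lebesgue_measure R).
Local Notation J := (@unit_square R).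
Local Notation U := (@uniform_square R).
Implicit Types (a p q r s z : plane R).

Definition sqdist a z : R := (z.1 - a.1) ^+ 2 + (z.2 - a.2) ^+ 2.

Lemma sqdist_ge0 a z : 0 <= sqdist a z.
Proof. by rewrite addr_ge0// sqr_ge0. Qed.

Lemma edist_sqr z a : Defs.edist z a ^+ 2 = sqdist a z.
Proof. by rewrite /Defs.edist /enorm sqr_sqrtr// addr_ge0// sqr_ge0. Qed.

Lemma measurable_sqdist a : measurable_fun setT (sqdist a).
Proof.
by apply: measurable_funD; apply: measurable_funX; apply: measurable_funB.
Qed.

Lemma integral_uniform_square (f : plane R -> \bar R) :
  measurable_fun setT f -> (forall z, (0 <= f z)%E) ->
  (\int[U]_z f z = \int[mu]_x \int[mu]_y (f \_ J) (x, y))%E.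
Proof.
move=> mf f0.
have mJ := @measurable_unit_square R.
have UE (A : set (plane R)) : measurable A -> U A = (mu \x mu)%E (J `&` A).
  by move=> mA; rewrite /uniform_square integral_indic.
have -> : (\int[U]_z f z = \int[U]_(z in J) f z)%E.
  rewrite -(setUv J) ge0_integral_setU//.
  - rewrite [X in (_ + X)%E](_ : _ = 0%E) ?adde0//.
    apply: null_set_integral; [exact: measurableC|exact: measurable_funTS|].
    rewrite [LHS]UE; last exact: measurableC.
    by rewrite setICr measure0.
  - exact: measurableC.
  - exact: measurable_funTS.
  - by apply/disj_setPCl.
rewrite (@eq_measure_integral _ _ _ _ (mu \x mu)%E); last first.
  by move=> A mA AJ; rewrite [LHS]UE// setIidr.
rewrite [LHS]integral_mkcond [LHS]fubini_tonelli1//.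
- exact/(measurable_restrictT _ mJ)/measurable_funTS.
- by move=> z; exact: erestrict_ge0.
Qed.

Definition rot z : plane R := (z.1 + z.2 - 1, z.2 - z.1).
Definition unrot z : plane R := ((1 + z.1 - z.2) / 2, (1 + z.1 + z.2) / 2).

Lemma rotK : cancel rot unrot.
Proof. by move=> [x y]; rewrite /unrot /rot /=; congr pair; field. Qed.

Lemma unrotK : cancel unrot rot.
Proof. by move=> [x y]; rewrite /unrot /rot /=; congr pair; field. Qed.

Lemma sqdist_rot a z : sqdist (rot a) (rot z) = 2 * sqdist a z.
Proof. by rewrite /sqdist /rot /=; ring. Qed.

Lemma diamond_halves (x y : R) : `|x| + `|y| <= 1 <->
  0 <= (1 + x - y) / 2 <= 1 /\ 0 <= (1 + x + y) / 2 <= 1.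
Proof.
split.
  have n1 := ler_norm x; have n2 := ler_norm (- x).
  have n3 := ler_norm y; have n4 := ler_norm (- y).
  by rewrite !normrN in n2 n4 * => h; split; apply/andP; split; lra.
move=> [/andP[h1 h2] /andP[h3 h4]].
have abs t : `|t| = t \/ `|t| = - t :> R.
  by have [/ger0_norm|/ltr0_norm] := leP 0 t; [left|right].
by have [->|->] := abs x; have [->|->] := abs y; lra.
Qed.

Lemma diamond_unrot z : diamond z = J (unrot z).
Proof. by apply/propext; exact: diamond_halves. Qed.

(** The change of variables is made one coordinate at a time: the shear [y = v + x] preserves the
    measure, and [x = u / 2 + (1 - v) / 2] for fixed [v] contributes the factor [1 / 2]. Tonelli's
    theorem exchanges the order in between. *)
Lemma energy_square (f : plane R -> R) : measurable_fun setT f -> (forall z, 0 <= f z) ->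
  (\int[U]_z (f z)%:E = 2^-1%:E * energy (f \o unrot))%E.
Proof.
move=> mf f0.
have mJ := @measurable_unit_square R.
have mfE : measurable_fun setT (EFin \o f) by exact/measurable_EFinP.
rewrite integral_uniform_square//.
pose F : plane R -> \bar R := (EFin \o f) \_ J.
change (\int[mu]_x \int[mu]_y F (x, y) = 2^-1%:E * energy (f \o unrot))%E.
have mF : measurable_fun setT F.
  exact/(measurable_restrictT _ mJ)/measurable_funTS.
have F0 z : (0 <= F z)%E by apply: erestrict_ge0 => y _; rewrite lee_fin.
have shear : measurable_fun setT (fun z : plane R => (z.1, z.2 + z.1) : plane R).
  apply/measurable_fun_pairP; split; first exact: measurable_fst.
  by apply: measurable_funD; [exact: measurable_snd|exact: measurable_fst].
have E1 x : (\int[mu]_y F (x, y) = \int[mu]_v F (x, (v + x)%R))%E.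
  rewrite (@integral_affine _ 1 x (fun y => F (x, y)))//.
    by rewrite mul1e; apply: eq_integral => v _; rewrite mul1r.
  by apply: (measurableT_comp mF); exact: measurable_pair1.
under eq_integral do rewrite E1.
pose G := fun z : plane R => F (z.1, z.2 + z.1).
have mG : measurable_fun setT G by exact: measurableT_comp.
have G0 z : (0 <= G z)%E by exact: F0.
rewrite (@fubini_tonelli _ _ _ _ _ mu mu G)//.
have E2 v : (\int[mu]_x G (x, v) =
    2^-1%:E * \int[mu]_u dia_fun (f \o unrot) (u, v))%E.
  rewrite (@integral_affine _ 2^-1 ((1 - v) / 2) (fun x => G (x, v)))//.
  - congr (_ * _)%E; apply: eq_integral => u _.
    rewrite /G /F /dia_fun !patchE /=.
    have -> : (2^-1 * u + (1 - v) / 2, v + (2^-1 * u + (1 - v) / 2)) = unrot (u, v) :> plane R.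
      by rewrite /unrot /=; congr pair; field.
    by rewrite /in_mem /mem /= /in_set /= diamond_unrot.
  - by apply: (measurableT_comp mG); exact: measurable_pair2.
under eq_integral do rewrite E2.
have munrot : measurable_fun setT unrot.
  apply/measurable_fun_pairP; split; rewrite /comp /unrot /=;
    apply: measurable_funM => //.
  + by apply: measurable_funB; [apply: measurable_funD => //; exact: measurable_fst|exact: measurable_snd].
  + by apply: measurable_funD; [apply: measurable_funD => //; exact: measurable_fst|exact: measurable_snd].
have mfu : measurable_fun setT (f \o unrot) by exact: measurableT_comp.
have fu0 z : 0 <= (f \o unrot) z by exact: f0.
have mg := measurable_dia_fun mfu; have g0 := dia_fun_ge0 fu0.
have mG2 : measurable_fun setT (fun v => \int[mu]_u dia_fun (f \o unrot) (u, v))%E.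
  exact: (measurable_fun_fubini_tonelli_G _ mg g0).
have G20 v : (0 <= \int[mu]_u dia_fun (f \o unrot) (u, v))%E.
  by apply: integral_ge0 => u _; exact: g0.
have half0 : (0 <= (2^-1 : R)%:E)%E by rewrite lee_fin.
rewrite (ge0_integralZl mu measurableT mG2 (fun v _ => G20 v) half0).
by rewrite (energy_fubini mfu fu0) (fubini_tonelli2 _ mg g0).
Qed.

End square.

(** * Squared distance to the nearest of four points *)

Section min4.
Context {R : realType}.
Implicit Types (p q r s z : plane R) (a b c h u v x : R).

Definition min4 p q r s z : R :=
  Num.min (Num.min (sqdist p z) (sqdist q z)) (Num.min (sqdist r z) (sqdist s z)).

Lemma le_min4 x p q r s z : (x <= min4 p q r s z) =
  [&& x <= sqdist p z, x <= sqdist q z, x <= sqdist r z & x <= sqdist s z].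
Proof. by rewrite /min4 !le_min -andbA. Qed.

Lemma min4_ge0 p q r s z : 0 <= min4 p q r s z.
Proof. by rewrite le_min4 !sqdist_ge0. Qed.

Lemma measurable_min4 p q r s : measurable_fun setT (min4 p q r s).
Proof.
have -> : min4 p q r s = (sqdist p \min sqdist q) \min (sqdist r \min sqdist s) by [].
by apply: measurable_minr; apply: measurable_minr; exact: measurable_sqdist.
Qed.

Definition sym4 a b c h := min4 (a, 0) (b, 0) (c, h) (c, - h).

Lemma sym4_ge0 a b c h z : 0 <= sym4 a b c h z.
Proof. exact: min4_ge0. Qed.

Lemma measurable_sym4 a b c h : measurable_fun setT (sym4 a b c h).
Proof. exact: measurable_min4. Qed.

Lemma sym4_even a b c h u v : sym4 a b c h (u, - v) = sym4 a b c h (u, v).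
Proof.
have e1 : (- v - h) ^+ 2 = (v + h) ^+ 2 by ring.
have e2 : (- v + h) ^+ 2 = (v - h) ^+ 2 by ring.
rewrite /sym4 /min4 /sqdist /= !subr0 !opprK sqrrN e1 e2.
by congr Num.min; rewrite minC.
Qed.

(** In the upper half-plane [(c, -h)] is never nearer than [(c, h)]: the squared distances differ by
    [4 h v]. *)
Lemma le_sym4 x a b c h u v : 0 <= h -> 0 <= v ->
  x <= (u - a) ^+ 2 + v ^+ 2 -> x <= (u - b) ^+ 2 + v ^+ 2 ->
  x <= (u - c) ^+ 2 + (v - h) ^+ 2 -> x <= sym4 a b c h (u, v).
Proof.
move=> h0 v0 xa xb xc; rewrite le_min4 /sqdist /= !subr0 xa xb xc /= opprK.
apply: le_trans xc _; rewrite lerD2l -subr_ge0.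
rewrite (_ : _ - _ = 4 * (h * v)); last by ring.
by rewrite mulr_ge0// mulr_ge0.
Qed.

End min4.

(** * Column bound with one tent per axis centre *)

Section column_energy_bounds.
Context {R : realType}.
Implicit Types (a b c h u v m A B E : R).

Lemma energy_ge_halves (f : plane R -> R) E1 E2 :
  measurable_fun setT f -> (forall z, 0 <= f z) ->
  columns_ge f (-1) 0 E1 -> columns_ge f 0 1 E2 -> ((E1 + E2)%:E <= energy f)%E.
Proof. by move=> mf f0; apply: columns_ge_cat => //; lra. Qed.

(** The base is the squared distance to [(c, h)] in the upper half. Over it each axis centre gains
    the positive part of a function affine in [v]; subtracting both gains separately can only lower
    the bound. [YP] and [YQ] are the gains of [(a, 0)] and [(b, 0)] at the corners [(-1, 0)] and
    [(1, 0)]. At the grid the bound equals [1 / 6]. *)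
Lemma energy_tents a b c h (A := c - a) (B := b - c)
  (YP := 2 * A * (1 + c) - A ^+ 2 + h ^+ 2) (YQ := 2 * B * (1 - c) - B ^+ 2 + h ^+ 2) :
  0 < h -> 0 < A -> 0 < B ->
  ((2 * (1 / 3 - (2 * h / 3 - h ^+ 2 - c ^+ 2 + pos YP ^+ 3 / (24 * A * (A + h))
       + pos YQ ^+ 3 / (24 * B * (B + h)))))%:E <= energy (sym4 a b c h))%E.
Proof.
move=> h0 A0 B0.
pose lp u := c ^+ 2 - a ^+ 2 + h ^+ 2 - 2 * A * u.
pose lq u := c ^+ 2 - b ^+ 2 + h ^+ 2 + 2 * B * u.
(* The column ends at [w = 1 - |u|], but the gain of [(a, 0)] is integrated up to [1 + u] and that
   of [(b, 0)] up to [1 - u]. Both exceed [w], so the gains are overestimated, and one formula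
   serves both signs of [u]. *)
pose tents u := (pos (lp u - 2 * h * (1 + u)) ^+ 2 - pos (lp u) ^+ 2
  + (pos (lq u - 2 * h * (1 - u)) ^+ 2 - pos (lq u) ^+ 2)) / (4 * h).
pose T u := ((- pos (lp u - 2 * h * (1 + u)) ^+ 3 / (A + h) + pos (lp u) ^+ 3 / A)
  + (pos (lq u - 2 * h * (1 - u)) ^+ 3 / (B + h) - pos (lq u) ^+ 3 / B)) / (24 * h).
have col u w : -1 <= u <= 1 -> w = 1 - `|u| -> w <= 1 + u -> w <= 1 - u ->
  ((2 * ((u - c) ^+ 2 * w + ((w - h) ^+ 3 + h ^+ 3) / 3 + tents u))%:E
   <= column (sym4 a b c h) u)%E.
  move=> u1 wE w1 w2.
  have w0 : 0 <= w by rewrite wE subr_ge0 ler_norml.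
  pose F v := (u - c) ^+ 2 * v + (v - h) ^+ 3 / 3 + pos (lp u - 2 * h * v) ^+ 2 / (4 * h)
     + pos (lq u - 2 * h * v) ^+ 2 / (4 * h).
  apply: (@le_trans _ _ (2 * (F (1 - `|u|) - F 0))%:E).
    rewrite lee_fin -wE /F /tents.
    have sq x y : x <= y -> pos x ^+ 2 <= pos y ^+ 2.
      by move=> xy; rewrite ler_sqr ?nnegrE ?pos_ge0// le_pos.
    have hw1 : h * w <= h * (1 + u) by rewrite ler_pM2l.
    have hw2 : h * w <= h * (1 - u) by rewrite ler_pM2l.
    have s1 : pos (lp u - 2 * h * (1 + u)) ^+ 2 <= pos (lp u - 2 * h * w) ^+ 2.
      by apply: sq; lra.
    have s2 : pos (lq u - 2 * h * (1 - u)) ^+ 2 <= pos (lq u - 2 * h * w) ^+ 2.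
      by apply: sq; lra.
    rewrite !mulr0 !subr0 add0r sub0r.
    set p1 := pos _ ^+ 2 in s1 *; set p2 := pos _ ^+ 2 in s1 *.
    set q1 := pos _ ^+ 2 in s2 *; set q2 := pos _ ^+ 2 in s2 *.
    rewrite -subr_ge0 [X in 0 <= X](_ : _ = 2 * ((p2 - p1) + (q2 - q1)) / (4 * h)); last by field; lra.
    by rewrite divr_ge0//; lra.
  apply: (@column_ge_even _ _ (measurable_sym4 a b c h) (@sym4_ge0 _ a b c h) F
    (fun v => (u - c) ^+ 2 + (v - h) ^+ 2 - pos (lp u - 2 * h * v)
     - pos (lq u - 2 * h * v)) u u1).
  - by move=> v; exact: sym4_even.
  - rewrite /F; derive1.
    by field; lra.
  - by continuity.
  - rewrite -wE => v /andP[v0 vw].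
    have p1 := pos_ge0 (lp u - 2 * h * v); have p2 := pos_ge (lp u - 2 * h * v).
    have q1 := pos_ge0 (lq u - 2 * h * v); have q2 := pos_ge (lq u - 2 * h * v).
    set p := pos _ in p1 p2 *; set q := pos _ in q1 q2 *.
    by apply: le_sym4; rewrite /lp /lq /A /B in p2 q2; nra.
have cub (x y k l : R) : x <= y -> 0 < k -> k <= l -> pos x ^+ 3 / l <= pos y ^+ 3 / k.
  move=> xy k0 kl; have l0 := lt_le_trans k0 kl.
  have xy3 : pos x ^+ 3 <= pos y ^+ 3 by rewrite ler_pXn2r ?nnegrE ?pos_ge0// le_pos.
  apply: (le_trans (y := pos y ^+ 3 / l)); first by rewrite ler_pM2r ?invr_gt0.
  by rewrite ler_wpM2l ?exprn_ge0 ?pos_ge0// lef_pV2 ?posrE.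
(* What remains of the gain of [(a, 0)] at [u = 1] and of [(b, 0)] at [u = -1] has a favourable sign
   by [cub] and is dropped. *)
have T1 : - (pos YP ^+ 3 / (24 * A * (A + h)) + pos YQ ^+ 3 / (24 * B * (B + h)))
    <= T 1 - T (-1).
  have h1 : pos (lp 1 - 2 * h * (1 + 1)) ^+ 3 / (A + h) <= pos (lp 1) ^+ 3 / A.
    by apply: cub; lra.
  have h2 : pos (lq (-1) - 2 * h * (1 - -1)) ^+ 3 / (B + h) <= pos (lq (-1)) ^+ 3 / B.
    by apply: cub; lra.
  have lpE : lp (-1) = YP by rewrite /lp /YP /A; ring.
  have lqE : lq 1 = YQ by rewrite /lq /YQ /B; ring.
  rewrite /T lpE lqE !subrr !mulr0 !subr0.
  set x1 := pos _ ^+ 3 in h1 *; set y1 := pos (lp 1) ^+ 3 in h1 *.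
  set x2 := pos _ ^+ 3 in h2 *; set y2 := pos (lq (-1)) ^+ 3 in h2 *.
  rewrite -subr_ge0 [X in 0 <= X](_ : _ =
    ((y1 / A - x1 / (A + h)) + (y2 / B - x2 / (B + h))) / (24 * h)); last first.
    by field; lra.
  by rewrite divr_ge0//; lra.
pose F1 u := 2 * ((u - c) ^+ 3 * (1 + u) / 3 - (u - c) ^+ 4 / 12 + (1 + u - h) ^+ 4 / 12
  + h ^+ 3 * u / 3 + T u).
pose F2 u := 2 * ((u - c) ^+ 3 * (1 - u) / 3 + (u - c) ^+ 4 / 12 - (1 - u - h) ^+ 4 / 12
  + h ^+ 3 * u / 3 + T u).
apply: (@le_trans _ _ ((F1 0 - F1 (-1)) + (F2 1 - F2 0))%:E).
  rewrite lee_fin /F1 /F2.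
  set t0 := T 0; set t1 := T 1 in T1 *; set t2 := T (-1) in T1 *.
  set y1 := pos YP ^+ 3 / _ in T1 *; set y2 := pos YQ ^+ 3 / _ in T1 *.
  rewrite -subr_ge0 [X in 0 <= X](_ : _ = 2 * (t1 - t2 + (y1 + y2))); last by field.
  by lra.
apply: energy_ge_halves; [exact: measurable_sym4|exact: sym4_ge0| |].
- apply: (columns_ge_antiderivative (measurable_sym4 a b c h) (@sym4_ge0 _ a b c h)
    (g := fun u => 2 * ((u - c) ^+ 2 * (1 + u) + ((1 + u - h) ^+ 3 + h ^+ 3) / 3 + tents u))).
  + by lra.
  + rewrite /F1 /T /lp /lq /tents; derive1.
    by field; lra.
  + by rewrite /tents /lp /lq; continuity.
  + move=> u /andP[u1 u0]; apply: col; rewrite ?ltr0_norm//; lra.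
- apply: (columns_ge_antiderivative (measurable_sym4 a b c h) (@sym4_ge0 _ a b c h)
    (g := fun u => 2 * ((u - c) ^+ 2 * (1 - u) + ((1 - u - h) ^+ 3 + h ^+ 3) / 3 + tents u))).
  + by lra.
  + rewrite /F2 /T /lp /lq /tents; derive1.
    by field; lra.
  + by rewrite /tents /lp /lq; continuity.
  + move=> u /andP[u1 u0]; apply: col; rewrite ?gtr0_norm//; lra.
Qed.

End column_energy_bounds.

(** * Column bound with a half-axis in place of the axis centres *)

Section axis_energy_bound.
Context {R : realType}.
Implicit Types (a b c h u v m A B E : R).

(* The two axis centers are replaced by the whole half-axis u >= c0 and the gain of (c, +-h)
   over it is bounded by means of a tent function with apex m. *)
Lemma energy_half_axis a b c h c0 m A B t0
  (X0 := 2 * h * (1 + m) - h ^+ 2 + t0) (X1 := 2 * h - h ^+ 2 + t0 + 2 * B * m) :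
  0 < h -> 0 <= A -> 0 <= B -> -1 <= m <= 0 -> -1 <= c0 <= 0 ->
  (forall u, -1 < u < 1 -> pos (c0 - u) ^+ 2 <= (u - a) ^+ 2) ->
  (forall u, -1 < u < 1 -> pos (c0 - u) ^+ 2 <= (u - b) ^+ 2) ->
  (forall u, -1 < u < m -> 2 * A * (m - u) - t0 + pos (c0 - u) ^+ 2 <= (u - c) ^+ 2) ->
  (forall u, m < u < 1 -> 2 * B * (u - m) - t0 + pos (c0 - u) ^+ 2 <= (u - c) ^+ 2) ->
  ((2 * (1 / 6 + (1 + c0) ^+ 4 / 12 - pos X0 ^+ 3 / (24 * h * (h + A))
     + m * (X0 ^+ 2 + X0 * X1 + X1 ^+ 2) / (12 * h)
     - pos X1 ^+ 3 / (24 * h * (h + B))))%:E <= energy (sym4 a b c h))%E.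
Proof.
move=> h0 A0 B0 /andP[m1 m0] /andP[c1 c00] Ha Hb HL HR.
(* The squared distance to the half-axis is [v ^ 2 + pos (c0 - u) ^ 2]; the condition on [e] says
   that [(c, h)] gains at most [2 h v - e] over it. *)
have col u w e : -1 <= u <= 1 -> -1 < u < 1 -> w = 1 - `|u| ->
    e - h ^+ 2 + pos (c0 - u) ^+ 2 <= (u - c) ^+ 2 ->
  ((2 * (w ^+ 3 / 3 + pos (c0 - u) ^+ 2 * w - pos (2 * h * w - e) ^+ 2 / (4 * h)))%:E
   <= column (sym4 a b c h) u)%E.
  move=> u1 uo wE He.
  have w0 : 0 <= w by rewrite wE subr_ge0 ler_norml.
  pose F v := v ^+ 3 / 3 + pos (c0 - u) ^+ 2 * v - pos (2 * h * v - e) ^+ 2 / (4 * h).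
  apply: (@le_trans _ _ (2 * (F (1 - `|u|) - F 0))%:E).
    rewrite lee_fin -wE /F ler_pM2l// expr0n /= mul0r !mulr0 !add0r opprK lerDl.
    by rewrite divr_ge0 ?sqr_ge0//; lra.
  apply: (@column_ge_even _ _ (measurable_sym4 a b c h) (@sym4_ge0 _ a b c h) F
    (fun v => v ^+ 2 + pos (c0 - u) ^+ 2 - pos (2 * h * v - e)) u u1).
  - by move=> v; exact: sym4_even.
  - by rewrite /F; derive1; field; lra.
  - by continuity.
  - rewrite -wE => v /andP[v0 vw].
    have p1 := pos_ge0 (2 * h * v - e); have p2 := pos_ge (2 * h * v - e).
    have k1 := Ha u uo; have k2 := Hb u uo.
    set p := pos (2 * h * v - e) in p1 p2 *; set k := pos _ ^+ 2 in k1 k2 He *.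
    by apply: le_sym4; nra.
(* An antiderivative of [(1 + u) * pos (c0 - u) ^ 2]. *)
pose T u := - ((1 + u) * pos (c0 - u) ^+ 3 / 3) - (pos (c0 - u) ^+ 2) ^+ 2 / 12.
pose X u := 2 * h * (1 + u) - h ^+ 2 + t0.
pose s := 2 * (h - B).
pose F1 u := 2 * ((1 + u) ^+ 4 / 12 + T u
  - pos (X u - 2 * A * (m - u)) ^+ 3 / (24 * h * (h + A))).
(* On [[m, 0]] the squared positive part is bounded by the plain square of an affine function, with
   values [X0] at [m] and [X1] at [0]; this makes the subtracted term a polynomial. *)
pose F2 u := 2 * ((1 + u) ^+ 4 / 12 + T u
  - (X0 ^+ 2 * (u - m) + X0 * s * (u - m) ^+ 2 + s ^+ 2 * (u - m) ^+ 3 / 3) / (4 * h)).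
pose F3 u := 2 * (- (1 - u) ^+ 4 / 12
  + pos (2 * h * (1 - u) - h ^+ 2 + t0 - 2 * B * (u - m)) ^+ 3 / (24 * h * (h + B))).
have ms := measurable_sym4 a b c h; have s0 := @sym4_ge0 _ a b c h.
have P1 : columns_ge (sym4 a b c h) (-1) m (F1 m - F1 (-1)).
  apply: (@columns_ge_antiderivative _ _ ms s0 F1 (fun u => 2 * ((1 + u) ^+ 3 / 3
    + pos (c0 - u) ^+ 2 * (1 + u) - pos (X u - 2 * A * (m - u)) ^+ 2 / (4 * h))) _ _ m1).
  - by rewrite /F1 /T /X; derive1; field; lra.
  - by rewrite /X; continuity.
  - move=> u /andP[u1 um].
    have := @col u (1 + u) (h ^+ 2 - t0 + 2 * A * (m - u)).
    rewrite (_ : _ - (h ^+ 2 - t0 + _) = X u - 2 * A * (m - u)); last by rewrite /X; ring.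
    apply; [lra|lra|rewrite ltr0_norm; lra|].
    by have := HL u; rewrite u1 um => /(_ isT); lra.
have P2 : columns_ge (sym4 a b c h) m 0 (F2 0 - F2 m).
  apply: (@columns_ge_antiderivative _ _ ms s0 F2 (fun u => 2 * ((1 + u) ^+ 3 / 3
    + pos (c0 - u) ^+ 2 * (1 + u) - (X0 + s * (u - m)) ^+ 2 / (4 * h))) _ _ m0).
  - by rewrite /F2 /T; derive1; field; lra.
  - by continuity.
  - move=> u /andP[mu u0].
    apply: (@le_trans _ _ (2 * ((1 + u) ^+ 3 / 3 + pos (c0 - u) ^+ 2 * (1 + u)
       - pos (2 * h * (1 + u) - (h ^+ 2 - t0 + 2 * B * (u - m))) ^+ 2 / (4 * h)))%:E).
      rewrite lee_fin ler_pM2l// lerD2l lerN2 ler_pM2r ?invr_gt0; last by lra.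
      rewrite (_ : _ - (h ^+ 2 - t0 + _) = X0 + s * (u - m)); last by rewrite /X0 /s; ring.
      by rewrite -pos_mul; have := pos_ge0 (X0 + s * (u - m));
         have := pos_ge (X0 + s * (u - m)); have := pos_mul (X0 + s * (u - m)); nra.
    apply: col; [lra|lra|rewrite ltr0_norm; lra|].
    by have := HR u; rewrite mu (_ : u < 1 = true) => [/(_ isT)|]; lra.
have P3 : columns_ge (sym4 a b c h) 0 1 (F3 1 - F3 0).
  apply: (@columns_ge_antiderivative _ _ ms s0 F3 (fun u => 2 * ((1 - u) ^+ 3 / 3
    - pos (2 * h * (1 - u) - h ^+ 2 + t0 - 2 * B * (u - m)) ^+ 2 / (4 * h))) 0 1 ler01).
  - by rewrite /F3; derive1; field; lra.
  - by continuity.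
  - move=> u /andP[u0 u1].
    have c0u : pos (c0 - u) = 0 by rewrite le0_pos//; lra.
    have := @col u (1 - u) (h ^+ 2 - t0 + 2 * B * (u - m)).
    rewrite (_ : _ - (h ^+ 2 - t0 + _) = 2 * h * (1 - u) - h ^+ 2 + t0 - 2 * B * (u - m));
      last by ring.
    rewrite c0u expr0n /= mul0r !addr0; apply; [lra|lra|rewrite gtr0_norm; lra|].
    by have := HR u; rewrite c0u expr0n /= (_ : m < u < 1) => [/(_ isT)|]; lra.
apply: (@le_trans _ _ (((F1 m - F1 (-1)) + (F2 0 - F2 m)) + (F3 1 - F3 0))%:E); last first.
  apply: energy_ge_halves => //; exact: (columns_ge_cat ms s0 m1 m0 P1 P2).
rewrite lee_fin.
have T0 : T 0 = 0 by rewrite /T subr0 le0_pos// !expr0n /=; field.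
have TN : T (-1) = - (1 + c0) ^+ 4 / 12.
  by rewrite /T subrr opprK ge0_pos; [field|lra].
have h4 : 2 * h * (1 - 0) - h ^+ 2 + t0 - 2 * B * (0 - m) = X1 by rewrite /X1; ring.
have h5 : X m - 2 * A * (m - m) = X0 by rewrite /X /X0; ring.
rewrite /F1 /F2 /F3 h4 h5 T0 TN.
set Y0 := pos X0 ^+ 3; set Y1 := pos X1 ^+ 3.
set L := pos _ ^+ 3; set M := pos _ ^+ 3.
have L0 : 0 <= L by rewrite exprn_ge0 ?pos_ge0.
have M0 : 0 <= M by rewrite exprn_ge0 ?pos_ge0.
rewrite -subr_ge0 [X in 0 <= X](_ : _ = L / (12 * h * (h + A)) + M / (12 * h * (h + B))).
  by rewrite addr_ge0// divr_ge0// !mulr_ge0//; lra.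
rewrite /s /X1 /X0; field; lra.
Qed.

End axis_energy_bound.

(** * Row bound *)

Section row_energy_bound.
Context {R : realType}.
Implicit Types (a b c h u v m A B E : R).

Lemma energy_ge_even (f : plane R -> R) F (g : R -> R) :
  measurable_fun setT f -> (forall z, 0 <= f z) ->
  (forall u v, f (- u, v) = f (u, v)) ->
  (forall u : R, is_derive u 1 F (g u)) -> continuous g ->
  (forall u, 0 < u < 1 -> ((g u)%:E <= column f u)%E) ->
  ((2 * (F 1 - F 0))%:E <= energy f)%E.
Proof.
move=> mf f0 fe dF cg gf.
have -> : 2 * (F 1 - F 0) = (- F (- 0) - - F (- - 1)) + (F 1 - F 0).
  by rewrite oppr0 !opprK; ring.
apply: energy_ge_halves => //.
- apply: (columns_ge_antiderivative mf f0 (F := fun u => - F (- u)) (g := fun u => g (- u))).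
  + by rewrite oppr_le0 ler01.
  + move=> u; have := is_derive1N (@is_derive1_comp _ F -%R u _ _ (dF (- u)) (is_deriveNid u 1)).
    by rewrite mulrN1 opprK.
  + by move=> u; apply: continuous_comp; [exact: opp_continuous|exact: cg].
  + move=> u /andP[u1 u0]; apply: (le_trans (gf (- u) _)); first by apply/andP; split; lra.
    rewrite /column normrN.
    by under eq_integral do rewrite fe.
- by apply: (columns_ge_antiderivative mf f0 ler01 dF cg).
Qed.

Definition rows4 a b c h (z : plane R) := sym4 a b c h (z.2, z.1).

Lemma measurable_rows4 a b c h : measurable_fun setT (rows4 a b c h).
Proof. by apply: (measurableT_comp (measurable_sym4 _ _ _ _)); exact: measurable_swap. Qed.

Lemma rows4_ge0 a b c h z : 0 <= rows4 a b c h z.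
Proof. exact: sym4_ge0. Qed.

Lemma energy_rows4 a b c h : energy (sym4 a b c h) = energy (rows4 a b c h).
Proof. by rewrite energy_swap//; [exact: measurable_sym4|exact: sym4_ge0]. Qed.

(** In the row at height [v], [t] is the gain of [(c, h)] over the two axis centres at their
    midpoint [m]; away from [m] the gain over the nearer axis centre falls with slopes [2 A] and
    [2 B]. Since [pos x <= k + pos (x - k)], the total gain is at most [2 w k] plus the area of the
    tent above level [k]. The free level [k] matters when the tent is wider than the row. *)
Lemma row_ge a b c h v w k (A := c - a) (B := b - c) (m := (a + b) / 2) (d := (b - a) / 2)
    (t := 2 * h * v - h ^+ 2 + A * B) :
  0 < A -> 0 < B -> 0 <= h -> 0 <= v < 1 -> w = 1 - v -> 0 <= k ->
  ((2 * w * v ^+ 2 + 2 * w ^+ 3 / 3 + 2 * w * (m ^+ 2 + d ^+ 2)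
     - 2 * d * (w ^+ 2 + m ^+ 2 - pos (`|m| - w) ^+ 2) - 2 * w * k
     - pos (t - k) ^+ 2 * (1 / (4 * A) + 1 / (4 * B)))%:E <= column (rows4 a b c h) v)%E.
Proof.
move=> A0 B0 h0 /andP[v0 v1] wE k0.
have wv : 1 - `|v| = w by rewrite ger0_norm.
have w0 : 0 < w by rewrite wE; lra.
(* The row is cut at [m], or at the end nearest to [m] when [m] lies outside the row. *)
pose c' := Num.max (- w) (Num.min w m).
have c1 : - w <= c' by rewrite /c' le_max lexx.
have c2 : c' <= w by rewrite /c' ge_max ge_min lexx andbT; lra.
have cm u : u < c' -> -w < u -> u < m.
  by rewrite /c' !lt_max !lt_min => /orP[|/andP[]//]; lra.
have mc u : c' < u -> u < w -> m < u.
  by rewrite /c' gt_max gt_min => /andP[_ /orP[|]//]; lra.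
pose F1 u := (u - a) ^+ 3 / 3 + v ^+ 2 * u - k * u - pos (t - k - 2 * A * (m - u)) ^+ 2 / (4 * A).
pose F2 u := (u - b) ^+ 3 / 3 + v ^+ 2 * u - k * u + pos (t - k - 2 * B * (u - m)) ^+ 2 / (4 * B).
apply: (@le_trans _ _ (F1 c' - F1 (- (1 - `|v|)) + (F2 (1 - `|v|) - F2 c'))%:E); last first.
  apply: (@column_ge_split _ _ (measurable_rows4 a b c h) (@rows4_ge0 a b c h) F1 F2
    (fun u => (u - a) ^+ 2 + v ^+ 2 - k - pos (t - k - 2 * A * (m - u)))
    (fun u => (u - b) ^+ 2 + v ^+ 2 - k - pos (t - k - 2 * B * (u - m)))).
  - by rewrite wv c1 c2.
  - by rewrite /F1; derive1; field; lra.
  - by rewrite /F2; derive1; field; lra.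
  - by continuity.
  - by continuity.
  - rewrite wv => u /andP[wu uc]; have um := cm u uc wu.
    have p1 := pos_ge0 (t - k - 2 * A * (m - u)); have p2 := pos_ge (t - k - 2 * A * (m - u)).
    set p := pos _ in p1 p2 *.
    have abu : 0 <= (b - a) * (a + b - 2 * u).
      by apply: mulr_ge0; rewrite /A /B /m in A0 B0 um *; lra.
    by rewrite /rows4 /=; apply: le_sym4 => //; rewrite /t /A /B /m in p2; lra.
  - rewrite wv => u /andP[cu uw]; have um := mc u cu uw.
    have p1 := pos_ge0 (t - k - 2 * B * (u - m)); have p2 := pos_ge (t - k - 2 * B * (u - m)).
    set p := pos _ in p1 p2 *.
    have abu : 0 <= (b - a) * (2 * u - a - b).
      by apply: mulr_ge0; rewrite /A /B /m in A0 B0 um *; lra.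
    by rewrite /rows4 /=; apply: le_sym4 => //; rewrite /t /A /B /m in p2; lra.
rewrite wv lee_fin /F1 /F2.
have sq x y : x <= y -> pos x ^+ 2 <= pos y ^+ 2.
  by move=> xy; rewrite ler_sqr ?nnegrE ?pos_ge0// le_pos.
set q := pos (t - k) ^+ 2.
have d0 : 0 < d by rewrite /d /A /B in A0 B0 *; lra.
have aE : a = m - d by rewrite /m /d; field.
have bE : b = m + d by rewrite /m /d; field.
have qA : 0 <= pos (t - k - 2 * A * (m - - w)) ^+ 2 / (4 * A) by rewrite divr_ge0 ?sqr_ge0//; lra.
have qB : 0 <= pos (t - k - 2 * B * (w - m)) ^+ 2 / (4 * B) by rewrite divr_ge0 ?sqr_ge0//; lra.
have qqA : 0 <= q / (4 * A) by rewrite divr_ge0 ?sqr_ge0//; lra.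
have qqB : 0 <= q / (4 * B) by rewrite divr_ge0 ?sqr_ge0//; lra.
rewrite [q * _]mulrDr !mul1r.
set qa := pos _ ^+ 2 / _ in qA *; set qb := pos _ ^+ 2 / _ in qB *.
set qqa := q / _ in qqA *; set qqb := q / _ in qqB *.
rewrite aE bE.
have [wm|mw] := lerP w m.
  have c'E : c' = w by rewrite /c' (min_idPl wm); apply/max_idPr; lra.
  rewrite c'E.
  have pm : pos (`|m| - w) = m - w by rewrite ger0_norm ?ge0_pos; lra.
  have h1 : pos (t - k - 2 * A * (m - w)) ^+ 2 / (4 * A) <= qqa.
    by rewrite ler_pM2r ?invr_gt0 ?sq//; [rewrite lerBlDr lerDl mulr_ge0//; lra|lra].
  by rewrite pm -/qb; lra.
have [wm'|mw'] := lerP m (- w).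
  have c'E : c' = - w by rewrite /c' (min_idPr (ltW mw)); exact/max_idPl.
  rewrite c'E.
  have pm : pos (`|m| - w) = - m - w by rewrite ltr0_norm ?ge0_pos; lra.
  have h1 : pos (t - k - 2 * B * (- w - m)) ^+ 2 / (4 * B) <= qqb.
    by rewrite ler_pM2r ?invr_gt0 ?sq//; [rewrite lerBlDr lerDl mulr_ge0//; lra|lra].
  by rewrite pm -/qa; lra.
have c'E : c' = m by rewrite /c' (min_idPr (ltW mw)); apply/max_idPr; lra.
have pm : pos (`|m| - w) = 0 by rewrite le0_pos// subr_le0 ler_norml; lra.
by rewrite c'E subrr !mulr0 subr0 pm -/qqa -/qqb; lra.
Qed.

Lemma energy_rows a b c h (A := c - a) (B := b - c) (m := (a + b) / 2) (d := (b - a) / 2)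
    (P := A * B) (T := 2 * h - h ^+ 2 + P) :
  0 < A -> 0 < B -> 0 < h -> `|m| <= 1 ->
  ((2 * (1 / 3 + m ^+ 2 + d ^+ 2 - 2 * d / 3 - 2 * d * m ^+ 2 + 2 * d * `|m| ^+ 3 / 3
     - pos T ^+ 3 / (12 * h * (h + P / d))))%:E <= energy (sym4 a b c h))%E.
Proof.
move=> A0 B0 h0 m1; rewrite energy_rows4.
have d0 : 0 < d by rewrite /d /A /B in A0 B0 *; lra.
have P0 : 0 < P by exact: mulr_gt0.
(* [s] is the harmonic mean of [A] and [B]: a tent of height [x] with slopes [2 A] and [2 B] has
   area [x ^ 2 / (2 s)]. *)
pose s := P / d; have s0 : 0 < s by exact: divr_gt0.
have sE : 1 / (4 * A) + 1 / (4 * B) = 1 / (2 * s).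
  have dE : d = (A + B) / 2 by rewrite /d /A /B; field.
  by rewrite /s dE /P; field; lra.
pose t v := 2 * h * v - h ^+ 2 + P.
pose g v := 2 * (1 - v) * v ^+ 2 + 2 * (1 - v) ^+ 3 / 3 + 2 * (1 - v) * (m ^+ 2 + d ^+ 2)
     - 2 * d * ((1 - v) ^+ 2 + m ^+ 2 - pos (`|m| - (1 - v)) ^+ 2)
     - (pos (t v) ^+ 2 - pos (t v - 2 * (1 - v) * s) ^+ 2) / (2 * s).
pose F v := 2 * v ^+ 3 / 3 - v ^+ 4 / 2 - (1 - v) ^+ 4 / 6 - (1 - v) ^+ 2 * (m ^+ 2 + d ^+ 2)
     - 2 * d * (- (1 - v) ^+ 3 / 3 + m ^+ 2 * v - pos (`|m| - (1 - v)) ^+ 3 / 3)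
     - pos (t v) ^+ 3 / (12 * h * s) + pos (t v - 2 * (1 - v) * s) ^+ 3 / (12 * s * (h + s)).
apply: (@le_trans _ _ (2 * (F 1 - F 0))%:E); last first.
  apply: (@energy_ge_even _ F g (measurable_rows4 a b c h) (@rows4_ge0 a b c h)).
  - by move=> u v; rewrite /rows4 /= sym4_even.
  - by rewrite /F /g /t; derive1; field; lra.
  - by rewrite /g /t; continuity.
  - move=> v /andP[v0 v1].
    (* This level minimises [2 (1 - v) k + pos (t v - k) ^ 2 / (2 s)] over [k >= 0]. *)
    pose k := pos (t v - 2 * (1 - v) * s).
    apply: le_trans (@row_ge a b c h v (1 - v) k A0 B0 (ltW h0) _ erefl (pos_ge0 _)); last first.
      by rewrite ltW.
    rewrite lee_fin -/A -/B -/m -/d -/P -/(t v) sE /g -/k.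
    have w0 : 0 < (1 - v) * s by rewrite mulr_gt0//; lra.
    set x := pos (`|m| - _) ^+ 2.
    have kE : 2 * (1 - v) * k + pos (t v - k) ^+ 2 * (1 / (2 * s)) =
        (pos (t v) ^+ 2 - k ^+ 2) / (2 * s).
      rewrite /k; have [tw|/ltW tw] := lerP (t v - 2 * (1 - v) * s) 0.
        by rewrite (le0_pos tw) subr0 expr0n /= subr0 mulr0 add0r mul1r.
      rewrite (ge0_pos tw) !ge0_pos; [field|..]; lra.
    by lra.
rewrite lee_fin ler_pM2l//.
have t1 : t 1 = T by rewrite /t /T; ring.
rewrite /F t1 subrr !(mulr0, mul0r) !subr0 !expr0n /=.
have m3 : pos (`|m|) = `|m| by rewrite ge0_pos.
have m0 : pos (`|m| - 1) = 0 by rewrite le0_pos// subr_le0.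
rewrite m3 m0 expr0n /=.
have t0 : t 0 = P - h ^+ 2 by rewrite /t; ring.
(* The boundary terms at [v = 0] have a favourable sign and are dropped. *)
have y0 : pos (t 0 - 2 * 1 * s) ^+ 3 / (12 * s * (h + s)) <= pos (t 0) ^+ 3 / (12 * h * s).
  have hs : 0 < 12 * h * s by rewrite mulr_gt0// mulr_gt0.
  apply: (le_trans (y := pos (t 0) ^+ 3 / (12 * s * (h + s)))).
    have hs2 : 0 < 12 * s * (h + s) by rewrite mulr_gt0//; [rewrite mulr_gt0|lra].
    by rewrite ler_pM2r ?invr_gt0// ler_pXn2r ?nnegrE ?pos_ge0// le_pos//; lra.
  apply: ler_wpM2l; first by rewrite exprn_ge0 ?pos_ge0.
  have ss : 0 < s * s by exact: mulr_gt0.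
  have hs' : 12 * s * (h + s) = 12 * h * s + 12 * (s * s) by ring.
  by rewrite lef_pV2 ?posrE; rewrite ?hs'; lra.
set y1 := _ / (12 * s * _) in y0 *; set y2 := _ / (12 * h * s) in y0 *.
set p := pos T ^+ 3.
rewrite -subr_ge0 [X in 0 <= X](_ : _ = y2 - y1); first by rewrite subr_ge0.
by rewrite -/s; field; lra.
Qed.

End row_energy_bound.

(** * Positivity of integer polynomials on a square by bisection *)

Section z2r.
Context {R : realType}.

(** The coefficients are binary integers, on which [vm_compute] is efficient; [z2r] interprets them
    in the field. *)
Definition z2r (z : Z) : R := (int_of_Z z)%:~R.

Lemma z2r0 : z2r Z0 = 0. Proof. by []. Qed.
Lemma z2r1 : z2r (Zpos 1) = 1. Proof. by []. Qed.
Lemma z2rD x y : z2r (Z.add x y) = z2r x + z2r y.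
Proof. by rewrite /z2r (rmorphD int_of_Z) rmorphD. Qed.
Lemma z2rM x y : z2r (Z.mul x y) = z2r x * z2r y.
Proof. by rewrite /z2r (rmorphM int_of_Z) rmorphM. Qed.
Lemma z2rN x : z2r (Z.opp x) = - z2r x.
Proof. by rewrite /z2r (rmorphN int_of_Z) rmorphN. Qed.
Lemma z2r_pos p : 0 < z2r (Zpos p).
Proof. by rewrite /z2r ltr0z /= ltz_nat; apply/ssrnat.ltP; exact: Pos2Nat.is_pos. Qed.
Lemma z2r_gt0 z : Z.ltb 0 z -> 0 < z2r z.
Proof. by case: z => // p _; exact: z2r_pos. Qed.
Lemma z2r_min0 z : z2r (Z.min 0 z) <= 0 /\ z2r (Z.min 0 z) <= z2r z.
Proof.
have pp p := ltW (@z2r_pos p); case: z => [|p|p] /=; first by rewrite z2r0.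
  by split; [rewrite z2r0|exact: pp].
by split => //; rewrite -[Z.neg p]/(Z.opp (Zpos p)) z2rN oppr_le0.
Qed.

End z2r.

Section univariate.
Context {R : realType}.
Implicit Types (p q : seq Z) (s t : R).

Fixpoint eval1 p t : R := if p is a :: p' then z2r a + t * eval1 p' t else 0.

Fixpoint add1 p q := match p, q with
  | [::], _ => q
  | _, [::] => p
  | a :: p', b :: q' => Z.add a b :: add1 p' q'
  end.

Definition scale1 z p := map (Z.mul z) p.

Fixpoint mul1 p q := if p is a :: p' then add1 (scale1 a q) (Z0 :: mul1 p' q) else [::].

(** For [k] the power of two with exponent at least the degree, this is [k * p (t / 2)]: scaling by
    [k] keeps the coefficients integral and does not affect the sign. *)
Fixpoint half1 k p := if p is a :: p' then Z.mul k a :: half1 (Z.div2 k) p' else [::].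

Fixpoint shift1 p :=
  if p is a :: p' then let r := shift1 p' in add1 [:: a] (add1 r (Z0 :: r)) else [::].

Fixpoint neg1 p := if p is a :: p' then Z.add (Z.min 0 a) (neg1 p') else Z0.

Definition lower1 p := if p is a :: p' then Z.add a (neg1 p') else Z0.

Lemma eval_add1 p q t : eval1 (add1 p q) t = eval1 p t + eval1 q t.
Proof.
elim: p q => [|a p ih] [|b q] /=; rewrite ?add0r ?addr0//.
by rewrite ih z2rD; ring.
Qed.

Lemma eval_scale1 z p t : eval1 (scale1 z p) t = z2r z * eval1 p t.
Proof. by elim: p => [|a p ih] /=; [rewrite mulr0|rewrite ih z2rM; ring]. Qed.

Lemma eval_mul1 p q t : eval1 (mul1 p q) t = eval1 p t * eval1 q t.
Proof.
elim: p => [|a p ih] /=; first by rewrite mul0r.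
by rewrite eval_add1 eval_scale1 /= ih z2r0; ring.
Qed.

Lemma eval_shift1 p t : eval1 (shift1 p) t = eval1 p (t + 1).
Proof.
elim: p => // a p ih.
rewrite -[shift1 _]/(add1 [:: a] (add1 (shift1 p) (Z0 :: shift1 p))).
by rewrite !eval_add1 /= !ih z2r0; ring.
Qed.

Lemma neg1P p t : 0 <= t <= 1 -> z2r (neg1 p) <= 0 :> R /\ z2r (neg1 p) <= eval1 p t.
Proof.
move=> /andP[t0 t1]; elim: p => [|a p [ih1 ih2]] //=; rewrite z2rD.
have [m1 m2] := @z2r_min0 R a; split; first by lra.
by apply: lerD => //; nra.
Qed.

Lemma lower1P p t : 0 <= t <= 1 -> z2r (lower1 p) <= eval1 p t.
Proof.
case: p => [|a p] t01 //=; have [n1 n2] := neg1P p t01.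
by rewrite z2rD lerD2l; move/andP: t01 => [t0 t1]; nra.
Qed.

End univariate.

Section bivariate.
Context {R : realType}.
Implicit Types (p q : seq (seq Z)) (s t : R).

Fixpoint eval2 p s t : R := if p is a :: p' then eval1 a t + s * eval2 p' s t else 0.

Fixpoint add2 p q := match p, q with
  | [::], _ => q
  | _, [::] => p
  | a :: p', b :: q' => add1 a b :: add2 p' q'
  end.

Definition scale2 z p := map (mul1 z) p.

Fixpoint mul2 p q := if p is a :: p' then add2 (scale2 a q) ([::] :: mul2 p' q) else [::].

Fixpoint shift2 p :=
  if p is a :: p' then let r := shift2 p' in add2 [:: a] (add2 r ([::] :: r)) else [::].

Fixpoint half2 k p := if p is a :: p' then scale1 k a :: half2 (Z.div2 k) p' else [::].

Fixpoint neg2 p := if p is a :: p' then Z.add (neg1 a) (neg2 p') else Z0.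

Definition lower2 p := if p is a :: p' then Z.add (lower1 a) (neg2 p') else Z0.

Lemma eval_add2 p q s t : eval2 (add2 p q) s t = eval2 p s t + eval2 q s t.
Proof.
elim: p q => [|a p ih] [|b q] /=; rewrite ?add0r ?addr0//.
by rewrite ih eval_add1; ring.
Qed.

Lemma eval_scale2 z p s t : eval2 (scale2 z p) s t = eval1 z t * eval2 p s t.
Proof. by elim: p => [|a p ih] /=; [rewrite mulr0|rewrite ih eval_mul1; ring]. Qed.

Lemma eval_mul2 p q s t : eval2 (mul2 p q) s t = eval2 p s t * eval2 q s t.
Proof.
elim: p => [|a p ih] /=; first by rewrite mul0r.
by rewrite eval_add2 eval_scale2 /= ih; ring.
Qed.

Lemma eval_shift2 p s t : eval2 (shift2 p) s t = eval2 p (s + 1) t.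
Proof.
elim: p => // a p ih.
rewrite -[shift2 _]/(add2 [:: a] (add2 (shift2 p) ([::] :: shift2 p))).
by rewrite !eval_add2 /= !ih; ring.
Qed.

Lemma lower2P p s t : 0 <= s <= 1 -> 0 <= t <= 1 -> z2r (lower2 p) <= eval2 p s t.
Proof.
move=> /andP[s0 s1] t01; case: p => [|a p] //=; rewrite z2rD.
apply: lerD; first exact: lower1P.
have [] : z2r (neg2 p) <= 0 :> R /\ z2r (neg2 p) <= eval2 p s t.
  elim: p => [|b p [ih1 ih2]] //=; rewrite z2rD.
  have [n1 n2] := neg1P b t01; split; first by lra.
  by apply: lerD => //; nra.
by move=> h1 h2; nra.
Qed.

Fixpoint pow2 n : Z := if n is n'.+1 then Z.mul 2 (pow2 n') else Zpos 1.

Lemma z2r_pow2S n : z2r (pow2 n.+1) = 2 * z2r (pow2 n) :> R.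
Proof. by have -> : pow2 n.+1 = Z.mul 2 (pow2 n) by []; rewrite z2rM. Qed.

Lemma div2_pow2 n : Z.div2 (pow2 n.+1) = pow2 n.
Proof. by rewrite [pow2 n.+1]/(Z.mul 2 (pow2 n)); case: (pow2 n). Qed.

Lemma z2r_pow2_gt0 n : 0 < z2r (pow2 n) :> R.
Proof. by elim: n => [|n ih]; [rewrite z2r1|rewrite z2r_pow2S mulr_gt0]. Qed.

Lemma eval_half1 (n : nat) (p : seq Z) t : (size p <= n.+1)%N ->
  eval1 (half1 (pow2 n) p) t = z2r (pow2 n) * eval1 p (t / 2).
Proof.
have E k a (q : seq Z) : eval1 (half1 (pow2 k) (a :: q)) t =
    z2r (pow2 k) * z2r a + t * eval1 (half1 (Z.div2 (pow2 k)) q) t.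
  by rewrite -z2rM.
have E' a (q : seq Z) : eval1 (a :: q) (t / 2) = z2r a + (t / 2) * eval1 q (t / 2) by [].
elim: n p => [|n ih] [|a p] sp; rewrite ?E ?E'; try by rewrite mulr0.
  by case: p sp => // _; rewrite /= z2r1; ring.
by rewrite div2_pow2 ih// z2r_pow2S; field.
Qed.

Lemma eval_half2 (n : nat) p s t : (size p <= n.+1)%N ->
  eval2 (half2 (pow2 n) p) s t = z2r (pow2 n) * eval2 p (s / 2) t.
Proof.
have E k a (q : seq (seq Z)) : eval2 (half2 (pow2 k) (a :: q)) s t =
    z2r (pow2 k) * eval1 a t + s * eval2 (half2 (Z.div2 (pow2 k)) q) s t.
  by rewrite -eval_scale1.
have E' a (q : seq (seq Z)) : eval2 (a :: q) (s / 2) t = eval1 a t + (s / 2) * eval2 q (s / 2) t by [].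
elim: n p => [|n ih] [|a p] sp; rewrite ?E ?E'; try by rewrite mulr0.
  by case: p sp => // _; rewrite /= z2r1; ring.
by rewrite div2_pow2 ih// z2r_pow2S; field.
Qed.

Definition halfx p := half2 (pow2 (size p).-1) p.
Definition leny p := foldr maxn 0 (map size p).
Definition halfy p := map (half1 (pow2 (leny p).-1)) p.

Lemma halfx_gt0 p s t : 0 < eval2 (halfx p) s t -> 0 < eval2 p (s / 2) t.
Proof.
rewrite /halfx eval_half2; last by case: p.
by rewrite pmulr_rgt0 ?z2r_pow2_gt0.
Qed.

Lemma halfy_gt0 p s t : 0 < eval2 (halfy p) s t -> 0 < eval2 p s (t / 2).
Proof.
have E (n : nat) : (leny p <= n.+1)%N ->
    eval2 (map (half1 (pow2 n)) p) s t = z2r (pow2 n) * eval2 p s (t / 2).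
  elim: p => [|a p ih] /=; first by rewrite mulr0.
  by rewrite /leny /= geq_max => /andP[sa sp]; rewrite ih// eval_half1//; ring.
rewrite /halfy E; last by case: leny.
by rewrite pmulr_rgt0 ?z2r_pow2_gt0.
Qed.

Lemma eval_shifty p s t : eval2 (map shift1 p) s t = eval2 p s (t + 1).
Proof. by elim: p => //= a p ih; rewrite eval_shift1 ih. Qed.

(* On [0,1]^2 a polynomial exceeds its constant term plus its negative coefficients;
   the square is bisected, alternately in both directions, until this bound decides. *)
Fixpoint box_check n (b : bool) (ps : seq (seq (seq Z))) : bool :=
  (* Conditionals replace boolean connectives, whose two arguments [vm_compute] would both
     evaluate. *)
  if has (fun p => Z.ltb 0 (lower2 p)) ps then true else
  if n is n'.+1 then
    let qs := map (if b then halfx else halfy) ps in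
    if box_check n' (~~ b) qs
    then box_check n' (~~ b) (map (if b then shift2 else map shift1) qs) else false
  else false.

(** Only some polynomial of the list has to be positive at each point. This allows another
    certificate near a zero of the first polynomial, and the exclusion of part of the rectangle by
    the negation of a side condition. *)
Lemma box_checkP n b ps s t : box_check n b ps -> 0 <= s <= 1 -> 0 <= t <= 1 ->
  has (fun p => 0 < eval2 p s t) ps.
Proof.
have low qs (x y : R) : has (fun p => Z.ltb 0 (lower2 p)) qs -> 0 <= x <= 1 -> 0 <= y <= 1 ->
    has (fun p => 0 < eval2 p x y) qs.
  move=> + x01 y01; apply: sub_has => p /z2r_gt0 h.
  exact: lt_le_trans (h R) (lower2P p x01 y01).
elim: n b ps s t => [|n ih] b ps s t /=; case: ifPn => //; try by move=> h _; exact: low.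
move=> _; case: ifPn => // h1 h2 s01 t01.
have m2 : 2 / 2 = 1 :> R by rewrite divff.
case: b h1 h2 => /= h1 h2.
- have [s2|s2] := lerP s (1 / 2).
    have s2' : 0 <= 2 * s <= 1 by move/andP: s01 => [? ?]; apply/andP; split; lra.
    move: (ih _ _ _ _ h1 s2' t01); rewrite has_map; apply: sub_has => p /= /halfx_gt0.
    by rewrite mulrAC m2 mul1r.
  have s2' : 0 <= 2 * s - 1 <= 1 by move/andP: s01 => [? ?]; apply/andP; split; lra.
  move: (ih _ _ _ _ h2 s2' t01); rewrite !has_map; apply: sub_has => p /=.
  by rewrite eval_shift2 subrK => /halfx_gt0; rewrite mulrAC m2 mul1r.
- have [s2|s2] := lerP t (1 / 2).
    have s2' : 0 <= 2 * t <= 1 by move/andP: t01 => [? ?]; apply/andP; split; lra.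
    move: (ih _ _ _ _ h1 s01 s2'); rewrite has_map; apply: sub_has => p /= /halfy_gt0.
    by rewrite mulrAC m2 mul1r.
  have s2' : 0 <= 2 * t - 1 <= 1 by move/andP: t01 => [? ?]; apply/andP; split; lra.
  move: (ih _ _ _ _ h2 s01 s2'); rewrite !has_map; apply: sub_has => p /=.
  by rewrite eval_shifty subrK => /halfy_gt0; rewrite mulrAC m2 mul1r.
Qed.

End bivariate.

(** * Reflection of rational polynomials in two variables *)

Inductive pexpr :=
  | PX | PY | PNum of positive | PInv of positive
  | PAdd of pexpr & pexpr | PMul of pexpr & pexpr | POpp of pexpr | PExp of pexpr & nat.

Section expressions.
Context {R : realType}.

Fixpoint peval (e : pexpr) (x y : R) : R := match e with
  | PX => x
  | PY => y
  | PNum n => z2r (Zpos n)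
  | PInv d => (z2r (Zpos d))^-1
  | PAdd e1 e2 => peval e1 x y + peval e2 x y
  | PMul e1 e2 => peval e1 x y * peval e2 x y
  | POpp e1 => - peval e1 x y
  | PExp e1 n => peval e1 x y ^+ n
  end.

(* A pair (p, d) stands for the polynomial p / d. *)
Definition fpoly := (seq (seq Z) * positive)%type.

Definition feval (f : fpoly) (s t : R) : R := eval2 f.1 s t / z2r (Zpos f.2).

(** Fractions are never reduced, so a common denominator is kept to limit growth. *)
Definition fadd (f g : fpoly) : fpoly :=
  if Pos.eqb f.2 g.2 then (add2 f.1 g.1, f.2) else
  (add2 (scale2 [:: Zpos g.2] f.1) (scale2 [:: Zpos f.2] g.1), Pos.mul f.2 g.2).
Definition fmul (f g : fpoly) : fpoly := (mul2 f.1 g.1, Pos.mul f.2 g.2).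
Definition fopp (f : fpoly) : fpoly := (scale2 [:: Z.neg 1] f.1, f.2).
Definition fcst (n : Z) (d : positive) : fpoly := ([:: [:: n]], d).
Fixpoint fexp (f : fpoly) n : fpoly := if n is n'.+1 then fmul f (fexp f n') else fcst 1 1.

Fixpoint pnorm (x y : fpoly) (e : pexpr) : fpoly := match e with
  | PX => x
  | PY => y
  | PNum n => fcst (Zpos n) 1
  | PInv d => fcst 1 d
  | PAdd e1 e2 => fadd (pnorm x y e1) (pnorm x y e2)
  | PMul e1 e2 => fmul (pnorm x y e1) (pnorm x y e2)
  | POpp e1 => fopp (pnorm x y e1)
  | PExp e1 n => fexp (pnorm x y e1) n
  end.

Lemma z2r_neq0 p : z2r (Zpos p) != 0 :> R.
Proof. by rewrite gt_eqF// z2r_pos. Qed.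

Lemma feval_mul f g s t : feval (fmul f g) s t = feval f s t * feval g s t.
Proof.
rewrite /feval /fmul /= eval_mul2 -[Z.pos (_ * _)]/(Z.mul (Zpos f.2) (Zpos g.2)) z2rM.
by field; rewrite !z2r_neq0.
Qed.

Lemma feval_add f g s t : feval (fadd f g) s t = feval f s t + feval g s t.
Proof.
rewrite /feval /fadd; case: ifPn => [/Pos.eqb_eq E|_].
  by rewrite /= eval_add2 E mulrDl.
rewrite /= eval_add2 !eval_scale2 /= !mulr0 !addr0
  -[Z.pos (_ * _)]/(Z.mul (Zpos f.2) (Zpos g.2)) z2rM.
by field; rewrite !z2r_neq0.
Qed.

Lemma feval_cst n d s t : feval (fcst n d) s t = z2r n / z2r (Zpos d).
Proof. by rewrite /feval /= !mulr0 !addr0. Qed.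

Lemma feval_opp f s t : feval (fopp f) s t = - feval f s t.
Proof.
by rewrite /feval /= eval_scale2 /= mulr0 addr0 -[Z.neg 1]/(Z.opp 1) z2rN z2r1 mulN1r mulNr.
Qed.

Lemma feval_pnorm fx fy e s t :
  feval (pnorm fx fy e) s t = peval e (feval fx s t) (feval fy s t).
Proof.
elim: e => //= [n|d|e1 ih1 e2 ih2|e1 ih1 e2 ih2|e1 ih1|e1 ih1 n].
- by rewrite feval_cst z2r1 divr1.
- by rewrite feval_cst z2r1 mul1r.
- by rewrite feval_add ih1 ih2.
- by rewrite feval_mul ih1 ih2.
- by rewrite feval_opp ih1.
- elim: n => [|n ih]; first by rewrite /= feval_cst expr0 z2r1 divr1.
  by rewrite /= feval_mul ih ih1 exprS.
Qed.

(* The affine map from [0,1] onto [n1/d1, n2/d2]. *)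
Definition fitv (b : bool) (i : (Z * positive) * (Z * positive)) : fpoly :=
  fadd (fcst i.1.1 i.1.2) (fmul (fadd (fcst i.2.1 i.2.2) (fopp (fcst i.1.1 i.1.2)))
    (if b then [:: [::]; [:: Zpos 1]] else [:: [:: Z0; Zpos 1]], 1%positive)).

Definition cst2r (c : Z * positive) : R := z2r c.1 / z2r (Zpos c.2).

(** Denominators are positive, so the numerators decide. *)
Definition boxed n es i j :=
  box_check n true (map (fun e => (pnorm (fitv true i) (fitv false j) e).1) es).

Lemma boxedP n es i j (x y : R) : boxed n es i j ->
  cst2r i.1 <= x <= cst2r i.2 -> cst2r j.1 <= y <= cst2r j.2 ->
  cst2r i.1 < cst2r i.2 -> cst2r j.1 < cst2r j.2 ->
  has (fun e => 0 < peval e x y) es.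
Proof.
move=> chk /andP[x1 x2] /andP[y1 y2] i12 j12.
pose s := (x - cst2r i.1) / (cst2r i.2 - cst2r i.1).
pose t := (y - cst2r j.1) / (cst2r j.2 - cst2r j.1).
have s01 : 0 <= s <= 1.
  rewrite /s divr_ge0 ?subr_ge0// ?(ltW i12)// ler_pdivrMr ?subr_gt0// mul1r lerD2r.
  by [].
have t01 : 0 <= t <= 1.
  rewrite /t divr_ge0 ?subr_ge0// ?(ltW j12)// ler_pdivrMr ?subr_gt0// mul1r lerD2r.
  by [].
have ev b k s' t' : feval (fitv b k) s' t' =
    cst2r k.1 + (cst2r k.2 - cst2r k.1) * (if b then s' else t').
  rewrite /fitv !(feval_add, feval_mul, feval_opp, feval_cst); congr (_ + _ * _).
  by case: b; rewrite /feval /= !mulr0 !addr0 ?z2r0 ?z2r1 ?divr1 ?add0r ?mulr1.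
have := box_checkP chk s01 t01; rewrite has_map; apply: sub_has => e /=.
have ex : cst2r i.1 + (cst2r i.2 - cst2r i.1) * s = x.
  by rewrite /s mulrCA divff ?mulr1 ?subrKC// subr_eq0 gt_eqF.
have ey : cst2r j.1 + (cst2r j.2 - cst2r j.1) * t = y.
  by rewrite /t mulrCA divff ?mulr1 ?subrKC// subr_eq0 gt_eqF.
have := feval_pnorm (fitv true i) (fitv false j) e s t; rewrite !ev ex ey => <-.
by move=> h; rewrite /feval divr_gt0 ?z2r_pos.
Qed.

Lemma boxed1 n e (i j : (Z * positive) * (Z * positive)) (x1 x2 y1 y2 x y : R) :
  boxed n [:: e] i j -> cst2r i.1 = x1 -> cst2r i.2 = x2 -> cst2r j.1 = y1 -> cst2r j.2 = y2 ->
  x1 <= x <= x2 -> y1 <= y <= y2 -> x1 < x2 -> y1 < y2 -> 0 < peval e x y.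
Proof.
by move=> h <- <- <- <- hx hy h1 h2; have := boxedP h hx hy h1 h2; rewrite /= orbF.
Qed.

Lemma boxed3 n e e' e'' (i j : (Z * positive) * (Z * positive)) (x1 x2 y1 y2 x y : R) :
  boxed n [:: e; e'; e''] i j ->
  cst2r i.1 = x1 -> cst2r i.2 = x2 -> cst2r j.1 = y1 -> cst2r j.2 = y2 ->
  x1 <= x <= x2 -> y1 <= y <= y2 -> x1 < x2 -> y1 < y2 ->
  [\/ 0 < peval e x y, 0 < peval e' x y | 0 < peval e'' x y].
Proof.
move=> h <- <- <- <- hx hy h1 h2; have := boxedP h hx hy h1 h2; rewrite /= orbF.
by move/or3P.
Qed.

End expressions.

Ltac positive_of_nat n := eval vm_compute in (Pos.of_nat n).

Ltac reify x y t := lazymatch t with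
  | x => constr:(PX)
  | y => constr:(PY)
  | (?a + ?b)%R => let a' := reify x y a in let b' := reify x y b in constr:(PAdd a' b')
  | (?a * ?b)%R => let a' := reify x y a in let b' := reify x y b in constr:(PMul a' b')
  | (- ?a)%R => let a' := reify x y a in constr:(POpp a')
  | (?a ^+ ?n)%R => let a' := reify x y a in constr:(PExp a' n)
  | (?n%:R^-1)%R => let p := positive_of_nat n in constr:(PInv p)
  | (?n%:R)%R => let p := positive_of_nat n in constr:(PNum p)
  | 1%R => constr:(PNum 1%positive)
  end.

Ltac cst_of t := lazymatch t with
  | (- ?a)%R => lazymatch cst_of a with (?n, ?d) => let m := eval compute in (Z.opp n) in constr:((m, d)) end
  | (?n%:R / ?d%:R)%R => let p := positive_of_nat n in let q := positive_of_nat d in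
      constr:((Z.pos p, q))
  | 0%R => constr:((Z0, 1%positive))
  | 1%R => constr:((Z.pos 1, 1%positive))
  | (1 / ?d%:R)%R => let q := positive_of_nat d in constr:((Z.pos 1, q))
  | (?n%:R)%R => let p := positive_of_nat n in constr:((Z.pos p, 1%positive))
  end.

Ltac cst_eq := first
  [ reflexivity
  | rewrite /cst2r -?mulNr; reflexivity
  | rewrite /cst2r -[z2r (Z.pos (snd _))]/(1%R) divr1; reflexivity ].

Ltac box3_with x y t t' t'' x1 x2 y1 y2 n :=
  let a := cst_of x1 in let b := cst_of x2 in let c := cst_of y1 in let d := cst_of y2 in
  let e := reify x y t in let e' := reify x y t' in let e'' := reify x y t'' in
  change [\/ is_true (0 < peval e x y)%R, is_true (0 < peval e' x y)%R
    | is_true (0 < peval e'' x y)%R];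
  apply: (@boxed3 _ n e e' e'' (a, b) (c, d) x1 x2 y1 y2);
  [vm_compute; reflexivity | cst_eq | cst_eq | cst_eq | cst_eq |
   apply/andP; split; lra | apply/andP; split; lra | lra | lra].

Ltac box_with x y t x1 x2 y1 y2 n :=
  let a := cst_of x1 in let b := cst_of x2 in let c := cst_of y1 in let d := cst_of y2 in
  let e := reify x y t in
  change (is_true (0 < peval e x y)%R);
  apply: (@boxed1 _ n e (a, b) (c, d) x1 x2 y1 y2);
  [vm_compute; reflexivity | cst_eq | cst_eq | cst_eq | cst_eq |
   apply/andP; split; lra | apply/andP; split; lra | lra | lra].

(* [box x y in x1 x2 y1 y2 with n] proves [0 < t] for a polynomial [t] in the variables
   [x] and [y] with rational coefficients on [x1, x2] * [y1, y2] with at most [n] bisections. *)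
Tactic Notation "box" constr(x) constr(y) "in" constr(x1) constr(x2) constr(y1) constr(y2)
  "with" constr(n) :=
  lazymatch goal with |- is_true (0 < ?t)%R => box_with x y t x1 x2 y1 y2 n
  | |- [\/ is_true (0 < ?t)%R, is_true (0 < ?t')%R | is_true (0 < ?t'')%R] =>
    box3_with x y t t' t'' x1 x2 y1 y2 n end.

(** * The polynomial inequalities behind the energy bounds *)

Section scalar_inequalities.
Context {R : realType}.
Implicit Types (a b c d h m s t x y A B M P : R).

(** The difference [p] of the two sides vanishes at [(1 / 2, 1 / 2)]. It equals [3 a (h + a) (h + a
    - 1) ^ 2 + (h - a) ^ 2 S], so [S > 0] suffices near that point; bisection shows that elsewhere
    [p > 0], [S > 0] or the third hypothesis fails. The ratio [13 / 8] is that of [h <= 13 / 20] to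
    [A >= 2 / 5] in [diagonal_tents], and [5 / 32] that of [h >= 1 / 4] to [1 + c <= 8 / 5]. *)
Lemma tent_ineq a h : 1 / 16 <= a <= 1 -> 5 / 32 <= h <= 1 -> 8 * h <= 13 * a ->
  (2 * a - a ^+ 2 + h ^+ 2) ^+ 3 <= 24 * a * (a + h) * (1 / 8 - h / 3 + h ^+ 2 / 2) /\
  ((2 * a - a ^+ 2 + h ^+ 2) ^+ 3 = 24 * a * (a + h) * (1 / 8 - h / 3 + h ^+ 2 / 2) ->
   a = 1 / 2 /\ h = 1 / 2).
Proof.
move=> /andP[a1 a2] /andP[h1 h2] ah.
pose p := 3 * a * (h + a - 1) ^+ 2 * (h + a) + (h - a) ^+ 2 *
  ((2 - 3 * h - 3 * (h + a - 1) ^+ 2) * (h + a) - (h - a) * (h + a - 1) ^+ 3).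
pose S := (2 - 3 * h - 3 * (h + a - 1) ^+ 2) * (h + a) - (h - a) * (h + a - 1) ^+ 3.
have E : 24 * a * (a + h) * (1 / 8 - h / 3 + h ^+ 2 / 2) -
    (2 * a - a ^+ 2 + h ^+ 2) ^+ 3 = p by rewrite /p; field.
suff [p0 pE] : 0 <= p /\ (p = 0 -> a = 1 / 2 /\ h = 1 / 2).
  by split; [lra|move=> eq; apply: pE; lra].
have : [\/ 0 < p, 0 < S | 0 < 8 * h - 13 * a].
  rewrite /p /S.
  box a h in (1 / 16 : R) (1 : R) (5 / 32 : R) (1 : R) with 30%N.
move=> [p0|S0|]; last by lra.
  by split; [exact: ltW|move=> p0'; move: p0; rewrite p0' ltxx].
have pS : p = 3 * a * (h + a) * (h + a - 1) ^+ 2 + (h - a) ^+ 2 * S.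
  by rewrite /p /S; ring.
have k0 : 0 < 3 * a * (h + a) by rewrite !mulr_gt0//; lra.
have q1 : 0 <= 3 * a * (h + a) * (h + a - 1) ^+ 2 by rewrite mulr_ge0 ?sqr_ge0 ?ltW.
have q2 : 0 <= (h - a) ^+ 2 * S by rewrite mulr_ge0 ?sqr_ge0 ?ltW.
split; first by rewrite pS addr_ge0.
rewrite pS => /eqP; rewrite paddr_eq0// => /andP[/eqP f1 /eqP f2].
have g1 : (h + a - 1) ^+ 2 = 0 by apply: (mulfI (lt0r_neq0 k0)); rewrite f1 mulr0.
have g2 : (h - a) ^+ 2 = 0 by apply: (mulIf (lt0r_neq0 S0)); rewrite f2 mul0r.
move/eqP: g1; rewrite sqrf_eq0 => /eqP e1; move/eqP: g2; rewrite sqrf_eq0 => /eqP e2.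
by split; lra.
Qed.

(** Both sides are homogeneous of degree four, so dividing by [M] reduces this to [tent_ineq]. It
    bounds one tent of [energy_tents], with [M = 1 + c] or [M = 1 - c]. *)
Lemma tent_le A M h : 0 < M -> A <= M -> 5 / 32 * M <= h <= M -> 8 * h <= 13 * A ->
  (2 * A * M - A ^+ 2 + h ^+ 2) ^+ 3 / (24 * A * (A + h)) <=
    M ^+ 4 / 8 - h * M ^+ 3 / 3 + h ^+ 2 * M ^+ 2 / 2 /\
  ((2 * A * M - A ^+ 2 + h ^+ 2) ^+ 3 / (24 * A * (A + h)) =
    M ^+ 4 / 8 - h * M ^+ 3 / 3 + h ^+ 2 * M ^+ 2 / 2 -> A = M / 2 /\ h = M / 2).
Proof.
move=> M0 AM /andP[h1 h2] Ah.
have A0 : 0 < A by lra.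
have h0 : 0 < h by lra.
have M6 : 0 < M ^+ 6 by rewrite exprn_gt0.
have D0 : 0 < 24 * A * (A + h) by rewrite !mulr_gt0//; lra.
have [||| le eq] := @tent_ineq (A / M) (h / M).
- by rewrite ler_pdivlMr// ler_pdivrMr//; lra.
- by rewrite ler_pdivlMr// ler_pdivrMr//; lra.
- by rewrite !mulrA ler_pM2r ?invr_gt0.
have e1 : (2 * A * M - A ^+ 2 + h ^+ 2) ^+ 3 =
    M ^+ 6 * (2 * (A / M) - (A / M) ^+ 2 + (h / M) ^+ 2) ^+ 3 by field; lra.
have e2 : (M ^+ 4 / 8 - h * M ^+ 3 / 3 + h ^+ 2 * M ^+ 2 / 2) * (24 * A * (A + h)) =
    M ^+ 6 * (24 * (A / M) * (A / M + h / M) * (1 / 8 - h / M / 3 + (h / M) ^+ 2 / 2)).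
  by field; lra.
split; first by rewrite ler_pdivrMr// e1 e2 ler_pM2l.
move=> /(congr1 (fun z => z * (24 * A * (A + h)))); rewrite divfK ?gt_eqF// e1 e2.
move=> /(mulfI (lt0r_neq0 M6)) /eq[aE hE]; split.
  by rewrite -[A](divfK (lt0r_neq0 M0)) aE; field.
by rewrite -[h](divfK (lt0r_neq0 M0)) hE; field.
Qed.

(** Away from the equality case [h = M / 2] there is room for a square. It makes up for small [h],
    where the two instances of [tent_le] together can fall short when [c != 0]. *)
Lemma tent_le_wide A M h : 0 < M -> M / 4 <= A <= M -> 3 / 20 * M <= h <= 37 / 100 * M ->
  (2 * A * M - A ^+ 2 + h ^+ 2) ^+ 3 / (24 * A * (A + h)) <=
    M ^+ 4 / 8 - h * M ^+ 3 / 3 + h ^+ 2 * M ^+ 2 / 2 - M ^+ 2 * (h - M / 2) ^+ 2 / 10.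
Proof.
move=> M0 /andP[A1 A2] /andP[h1 h2].
have A0 : 0 < A by lra.
have h0 : 0 < h by lra.
have M6 : 0 < M ^+ 6 by rewrite exprn_gt0.
have D0 : 0 < 24 * A * (A + h) by rewrite !mulr_gt0//; lra.
have key a x : 1 / 4 <= a <= 1 -> 3 / 20 <= x <= 37 / 100 ->
  0 < 24 * a * (a + x) * (1 / 8 - x / 3 + x ^+ 2 / 2 - (x - 1 / 2) ^+ 2 / 10)
    - (2 * a - a ^+ 2 + x ^+ 2) ^+ 3.
  move=> /andP[a1 a2] /andP[x1 x2].
  box a x in (1 / 4 : R) (1 : R) (3 / 20 : R) (37 / 100 : R) with 30%N.
have a01 : 1 / 4 <= A / M <= 1 by rewrite ler_pdivlMr// ler_pdivrMr//; lra.
have h01 : 3 / 20 <= h / M <= 37 / 100 by rewrite ler_pdivlMr// ler_pdivrMr//; lra.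
have le := key _ _ a01 h01.
rewrite ler_pdivrMr//.
rewrite -subr_ge0 [X in 0 <= X](_ : _ = M ^+ 6 * (24 * (A / M) * (A / M + h / M) *
   (1 / 8 - h / M / 3 + (h / M) ^+ 2 / 2 - (h / M - 1 / 2) ^+ 2 / 10)
    - (2 * (A / M) - (A / M) ^+ 2 + (h / M) ^+ 2) ^+ 3)); last by field; lra.
by rewrite mulr_ge0 ?ltW.
Qed.

(** By convexity of the cube on nonnegative reals, an affine majorant at the ends of an interval is
    one inside; strictness at [x0] survives because [P < x1]. In the row bound this eliminates [P]
    and leaves polynomials in [h] and [d]. *)
Lemma cube_chord_lt d q x0 x1 P u v : 0 <= d -> 0 <= q + x0 -> x0 <= P < x1 ->
  d * (q + x0) ^+ 3 < u + v * x0 -> d * (q + x1) ^+ 3 <= u + v * x1 ->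
  d * (q + P) ^+ 3 < u + v * P.
Proof.
move=> d0 q0 /andP[x0P Px1] h0 h1.
have conv : 0 <= (x1 - P) * (P - x0) * (x1 - x0) * (3 * q + x0 + x1 + P).
  by rewrite !mulr_ge0//; lra.
have convE : (x1 - P) * (q + x0) ^+ 3 + (P - x0) * (q + x1) ^+ 3 - (x1 - x0) * (q + P) ^+ 3
   = (x1 - P) * (P - x0) * (x1 - x0) * (3 * q + x0 + x1 + P) by ring.
have g0 : (x1 - P) * (d * (q + x0) ^+ 3) < (x1 - P) * (u + v * x0).
  by rewrite ltr_pM2l//; lra.
have g1 : (P - x0) * (d * (q + x1) ^+ 3) <= (P - x0) * (u + v * x1).
  by rewrite ler_wpM2l//; lra.
have x01 : 0 < x1 - x0 by lra.
have dconv : 0 <= d * ((x1 - P) * (P - x0) * (x1 - x0) * (3 * q + x0 + x1 + P)).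
  exact: mulr_ge0.
rewrite -(ltr_pM2l x01); rewrite -convE in dconv.
have e1 : (x1 - x0) * (d * (q + P) ^+ 3) = (x1 - P) * (d * (q + x0) ^+ 3) +
   (P - x0) * (d * (q + x1) ^+ 3) - d * ((x1 - P) * (q + x0) ^+ 3 +
   (P - x0) * (q + x1) ^+ 3 - (x1 - x0) * (q + P) ^+ 3) by ring.
have e2 : (x1 - x0) * (u + v * P) = (x1 - P) * (u + v * x0) + (P - x0) * (u + v * x1) by ring.
by rewrite e1 e2; lra.
Qed.

(** This and the next inequality are what [energy_half_axis] requires in the last two cases of
    [diagonal_near], with denominators cleared. *)
Lemma axis_ineq_near c h : - (7 / 40) <= c <= - (1 / 20) -> 1 / 4 <= h <= 1 ->
  0 < (2 + 2 * (39 / 40 + c) ^+ 4) * (h - 2 * c) - h * (2 - h) ^+ 3 * (h - 2 * c)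
    - h ^+ 2 * (2 - h) ^+ 3.
Proof.
move=> /andP[c1 c2] /andP[h1 h2].
box c h in (- (7 / 40) : R) (- (1 / 20) : R) (1 / 4 : R) (1 : R) with 30%N.
Qed.

Lemma axis_ineq_far c h : - (3 / 4) <= c <= - (7 / 40) -> 1 / 4 <= h <= 1 ->
  0 < (2 + 2 * (39 / 40 + c) ^+ 4) * h * (h + 7 / 20)
    - h ^+ 2 * (h + 7 / 20) * (2 + 2 * c + 7 / 20 - h) ^+ 3
    + 2 * (c + 7 / 40) * (h + 7 / 20) * ((h * (2 + 2 * c + 7 / 20 - h)) ^+ 2
      + h * (2 + 2 * c + 7 / 20 - h) * (2 * h - h ^+ 2 + 49 / 400 + 7 / 10 * c)
      + (2 * h - h ^+ 2 + 49 / 400 + 7 / 10 * c) ^+ 2)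
    - (2 * h - h ^+ 2 + 49 / 400 + 7 / 10 * c) ^+ 3.
Proof.
move=> /andP[c1 c2] /andP[h1 h2].
box c h in (- (3 / 4) : R) (- (7 / 40) : R) (1 / 4 : R) (1 : R) with 30%N.
Qed.

(** The case [P = d ^ 2] of the row bound. Its polynomial is that of [tent_ineq] with [(a, h)]
    replaced by [(h, d)], so the same decomposition applies. *)
Lemma rows_ineq_sqr h d : 1 / 4 <= h <= 1 -> 0 < d <= 1 / 2 ->
  (2 * h - h ^+ 2 + d ^+ 2) ^+ 3 <= 12 * h * (h + d) * (1 / 4 - 2 * d / 3 + d ^+ 2) /\
  ((2 * h - h ^+ 2 + d ^+ 2) ^+ 3 = 12 * h * (h + d) * (1 / 4 - 2 * d / 3 + d ^+ 2) ->
   h = 1 / 2 /\ d = 1 / 2).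
Proof.
move=> /andP[h1 h2] /andP[d1 d2].
pose p := 3 * h * (h + d - 1) ^+ 2 * (h + d) + (d - h) ^+ 2 *
  ((2 - 3 * d - 3 * (h + d - 1) ^+ 2) * (h + d) - (d - h) * (h + d - 1) ^+ 3).
pose S := (2 - 3 * d - 3 * (h + d - 1) ^+ 2) * (h + d) - (d - h) * (h + d - 1) ^+ 3.
have E : 12 * h * (h + d) * (1 / 4 - 2 * d / 3 + d ^+ 2) -
    (2 * h - h ^+ 2 + d ^+ 2) ^+ 3 = p by rewrite /p; field.
suff [p0 pE] : 0 <= p /\ (p = 0 -> h = 1 / 2 /\ d = 1 / 2).
  by split; [lra|move=> eq; apply: pE; lra].
(* The last alternative is repeated to fit the three-polynomial form of [box]. *)
have : [\/ 0 < p, 0 < S | 0 < S].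
  rewrite /p /S.
  box h d in (1 / 4 : R) (1 : R) (0 : R) (1 / 2 : R) with 30%N.
move=> S0; have {S0} : 0 < p \/ 0 < S by case: S0; auto.
move=> [p0|S0].
  by split; [exact: ltW|move=> p0'; move: p0; rewrite p0' ltxx].
have pS : p = 3 * h * (h + d) * (h + d - 1) ^+ 2 + (d - h) ^+ 2 * S.
  by rewrite /p /S; ring.
have k0 : 0 < 3 * h * (h + d) by rewrite !mulr_gt0//; lra.
have q1 : 0 <= 3 * h * (h + d) * (h + d - 1) ^+ 2 by rewrite mulr_ge0 ?sqr_ge0 ?ltW.
have q2 : 0 <= (d - h) ^+ 2 * S by rewrite mulr_ge0 ?sqr_ge0 ?ltW.
split; first by rewrite pS addr_ge0.
rewrite pS => /eqP; rewrite paddr_eq0// => /andP[/eqP f1 /eqP f2].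
have g1 : (h + d - 1) ^+ 2 = 0 by apply: (mulfI (lt0r_neq0 k0)); rewrite f1 mulr0.
have g2 : (d - h) ^+ 2 = 0 by apply: (mulIf (lt0r_neq0 S0)); rewrite f2 mul0r.
move/eqP: g1; rewrite sqrf_eq0 => /eqP e1; move/eqP: g2; rewrite sqrf_eq0 => /eqP e2.
by split; lra.
Qed.

(** The left end [P = 0] of the chord. It is confined to small [d]: at [d = 1 / 3], [h = 1 / 2] it
    would read [5 / 3 > 27 / 16]. For larger [d] the chord starts at [P = 3 / 80 * d], which is
    [rows_ineq_low]. *)
Lemma rows_ineq_zero h d : 0 <= h <= 1 -> 0 <= d <= 1 / 5 ->
  0 < 12 * (1 / 4 - 2 * d / 3 + d ^+ 2) - h * (2 - h) ^+ 3.
Proof.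
move=> /andP[h1 h2] /andP[d1 d2].
box h d in (0 : R) (1 : R) (0 : R) (1 / 5 : R) with 30%N.
Qed.

Lemma rows_ineq_low h d : 1 / 4 <= h <= 1 -> 1 / 5 <= d <= 1 / 2 ->
  0 < 12 * h * (h + 3 / 80) * (1 / 4 - 2 * d / 3 + d ^+ 2)
    - (2 * h - h ^+ 2 + 3 / 80 * d) ^+ 3.
Proof.
move=> /andP[h1 h2] /andP[d1 d2].
box h d in (1 / 4 : R) (1 : R) (1 / 5 : R) (1 / 2 : R) with 30%N.
Qed.

(* Upper bounds on the range d >= 1/2 for the defect m^2 (2 d - 1) - 2 d |m|^3 / 3 caused by
   an eccentric pair of axis centers. *)
Definition eccentricity d : R :=
  if d <= 31 / 50 then 17 / 20 * (d - 1 / 2) ^+ 2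
  else if d <= 3 / 4 then 49 / 20 / 100 - 9 / 10 * (d - 73 / 100) ^+ 2 else 49 / 20 / 100.

Lemma le_eccentricity d x : 1 / 2 <= d <= 1 -> 0 <= x <= 1 - d ->
  x ^+ 2 * (2 * d - 1) - 2 * d * x ^+ 3 / 3 <= eccentricity d.
Proof.
move=> /andP[d1 d2] /andP[x0 x1]; rewrite /eccentricity.
have [d3|d3] := lerP d (31 / 50).
  (* For fixed [d] the cubic is largest at [d x = 2 e], with value [8 e ^ 3 / (3 d ^ 2)]; [h1] is
     this maximality and [h2] compares the value with [17 / 20 * e ^ 2]. *)
  pose e := d - 1 / 2; pose y := d * x.
  have h1 : 0 <= (y - 2 * e) ^+ 2 * (y + e).
    by rewrite mulr_ge0 ?sqr_ge0// /y /e addr_ge0 ?mulr_ge0//; lra.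
  have h2 : 0 <= e ^+ 2 * (255 / 100 * d ^+ 2 - 8 * e).
    have h3 : 0 <= (31 / 50 - d) * (8 - 255 / 100 * (d + 31 / 50)) by apply: mulr_ge0; lra.
    by apply: mulr_ge0; [exact: sqr_ge0|rewrite /e; lra].
  have dd : 0 < d ^+ 2 by rewrite exprn_gt0//; lra.
  rewrite -(ler_pM2l dd) -subr_ge0 [X in 0 <= X](_ : _ =
    e ^+ 2 * (255 / 100 * d ^+ 2 - 8 * e) / 3 + 2 / 3 * ((y - 2 * e) ^+ 2 * (y + e))).
    by lra.
  by rewrite /e /y; field.
have [dE|dn1] := eqVneq d 1.
  have -> : x = 0 by lra.
  by rewrite dE; case: ifP => [?|_]; lra.
have d4 : d < 1 by rewrite lt_neqAle dn1.
(* This turns the triangle [0 <= x <= 1 - d] into a rectangle. *)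
pose s := x / (1 - d).
have xs : x = (1 - d) * s by rewrite /s; field; lra.
have s01 : 0 <= s <= 1.
  have d10 : 0 < 1 - d by lra.
  by rewrite /s divr_ge0//= ?ler_pdivrMr//; lra.
clearbody s; move/andP: s01 => [s0 s1]; rewrite {x0 x1}xs.
case: ifP => d5; rewrite -subr_ge0 ltW//.
  box d s in (31 / 50 : R) (3 / 4 : R) (0 : R) (1 : R) with 30%N.
box d s in (31 / 50 : R) (1 : R) (0 : R) (1 : R) with 30%N.
Qed.

Lemma rows_ineq_wide_zero h d : 1 / 4 <= h <= 1 -> 1 / 2 <= d <= 1 ->
  0 < 12 * (1 / 4 - 2 * d / 3 + d ^+ 2 - eccentricity d) - h * (2 - h) ^+ 3.
Proof.
move=> /andP[h1 h2] /andP[d1 d2]; rewrite /eccentricity.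
case: ifP => d3; first by box h d in (1 / 4 : R) (1 : R) (1 / 2 : R) (31 / 50 : R) with 30%N.
have {}d3 : 31 / 50 < d by rewrite ltNge d3.
case: ifP => d4; first by box h d in (1 / 4 : R) (1 : R) (31 / 50 : R) (3 / 4 : R) with 30%N.
have {}d4 : 3 / 4 < d by rewrite ltNge d4.
box h d in (1 / 4 : R) (1 : R) (3 / 4 : R) (1 : R) with 30%N.
Qed.

(** For [d >= 1 / 2], [4 / 5 * d - 4 / 25] is the largest product [A B] with [A + B = 2 d] and one
    factor at most [2 / 5]. *)
Lemma rows_ineq_wide h d : 1 / 4 <= h <= 1 -> 1 / 2 <= d <= 1 ->
  0 < 12 * h * (h * d + (4 / 5 * d - 4 / 25)) * (1 / 4 - 2 * d / 3 + d ^+ 2 - eccentricity d)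
    - d * (2 * h - h ^+ 2 + (4 / 5 * d - 4 / 25)) ^+ 3.
Proof.
move=> /andP[h1 h2] /andP[d1 d2]; rewrite /eccentricity.
case: ifP => d3; first by box h d in (1 / 4 : R) (1 : R) (1 / 2 : R) (31 / 50 : R) with 30%N.
have {}d3 : 31 / 50 < d by rewrite ltNge d3.
case: ifP => d4; first by box h d in (1 / 4 : R) (1 : R) (31 / 50 : R) (3 / 4 : R) with 30%N.
have {}d4 : 3 / 4 < d by rewrite ltNge d4.
box h d in (1 / 4 : R) (1 : R) (3 / 4 : R) (1 : R) with 30%N.
Qed.

Lemma rows_ineq_wide_sqr h d : 13 / 20 <= h <= 1 -> 1 / 2 <= d <= 1 ->
  0 < 12 * h * (h * d + d ^+ 2) * (1 / 4 - 2 * d / 3 + d ^+ 2 - eccentricity d)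
    - d * (2 * h - h ^+ 2 + d ^+ 2) ^+ 3.
Proof.
move=> /andP[h1 h2] /andP[d1 d2]; rewrite /eccentricity.
case: ifP => d3; first by box h d in (13 / 20 : R) (1 : R) (1 / 2 : R) (31 / 50 : R) with 30%N.
have {}d3 : 31 / 50 < d by rewrite ltNge d3.
case: ifP => d4; first by box h d in (13 / 20 : R) (1 : R) (31 / 50 : R) (3 / 4 : R) with 30%N.
have {}d4 : 3 / 4 < d by rewrite ltNge d4.
box h d in (13 / 20 : R) (1 : R) (3 / 4 : R) (1 : R) with 30%N.
Qed.

(** The square is the improvement of [tent_le_wide] for [M = 1 + c]; the subtracted terms are the
    possible deficit when the sharp tent bounds for [1 + c] and [1 - c] are added. *)
Lemma tents_ineq_low c h : 0 <= c <= 3 / 5 -> 1 / 4 <= h <= 37 / 100 ->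
  0 < (1 + c) ^+ 2 * (h - (1 + c) / 2) ^+ 2 / 10
    - (c ^+ 2 * (1 / 2 - 2 * h + h ^+ 2) + c ^+ 4 / 4).
Proof.
move=> /andP[c1 c2] /andP[h1 h2].
box c h in (0 : R) (3 / 5 : R) (1 / 4 : R) (37 / 100 : R) with 30%N.
Qed.

End scalar_inequalities.

(** * Symmetric configurations settled by the half-axis bound *)

Ltac real_lra := lazymatch goal with |- context[EFin] => idtac | |- forall u, _ => idtac | _ => lra end.

Section diagonal.
Context {R : realType}.
Local Notation mu := (@lebesgue_measure R).
Implicit Types (a b c d h u v : R).

Lemma energy_reflect (f : plane R -> R) :
  measurable_fun setT f -> (forall z, 0 <= f z) ->
  energy f = energy (fun z => f (- z.1, z.2)).
Proof.
move=> mf f0.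
have mg : measurable_fun setT (fun z : plane R => f (- z.1, z.2)).
  apply: (measurableT_comp mf); apply/measurable_fun_pairP; split; rewrite /comp /=.
    by apply: measurableT_comp => //; exact: measurable_fst.
  exact: measurable_snd.
have g0 z : 0 <= f (- z.1, z.2) by exact: f0.
rewrite (energyE f) (energyE (fun z => f (- z.1, z.2))).
rewrite (integral_oppE (measurable_column mf f0)); last exact: column_ge0.
by apply: eq_integral => u _; rewrite /column normrN.
Qed.

Lemma energy_sym4_opp a b c h : energy (sym4 a b c h) = energy (sym4 (- b) (- a) (- c) h).
Proof.
rewrite energy_reflect; [|exact: measurable_sym4|exact: sym4_ge0].
congr energy; apply/funext => -[u v]; rewrite /sym4 /min4 /sqdist /=.
have e x : (- u - x) ^+ 2 = (u - - x) ^+ 2 by ring.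
by rewrite !e [Num.min ((u - - a) ^+ 2 + _) _]minC.
Qed.

Let gt_sixth (E : \bar R) (x : R) : 1 / 12 < x -> ((2 * x)%:E <= E)%E -> ((1 / 6)%:E < E)%E.
Proof. by move=> x1; apply: lt_le_trans; rewrite lte_fin; lra. Qed.

(** With [c0 = -1] the half-axis contains the whole axis of the diamond. The tangents of slope [2 h]
    and [- 2 h] to [(u - c) ^ 2] make the slope [s] on [[m, 0]] vanish, and the bound becomes twice
    [1 / 6 - h (1 + c) ^ 2 (1 - 2 c) / 3], at least twice [1 / 6 - h / 3]. This exceeds [1 / 6]
    exactly when [h < 1 / 4]. *)
Lemma diagonal_low a b c h : 0 < h < 1 / 4 -> -1 <= c <= 1 ->
  ((1 / 6)%:E < energy (sym4 a b c h))%E.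
Proof.
move=> /andP[h0 h1] c1.
wlog c0 : a b c c1 / c <= 0.
  move=> H; have [|/ltW c0] := lerP c 0; first exact: H.
  by rewrite energy_sym4_opp; apply: H; rewrite ?oppr_le0//; lra.
have ax u : -1 < u < 1 -> pos (-1 - u) ^+ 2 = 0.
  by move=> u1; rewrite le0_pos ?expr0n//; lra.
apply: (gt_sixth (x := 1 / 6 - h * ((1 + c) ^+ 2 * (1 - 2 * c)) / 3)).
  have : (1 + c) ^+ 2 * (1 - 2 * c) <= 1.
    have : 0 <= c ^+ 2 * (3 + 2 * c) by rewrite mulr_ge0 ?sqr_ge0//; lra.
    lra.
  nra.
apply: le_trans (@energy_half_axis _ a b c h (-1) c h h (h ^+ 2) _ _ _ _ _ _ _ _ _);
  real_lra.
- rewrite lee_fin.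
  have -> : 2 * h * (1 + c) - h ^+ 2 + h ^+ 2 = 2 * h * (1 + c) by ring.
  have -> : 2 * h - h ^+ 2 + h ^+ 2 + 2 * h * c = 2 * h * (1 + c) by ring.
  rewrite ge0_pos ?mulr_ge0//; [|lra..].
  rewrite -subr_ge0 [X in 0 <= X](_ : _ = 0)//; field; lra.
- by move=> u u1; rewrite ax// sqr_ge0.
- by move=> u u1; rewrite ax// sqr_ge0.
- move=> u u1; rewrite ax; last lra.
  have := sqr_ge0 (u - c + h); lra.
- move=> u u1; rewrite ax; last lra.
  have := sqr_ge0 (u - c - h); lra.
Qed.

(** Both axis centres lie on the half-axis from [c - 1 / 40], which therefore does at least as well.
    The three ranges of [c] differ in the affine minorant of [(u - c) ^ 2] that shapes the tent. *)
Lemma diagonal_near a b c h : 1 / 4 <= h -> `|c| + h <= 1 ->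
  c - 1 / 40 <= a -> c - 1 / 40 <= b -> ((1 / 6)%:E < energy (sym4 a b c h))%E.
Proof.
move=> h1 ch ca cb.
have c1 : - (1 - h) <= c <= 1 - h by rewrite -ler_norml; lra.
have Hax c0 x u : c0 <= x -> pos (c0 - u) ^+ 2 <= (u - x) ^+ 2.
  move=> cx; have p0 := pos_ge0 (c0 - u); have [w|w] := lerP (c0 - u) 0.
    by rewrite le0_pos// expr0n sqr_ge0.
  have -> : (u - x) ^+ 2 = (x - u) ^+ 2 by ring.
  by rewrite (ge0_pos (ltW w)) ler_sqr ?nnegrE; lra.
have [c2|c2] := lerP (- (1 / 20)) c.
  (* The tent is flat here, and [c0 = - (3 / 40)] is the least possible [c - 1 / 40]. *)
  apply: (gt_sixth (x := 1 / 6 + (37 / 40) ^+ 4 / 12 - h * (2 - h) ^+ 3 / 12)).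
    (* [169 / 100] separates [27 / 16], the maximum of [h (2 - h) ^ 3] at [h = 1 / 2], from
       [1 + (37 / 40) ^ 4]. *)
    have : 0 < 169 / 100 - h * (2 - h) ^+ 3.
      have h2 : h <= 1 by lra.
      have H (x : R) : 1 / 4 <= x -> x <= 1 -> 0 <= x -> 0 < 169 / 100 - x * (2 - x) ^+ 3.
        by move=> x1 x2 x3; box x x in (1 / 4 : R) (1 : R) (0 : R) (1 : R) with 20%N.
      by apply: H; lra.
    lra.
  apply: le_trans (@energy_half_axis _ a b c h (- (3 / 40)) 0 0 0 0 _ _ _ _ _ _ _ _ _);
    real_lra; try by move=> u _; apply: Hax; lra.
  - rewrite lee_fin !(mulr1, mulr0, addr0, mul0r).
    have -> : 2 * h - h ^+ 2 = h * (2 - h) by ring.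
    rewrite ge0_pos ?mulr_ge0//; [|lra..].
    rewrite -subr_ge0 [X in 0 <= X](_ : _ = 0)//; field; lra.
  - by move=> u _; rewrite !(mulr0, mul0r) subr0 add0r; apply: Hax; lra.
  - by move=> u _; rewrite !(mulr0, mul0r) subr0 add0r; apply: Hax; lra.
have c0P u : c < u -> pos (c - 1 / 40 - u) = 0 by move=> cu; rewrite le0_pos//; lra.
(* For [c >= - (7 / 40)] the minorant to the right of [0] is the tangent to [(u - c) ^ 2] at
   [u = - c], which vanishes at [0]. *)
have [c3|c3] := lerP (- (7 / 40)) c.
  apply: (gt_sixth (x := 1 / 6 + (39 / 40 + c) ^+ 4 / 12 - h * (2 - h) ^+ 3 / 24
      - h ^+ 2 * (2 - h) ^+ 3 / (24 * (h - 2 * c)))).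
    have k1 : - (7 / 40) <= c <= - (1 / 20) by apply/andP; split; lra.
    have k2 : 1 / 4 <= h <= 1 by apply/andP; split; lra.
    have K := axis_ineq_near k1 k2.
    have hc : 0 < 24 * (h - 2 * c) by lra.
    rewrite -subr_gt0 -(pmulr_rgt0 _ hc) [X in 0 < X](_ : _ =
      (2 + 2 * (39 / 40 + c) ^+ 4) * (h - 2 * c) - h * (2 - h) ^+ 3 * (h - 2 * c)
      - h ^+ 2 * (2 - h) ^+ 3)//.
    by field; lra.
  apply: le_trans (@energy_half_axis _ a b c h (c - 1 / 40) 0 0 (- (2 * c)) 0 _ _ _ _ _ _ _ _ _);
    real_lra; try by move=> u _; apply: Hax; lra.
  - rewrite lee_fin !(mulr1, mulr0, addr0, mul0r).
    have -> : 2 * h - h ^+ 2 = h * (2 - h) by ring.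
    rewrite ge0_pos ?mulr_ge0//; [|lra..].
    rewrite -subr_ge0 [X in 0 <= X](_ : _ = 0)//; field; lra.
  - by move=> u _; rewrite !(mulr0, mul0r) subr0 add0r; apply: Hax; lra.
  - move=> u /andP[u0 _]; rewrite c0P; last by lra.
    by have := sqr_ge0 (u + c); rewrite expr0n /=; lra.
(* Now the tangent at [u = c + 7 / 20] is used; it vanishes at [c + 7 / 40], the apex, and agrees
   with the previous choice when [c = - (7 / 40)]. *)
pose X0 := h * (2 + 2 * c + 7 / 20 - h).
pose X1 := 2 * h - h ^+ 2 + 49 / 400 + 7 / 10 * c.
apply: (gt_sixth (x := 1 / 6 + (39 / 40 + c) ^+ 4 / 12 - X0 ^+ 3 / (24 * h * h)
    + (c + 7 / 40) * (X0 ^+ 2 + X0 * X1 + X1 ^+ 2) / (12 * h)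
    - X1 ^+ 3 / (24 * h * (h + 7 / 20)))).
  have k1 : - (3 / 4) <= c <= - (7 / 40) by apply/andP; split; lra.
  have k2 : 1 / 4 <= h <= 1 by apply/andP; split; lra.
  have K := axis_ineq_far k1 k2.
  have hc : 0 < 24 * h * (h + 7 / 20) by rewrite mulr_gt0//; lra.
  rewrite -subr_gt0 -(pmulr_rgt0 _ hc).
  rewrite /X0 /X1 [X in 0 < X](_ : _ = (2 + 2 * (39 / 40 + c) ^+ 4) * h * (h + 7 / 20)
    - h ^+ 2 * (h + 7 / 20) * (2 + 2 * c + 7 / 20 - h) ^+ 3
    + 2 * (c + 7 / 40) * (h + 7 / 20) * ((h * (2 + 2 * c + 7 / 20 - h)) ^+ 2
      + h * (2 + 2 * c + 7 / 20 - h) * (2 * h - h ^+ 2 + 49 / 400 + 7 / 10 * c)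
      + (2 * h - h ^+ 2 + 49 / 400 + 7 / 10 * c) ^+ 2)
    - (2 * h - h ^+ 2 + 49 / 400 + 7 / 10 * c) ^+ 3)//.
  by field; lra.
apply: le_trans (@energy_half_axis _ a b c h (c - 1 / 40) (c + 7 / 40) 0 (7 / 20) 0 _ _ _ _ _ _ _ _ _);
  real_lra; try by move=> u _; apply: Hax; lra.
- rewrite lee_fin !addr0.
  have -> : 2 * h * (1 + (c + 7 / 40)) - h ^+ 2 = X0 by rewrite /X0; field.
  have -> : 2 * h - h ^+ 2 + 2 * (7 / 20) * (c + 7 / 40) = X1 by rewrite /X1; field.
  have X00 : 0 <= X0 by rewrite /X0 mulr_ge0//; lra.
  have X10 : 0 <= X1.
    have : 0 <= (h - 1 / 4) * (1 - h) by apply: mulr_ge0; lra.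
    by rewrite /X1; lra.
  rewrite (ge0_pos X00) (ge0_pos X10).
  by have -> : 1 + (c - 1 / 40) = 39 / 40 + c by lra.
- by move=> u _; rewrite !(mulr0, mul0r) subr0 add0r; apply: Hax; lra.
- move=> u /andP[u0 _]; rewrite c0P; last by lra.
  by have := sqr_ge0 (u - c - 7 / 20); rewrite expr0n /=; lra.
Qed.

End diagonal.

(** * Symmetric configurations: the sharp bounds and their combination *)

Section diagonal_bound.
Context {R : realType}.
Implicit Types (a b c d h u v : R).

Let gt_sixth (E : \bar R) (x : R) : 1 / 12 < x -> ((2 * x)%:E <= E)%E -> ((1 / 6)%:E < E)%E.
Proof. by move=> x1; apply: lt_le_trans; rewrite lte_fin; lra. Qed.

Lemma energy_rows_gt a b c h G (A := c - a) (B := b - c) (m := (a + b) / 2) (d := (b - a) / 2)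
    (P := A * B) :
  0 < A -> 0 < B -> 0 < h <= 1 -> `|m| <= 1 ->
  G <= 1 / 4 - 2 * d / 3 + d ^+ 2 - (m ^+ 2 * (2 * d - 1) - 2 * d * `|m| ^+ 3 / 3) ->
  d * (2 * h - h ^+ 2 + P) ^+ 3 < 12 * h ^+ 2 * d * G + 12 * h * G * P ->
  ((1 / 6)%:E < energy (sym4 a b c h))%E.
Proof.
move=> A0 B0 /andP[h0 h1] m1 GE HG.
apply: gt_sixth (energy_rows A0 B0 h0 m1); rewrite -/m -/d -/P.
have d0 : 0 < d by rewrite /d /A /B in A0 B0 *; lra.
have P0 : 0 < P by exact: mulr_gt0.
have q0 : 0 <= 2 * h - h ^+ 2.
  by have : 0 <= h * (2 - h) by [apply: mulr_ge0; lra]; lra.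
rewrite ge0_pos; last by lra.
set T3 := (_ + P) ^+ 3 in HG *.
have hd : 0 < h * d by exact: mulr_gt0.
have D : 0 < 12 * h * (h + P / d) by rewrite !mulr_gt0// addr_gt0// divr_gt0.
suff : T3 / (12 * h * (h + P / d)) < G by lra.
rewrite ltr_pdivrMr// -(ltr_pM2l d0); apply: lt_le_trans HG _.
by rewrite le_eqVlt (_ : _ == _)//; apply/eqP; field; lra.
Qed.

(** For fixed [h], [d] and [m] the row bound compares the cube of an affine function of [P] with an
    affine function of [P], where [P = d ^ 2 - (c - m) ^ 2], so it suffices to check the ends of the
    range of [P]. For [d <= 1 / 2] the terms in [m] only help and [P = d ^ 2] may give equality; for
    [d > 1 / 2] the term [m ^ 2 (2 d - 1)] hurts and is absorbed by [eccentricity]. *)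
Lemma diagonal_rows a b c h : -1 <= a -> b <= 1 -> 1 / 40 <= c - a -> 1 / 40 <= b - c ->
  1 / 4 <= h <= 1 ->
  (b - a <= 1 \/ (c - a <= 2 / 5 \/ b - c <= 2 / 5) \/ 13 / 20 <= h) ->
  ((1 / 6)%:E < energy (sym4 a b c h))%E \/ [/\ a = - (1 / 2), b = 1 / 2, c = 0 & h = 1 / 2].
Proof.
move=> a1 b1 A1 B1 /andP[h1 h2] cases.
pose A := c - a; pose B := b - c; pose m := (a + b) / 2; pose d := (b - a) / 2; pose P := A * B.
have A0 : 0 < A by rewrite /A; lra.
have B0 : 0 < B by rewrite /B; lra.
have h0 : 0 < h by lra.
have h01 : 0 < h <= 1 by rewrite h0.
have h11 : 1 / 4 <= h <= 1 by rewrite h1.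
have d0 : 0 < d by rewrite /d; lra.
have md : `|m| <= 1 - d by rewrite ler_norml; apply/andP; split; rewrite /m /d; lra.
have m1 : `|m| <= 1 by lra.
have q0 : 0 <= 2 * h - h ^+ 2.
  by have : 0 <= h * (2 - h) by [apply: mulr_ge0; lra]; lra.
have PE : P = d ^+ 2 - (c - m) ^+ 2 by rewrite /P /A /B /d /m; field.
have P0 : 0 < P by exact: mulr_gt0.
have Pd : P <= d ^+ 2 by rewrite PE; have := sqr_ge0 (c - m); lra.
have rows := @energy_rows_gt a b c h _ A0 B0 h01 m1; rewrite -/m -/d -/A -/B -/P in rows.
have dE0 : d = (b - a) / 2 by [].
have mE0 : m = (a + b) / 2 by [].
clearbody d m.
have [dle|dgt] := lerP d (1 / 2).
  have m3 : 0 <= `|m| ^+ 3 by rewrite exprn_ge0.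
  pose G := 1 / 4 - 2 * d / 3 + d ^+ 2.
  have dm3 : 0 <= d * `|m| ^+ 3 by rewrite mulr_ge0// ltW.
  have dm2 : 0 <= m ^+ 2 * (1 - 2 * d) by rewrite mulr_ge0 ?sqr_ge0//; lra.
  have d12 : 0 < d <= 1 / 2 by rewrite d0.
  have [sq1 sq2] := rows_ineq_sqr h11 d12.
  have sqd : d * (2 * h - h ^+ 2 + d ^+ 2) ^+ 3 <=
      12 * h ^+ 2 * d * G + 12 * h * G * d ^+ 2.
    have -> : 12 * h ^+ 2 * d * G + 12 * h * G * d ^+ 2 = d * (12 * h * (h + d) * G) by ring.
    by rewrite ler_pM2l.
  have [Plt|Pge] := ltP P (d ^+ 2).
    left; apply: (rows G); first by rewrite /G; clear - dm2 dm3; lra.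
    have [d5|d5] := lerP d (1 / 5).
      have d05 : 0 <= d <= 1 / 5 by rewrite (ltW d0).
      have h00 : 0 <= h <= 1 by rewrite (ltW h0).
      apply: (cube_chord_lt (x0 := 0) (x1 := d ^+ 2)); rewrite ?addr0 ?(ltW P0) ?(ltW d0)//.
      have K := rows_ineq_zero h00 d05.
      rewrite mulr0 addr0 -subr_gt0 [X in 0 < X](_ : _ = h ^+ 2 * d *
        (12 * (1 / 4 - 2 * d / 3 + d ^+ 2) - h * (2 - h) ^+ 3)); last by rewrite /G; ring.
      by rewrite !mulr_gt0// ?exprn_gt0.
    have d55 : 1 / 5 <= d <= 1 / 2 by rewrite (ltW d5).
    (* Expanding [(A - 1 / 40) (B - 1 / 40) >= 0] gives [P >= d / 20 - 1 / 1600], which is enough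
       once [d >= 1 / 20]. *)
    have PA : 3 / 80 * d <= P.
      have A2 : 0 <= A - 1 / 40 by rewrite subr_ge0.
      have B2 : 0 <= B - 1 / 40 by rewrite subr_ge0.
      have dE : 2 * d = A + B by rewrite dE0 /A /B; field.
      by have := mulr_ge0 A2 B2; rewrite /P; clear - dE d55; lra.
    have d80 : 0 <= 3 / 80 * d by clear - d0; lra.
    have qd : 0 <= 2 * h - h ^+ 2 + 3 / 80 * d by exact: addr_ge0.
    apply: (cube_chord_lt (x0 := 3 / 80 * d) (x1 := d ^+ 2)) => //;
      [exact: ltW|by rewrite PA|].
    have K := rows_ineq_low h11 d55.
    rewrite -subr_gt0 [X in 0 < X](_ : _ = d * (12 * h * (h + 3 / 80) *
      (1 / 4 - 2 * d / 3 + d ^+ 2) - (2 * h - h ^+ 2 + 3 / 80 * d) ^+ 3)); last by rewrite /G; ring.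
    exact: mulr_gt0.
  have Peq : P = d ^+ 2 by apply/eqP; rewrite eq_le Pd Pge.
  have cm : c = m.
    have /eqP : (c - m) ^+ 2 = 0 by clear - PE Peq; lra.
    by rewrite sqrf_eq0 subr_eq0 => /eqP.
  have [m0|mn0] := eqVneq m 0; last first.
    (* With [P = d ^ 2] the two sides may agree; an off-centre pair of axis centres gains strictly
       through its cubic term. *)
    left; pose e := d * `|m| ^+ 3 * 2 / 3.
    have e0 : 0 < e.
      have : 0 < d * `|m| ^+ 3 by rewrite mulr_gt0// exprn_gt0// normr_gt0.
      by rewrite /e; clear; lra.
    apply: (rows (G + e)); first by rewrite /G /e; clear - dm2; lra.
    rewrite Peq; apply: le_lt_trans sqd _; clearbody e.
    have : 0 < h ^+ 2 * d * e by rewrite !mulr_gt0// ?exprn_gt0.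
    have : 0 < h * e * d ^+ 2 by rewrite !mulr_gt0// ?exprn_gt0.
    clear; lra.
  have [sqE|sqN] := eqVneq ((2 * h - h ^+ 2 + d ^+ 2) ^+ 3)
      (12 * h * (h + d) * (1 / 4 - 2 * d / 3 + d ^+ 2)).
    right; have [hE dE] := sq2 sqE; rewrite dE0 in dE; rewrite mE0 in m0 cm.
    by clear - hE dE m0 cm; split; lra.
  left; apply: (rows G); first by rewrite /G; clear - dm2 dm3; lra.
  have sq3 : (2 * h - h ^+ 2 + d ^+ 2) ^+ 3 < 12 * h * (h + d) * G by rewrite lt_neqAle sqN.
  rewrite Peq (_ : _ + 12 * h * G * d ^+ 2 = d * (12 * h * (h + d) * G)); last by ring.
  by rewrite ltr_pM2l.
left.
have d1 : 1 / 2 <= d <= 1.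
  by have := normr_ge0 m; clear - dgt md => ?; apply/andP; split; lra.
have xm : 0 <= `|m| <= 1 - d by rewrite normr_ge0.
have ecc := le_eccentricity d1 xm; rewrite real_normK ?num_real// in ecc.
pose G := 1 / 4 - 2 * d / 3 + d ^+ 2 - eccentricity d.
apply: (rows G); first by rewrite /G; clear - ecc; lra.
have zero : d * (2 * h - h ^+ 2 + 0) ^+ 3 < 12 * h ^+ 2 * d * G + 12 * h * G * 0.
  have K := rows_ineq_wide_zero h11 d1.
  rewrite -subr_gt0 [X in 0 < X](_ : _ = h ^+ 2 * d *
    (12 * (1 / 4 - 2 * d / 3 + d ^+ 2 - eccentricity d) - h * (2 - h) ^+ 3)).
    by rewrite !mulr_gt0// ?exprn_gt0.
  by rewrite /G; ring.
have [h3|h3] := lerP (13 / 20) h.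
  have h13 : 13 / 20 <= h <= 1 by rewrite h3.
  have K := rows_ineq_wide_sqr h13 d1.
  have one : d * (2 * h - h ^+ 2 + d ^+ 2) ^+ 3 < 12 * h ^+ 2 * d * G + 12 * h * G * d ^+ 2.
    by rewrite -subr_gt0 (_ : 12 * h ^+ 2 * d * G + _ = 12 * h * (h * d + d ^+ 2) * G)//; ring.
  have [Plt|Pge] := ltP P (d ^+ 2).
    by apply: (cube_chord_lt (x0 := 0) (x1 := d ^+ 2));
      [exact: ltW|rewrite addr0|rewrite (ltW P0)|exact: zero|exact: ltW one].
  by have -> : P = d ^+ 2 by apply/eqP; rewrite eq_le Pd Pge.
have AB : A <= 2 / 5 \/ B <= 2 / 5.
  by rewrite /A /B; case: cases => [|[|]]; rewrite dE0 in dgt; [|by []|]; clear - dgt h3; lra.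
have dE : 2 * d = A + B by rewrite dE0 /A /B; field.
have Ple : P <= 4 / 5 * d - 4 / 25.
  have : 0 <= (2 / 5 - A) * (B - 2 / 5).
    by clear - AB dE d1; case: AB => AB; [apply: mulr_ge0|apply: mulr_le0]; lra.
  by rewrite /P; clear - dE; lra.
have K := rows_ineq_wide h11 d1.
have one : d * (2 * h - h ^+ 2 + (4 / 5 * d - 4 / 25)) ^+ 3 <
    12 * h ^+ 2 * d * G + 12 * h * G * (4 / 5 * d - 4 / 25).
  rewrite -subr_gt0 (_ : 12 * h ^+ 2 * d * G + _ =
    12 * h * (h * d + (4 / 5 * d - 4 / 25)) * G)//; ring.
have [Plt|Pge] := ltP P (4 / 5 * d - 4 / 25); last first.
  by have -> : P = 4 / 5 * d - 4 / 25 by apply/eqP; rewrite eq_le Ple Pge.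
by apply: (cube_chord_lt (x0 := 0) (x1 := 4 / 5 * d - 4 / 25));
  [exact: ltW|rewrite addr0|rewrite (ltW P0)|exact: zero|exact: ltW one].
Qed.

(** Adding [tent_le] for [1 + c] and [1 - c] bounds half the energy below by [1 / 12 + c ^ 2 (- 1 /
    2 + 2 h - h ^ 2 - c ^ 2 / 4)]. The bracket is positive for [h >= 37 / 100] and [c <= 3 / 5]; for
    smaller [h] the tent of [(a, 0)] is estimated by [tent_le_wide]. *)
Lemma diagonal_tents a b c h : -1 <= a -> b <= 1 -> 2 / 5 <= c - a -> 2 / 5 <= b - c ->
  1 / 4 <= h <= 13 / 20 -> `|c| + h <= 1 ->
  ((1 / 6)%:E < energy (sym4 a b c h))%E \/ [/\ a = - (1 / 2), b = 1 / 2, c = 0 & h = 1 / 2].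
Proof.
wlog c0 : a b c / 0 <= c.
  move=> H a1 b1 A1 B1 h1 ch; have [c0|/ltW c0] := lerP 0 c; first exact: H.
  have n0 : 0 <= - c by lra.
  have n1 : -1 <= - b by lra.
  have n2 : - a <= 1 by lra.
  have n3 : 2 / 5 <= - c - - b by lra.
  have n4 : 2 / 5 <= - a - - c by lra.
  have n5 : `|- c| + h <= 1 by rewrite normrN.
  rewrite energy_sym4_opp; case: (H _ _ _ n0 n1 n2 n3 n4 h1 n5); first by left.
  by move=> [e1 e2 e3 e4]; right; split; lra.
move=> a1 b1 A1 B1 /andP[h1 h2]; rewrite ger0_norm// => ch.
pose A := c - a; pose B := b - c.
have A0 : 0 < A by rewrite /A; lra.
have B0 : 0 < B by rewrite /B; lra.
have h0 : 0 < h by lra.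
have YP : 0 <= 2 * A * (1 + c) - A ^+ 2 + h ^+ 2.
  have : 0 <= A * (2 * (1 + c) - A) by apply: mulr_ge0; rewrite /A; lra.
  by have := sqr_ge0 h; lra.
have YQ : 0 <= 2 * B * (1 - c) - B ^+ 2 + h ^+ 2.
  have : 0 <= B * (2 * (1 - c) - B) by apply: mulr_ge0; rewrite /B; lra.
  by have := sqr_ge0 h; lra.
have tents := energy_tents h0 A0 B0; rewrite (ge0_pos YP) (ge0_pos YQ) in tents.
have [Q1 Q2] := @tent_le _ B (1 - c) h ltac:(lra) ltac:(rewrite /B; lra)
  ltac:(apply/andP; split; lra) ltac:(rewrite /B; lra).
set gP := _ / (24 * A * _) in tents *; set gQ := _ / (24 * B * _) in tents Q1 Q2 *.
have [h3|h3] := lerP (37 / 100) h; last first.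
  left; apply: gt_sixth tents.
  have := @tent_le_wide _ A (1 + c) h ltac:(lra) ltac:(apply/andP; split; rewrite /A; lra)
    ltac:(apply/andP; split; lra).
  rewrite -/gP => P1.
  have := @tents_ineq_low _ c h ltac:(apply/andP; split; rewrite /B; lra)
    ltac:(apply/andP; split; lra).
  lra.
have [P1 P2] := @tent_le _ A (1 + c) h ltac:(lra) ltac:(rewrite /A; lra)
  ltac:(apply/andP; split; lra) ltac:(rewrite /A; lra).
rewrite -/gP in P1 P2.
have [cz|cn] := eqVneq c 0; last first.
  left; apply: gt_sixth tents.
  have cp : 0 < c ^+ 2 by rewrite exprn_gt0// lt_neqAle eq_sym cn.
  have c6 : c <= 3 / 5 by lra.
  have k1 : 0 <= (3 / 5 - c) * (3 / 5 + c) by apply: mulr_ge0; lra.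
  have k2 : 0 <= (h - 37 / 100) * (13 / 20 - h) by apply: mulr_ge0; lra.
  have : 0 < c ^+ 2 * (- (1 / 2) + 2 * h - h ^+ 2 - c ^+ 2 / 4) by apply: mulr_gt0 => //; lra.
  lra.
have [gPE|gPN] := eqVneq gP ((1 + c) ^+ 4 / 8 - h * (1 + c) ^+ 3 / 3 + h ^+ 2 * (1 + c) ^+ 2 / 2);
  last first.
  left; apply: gt_sixth tents.
  have : gP < (1 + c) ^+ 4 / 8 - h * (1 + c) ^+ 3 / 3 + h ^+ 2 * (1 + c) ^+ 2 / 2.
    by rewrite lt_neqAle gPN.
  by rewrite cz in Q1 *; lra.
have [gQE|gQN] := eqVneq gQ ((1 - c) ^+ 4 / 8 - h * (1 - c) ^+ 3 / 3 + h ^+ 2 * (1 - c) ^+ 2 / 2);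
  last first.
  left; apply: gt_sixth tents.
  have : gQ < (1 - c) ^+ 4 / 8 - h * (1 - c) ^+ 3 / 3 + h ^+ 2 * (1 - c) ^+ 2 / 2.
    by rewrite lt_neqAle gQN.
  by rewrite cz in P1 *; lra.
right; have [AE hE] := P2 gPE; have [BE _] := Q2 gQE.
by rewrite /A /B cz in AE BE hE; split; lra.
Qed.

Theorem diagonal_bound a b c h : -1 <= a -> a < b -> b <= 1 -> 0 < h -> `|c| + h <= 1 ->
  ((1 / 6)%:E < energy (sym4 a b c h))%E \/ [/\ a = - (1 / 2), b = 1 / 2, c = 0 & h = 1 / 2].
Proof.
move=> a1 ab b1 h0 ch; have cn := normr_ge0 c.
have c1 : -1 <= c <= 1 by rewrite -ler_norml; lra.
have [h4|h4] := ltrP h (1 / 4); first by left; apply: diagonal_low; rewrite ?h0.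
(* The negation [c - a < 1 / 40] includes the case of both axis centres to the right of [c]. *)
have [A1|A1] := lerP (1 / 40) (c - a); last first.
  by left; apply: diagonal_near; lra.
have [B1|B1] := lerP (1 / 40) (b - c); last first.
  by left; rewrite energy_sym4_opp; apply: diagonal_near; rewrite ?normrN; lra.
have h41 : 1 / 4 <= h <= 1 by apply/andP; split; lra.
have [A2|A2] := lerP (c - a) (2 / 5); first by apply: diagonal_rows => //; right; left; left.
have [B2|B2] := lerP (b - c) (2 / 5); first by apply: diagonal_rows => //; right; left; right.
have [h5|h5] := lerP (13 / 20) h; first by apply: diagonal_rows => //; right; right.
by apply: diagonal_tents => //; [exact: ltW|exact: ltW|rewrite h4 ltW].
Qed.

End diagonal_bound.

(** * Truncated parabolas and the energy of a disc *)

Section parabolic_caps.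
Context {R : realType}.
Local Notation mu := (@lebesgue_measure R).
Implicit Types (s y : R).

(** Only positive parts of affine functions occur on the right, so the derivation rules cover the
    truncated parabola without a case distinction. *)
Lemma pos_sub_sqr s y : 0 <= s ->
  pos (s ^+ 2 - y ^+ 2) = 2 * s * pos (s + y) - pos (s + y) ^+ 2
    + (2 * s * pos (y - s) + pos (y - s) ^+ 2).
Proof.
move=> s0; have [y1|y1] := lerP y (- s).
  rewrite (le0_pos (x := s + y)); last by lra.
  rewrite (le0_pos (x := y - s)); last by lra.
  rewrite le0_pos ?expr0n /=; first by ring.
  have : 0 <= (- y - s) * (s - y) by apply: mulr_ge0; lra.
  lra.
rewrite (ge0_pos (x := s + y)); last by lra.
have [y2|y2] := lerP y s.
  rewrite (le0_pos (x := y - s)); last by lra.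
  rewrite ge0_pos ?expr0n /=; first by ring.
  have : 0 <= (s + y) * (s - y) by apply: mulr_ge0; lra.
  lra.
rewrite (ge0_pos (x := y - s)); last by lra.
rewrite le0_pos; first by ring.
have : 0 <= (s + y) * (y - s) by apply: mulr_ge0; lra.
lra.
Qed.

Definition cap1 s y := s * pos (s + y) ^+ 2 - pos (s + y) ^+ 3 / 3
  + (s * pos (y - s) ^+ 2 + pos (y - s) ^+ 3 / 3).

Definition cap2 s y :=
  4 * s ^+ 2 * pos (s + y) ^+ 3 / 3 - s * (pos (s + y) ^+ 2 * pos (s + y) ^+ 2)
  + pos (s + y) ^+ 2 * pos (s + y) ^+ 3 / 5
  - (4 * s ^+ 2 * pos (y - s) ^+ 3 / 3 + s * (pos (y - s) ^+ 2 * pos (y - s) ^+ 2)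
  + pos (y - s) ^+ 2 * pos (y - s) ^+ 3 / 5).

Lemma caps_bound s y : 0 <= s ->
  [/\ 0 <= cap1 s y, cap1 s y <= 4 * s ^+ 3 / 3, 0 <= cap2 s y & cap2 s y <= 16 * s ^+ 5 / 15].
Proof.
move=> s0; rewrite /cap1 /cap2.
have s3 : 0 <= s ^+ 3 by exact: exprn_ge0.
have s5 : 0 <= s ^+ 5 by exact: exprn_ge0.
have [y1|y1] := lerP y (- s).
  rewrite (le0_pos (x := s + y)); last by lra.
  rewrite (le0_pos (x := y - s)); last by lra.
  by rewrite !expr0n /=; split; lra.
rewrite (ge0_pos (x := s + y)); last by lra.
have [y2|y2] := lerP y s.
  rewrite (le0_pos (x := y - s)); last by lra.
  rewrite !expr0n /=.
  (* In [x = s + y] and [z = s - y] every difference to be estimated is a polynomial with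
     nonnegative coefficients. *)
  suff mid (x z : R) : 0 <= x -> 0 <= z -> s = (x + z) / 2 ->
      [/\ 0 <= s * x ^+ 2 - x ^+ 3 / 3, s * x ^+ 2 - x ^+ 3 / 3 <= 4 * s ^+ 3 / 3,
          0 <= 4 * s ^+ 2 * x ^+ 3 / 3 - s * (x ^+ 2 * x ^+ 2) + x ^+ 2 * x ^+ 3 / 5
        & 4 * s ^+ 2 * x ^+ 3 / 3 - s * (x ^+ 2 * x ^+ 2) + x ^+ 2 * x ^+ 3 / 5
          <= 16 * s ^+ 5 / 15].
    by have [| | |h1 h2 h3 h4] := mid (s + y) (s - y); [lra|lra|field|split; lra].
  move=> {s0 s3 s5 y1 y2 y} x0 z0 ->.
  have x2 := mulr_ge0 x0 x0; have xz := mulr_ge0 x0 z0; have z2 := mulr_ge0 z0 z0.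
  have x3 := mulr_ge0 x2 x0; have z3 := mulr_ge0 z2 z0.
  have x2z := mulr_ge0 x2 z0; have xz2 := mulr_ge0 xz z0.
  have x5 := mulr_ge0 x2 x3; have x4z := mulr_ge0 x2 x2z; have x3z2 := mulr_ge0 x2 xz2.
  have z5 := mulr_ge0 z2 z3; have xz4 := mulr_ge0 z2 xz2; have x2z3 := mulr_ge0 z2 x2z.
  by split; lra.
rewrite (ge0_pos (x := y - s)); last by lra.
have -> : s * (s + y) ^+ 2 - (s + y) ^+ 3 / 3 + (s * (y - s) ^+ 2 + (y - s) ^+ 3 / 3) =
  4 * s ^+ 3 / 3 by field.
rewrite [X in [/\ _, _, 0 <= X & X <= _]](_ : _ = 16 * s ^+ 5 / 15); last by field.
by split; lra.
Qed.

Lemma is_derive_cap1 s x0 y : 0 <= s ->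
  is_derive y 1 (fun y => cap1 s (y - x0)) (pos (s ^+ 2 - (y - x0) ^+ 2)).
Proof.
move=> s0; rewrite pos_sub_sqr// /cap1; derive1.
by field.
Qed.

Lemma is_derive_cap2 s x0 y : 0 <= s ->
  is_derive y 1 (fun y => cap2 s (y - x0)) (pos (s ^+ 2 - (y - x0) ^+ 2) ^+ 2).
Proof.
move=> s0.
have -> : pos (s ^+ 2 - (y - x0) ^+ 2) ^+ 2 = 4 * s ^+ 2 * pos (s + (y - x0)) ^+ 2
   - 4 * s * pos (s + (y - x0)) ^+ 3 + pos (s + (y - x0)) ^+ 4
   - (4 * s ^+ 2 * pos ((y - x0) - s) ^+ 2
   + 4 * s * pos ((y - x0) - s) ^+ 3 + pos ((y - x0) - s) ^+ 4).
  rewrite -pos_mul pos_sub_sqr//; move: (y - x0) => {}y.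
  have [y1|y1] := lerP y (- s).
    rewrite (le0_pos (x := s + y)); last by lra.
    rewrite (le0_pos (x := y - s)); last by lra.
    by rewrite !expr0n /=; ring.
  rewrite (ge0_pos (x := s + y)); last by lra.
  have [y2|y2] := lerP y s.
    rewrite (le0_pos (x := y - s)); last by lra.
    by rewrite !expr0n /=; ring.
  by rewrite (ge0_pos (x := y - s)); [ring|lra].
rewrite /cap2; derive1.
by field.
Qed.

Lemma integral_cap1_le s x0 a b : 0 <= s -> a <= b ->
  (\int[mu]_(y in `[a, b]) (pos (s ^+ 2 - (y - x0) ^+ 2))%:E <= (4 * s ^+ 3 / 3)%:E)%E.
Proof.
move=> s0 ab.
have cf : continuous (fun y => pos (s ^+ 2 - (y - x0) ^+ 2)) by continuity.
rewrite (integral_antiderivative ab (fun y => is_derive_cap1 x0 y s0) cf).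
have [_ h1 _ _] := caps_bound (b - x0) s0; have [h2 _ _ _] := caps_bound (a - x0) s0.
  by rewrite lee_fin; lra.
Qed.

Lemma integral_cap2_le s x0 a b : 0 <= s -> a <= b ->
  (\int[mu]_(y in `[a, b]) (pos (s ^+ 2 - (y - x0) ^+ 2) ^+ 2)%:E <= (16 * s ^+ 5 / 15)%:E)%E.
Proof.
move=> s0 ab.
have cf : continuous (fun y => pos (s ^+ 2 - (y - x0) ^+ 2) ^+ 2) by continuity.
rewrite (integral_antiderivative ab (fun y => is_derive_cap2 x0 y s0) cf).
have [_ _ _ h1] := caps_bound (b - x0) s0; have [_ _ h2 _] := caps_bound (a - x0) s0.
  by rewrite lee_fin; lra.
Qed.

End parabolic_caps.

Section disc_bound.
Context {R : realType}.
Local Notation mu := (@lebesgue_measure R).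

Definition disc (s : R) (a : plane R) (z : plane R) : R := pos (s ^+ 2 - sqdist a z).

Lemma measurable_pos : measurable_fun setT (pos : R -> R).
Proof. by apply: continuous_measurable_fun; exact: continuous_pos. Qed.

Lemma measurable_disc s a : measurable_fun setT (disc s a).
Proof.
apply: (measurableT_comp measurable_pos).
by apply: measurable_funB => //; exact: measurable_sqdist.
Qed.

Lemma disc_ge0 s a z : 0 <= disc s a z. Proof. exact: pos_ge0. Qed.

(* AM-GM: beta^(3/2) <= (beta^2 / k + k beta) / 2. *)
Lemma column_disc_le s k a u : 0 < k -> `|u| <= 1 ->
  (column (disc s a) u <= (2 / 3 * (pos (s ^+ 2 - (u - a.1) ^+ 2) ^+ 2 / k
     + k * pos (s ^+ 2 - (u - a.1) ^+ 2)))%:E)%E.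
Proof.
case: a => a1 a2 k0 u1; rewrite /column /disc /sqdist /=.
pose be := s ^+ 2 - (u - a1) ^+ 2.
have [b0|/ltW b0] := lerP be 0.
  rewrite integral0_eq; last first.
    move=> v _; congr EFin; apply: le0_pos.
    by have := sqr_ge0 (v - a2); rewrite /be in b0; lra.
  by rewrite -/be (le0_pos b0) expr0n /= mul0r mulr0 addr0 mulr0.
rewrite -/be (ge0_pos b0); pose r := Num.sqrt be.
have r0 : 0 <= r by exact: sqrtr_ge0.
have r2 : be = r ^+ 2 by rewrite sqr_sqrtr.
apply: (@le_trans _ _ (4 * r ^+ 3 / 3)%:E).
  under eq_integral.
    move=> v _; rewrite (_ : s ^+ 2 - _ = r ^+ 2 - (v - a2) ^+ 2); last first.
      by rewrite -r2 /be; ring.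
    over.
  by apply: integral_cap1_le => //; lra.
rewrite lee_fin r2 -subr_ge0 [X in 0 <= X](_ : _ = 2 / 3 * (r ^+ 2 * (r - k) ^+ 2) / k).
  apply: divr_ge0; last exact: ltW.
  by apply: mulr_ge0; [lra|exact: mulr_ge0 (sqr_ge0 _) (sqr_ge0 _)].
by field; lra.
Qed.

(** Over the whole plane the integral is [pi s ^ 4 / 2], about [0.0489]. The AM-GM estimate with the
    fixed weight [k = 9 / 10 * s] needs neither [pi] nor square roots and gives
    [644 / 405 * s ^ 4 < 0.0495]. *)
Lemma energy_disc_le a : (energy (disc (21 / 50) a) <= (5 / 100)%:E)%E.
Proof.
pose s : R := 21 / 50; pose k : R := 9 / 10 * s.
have s0 : 0 <= s by rewrite /s; lra.
have k0 : 0 < k by rewrite /k /s; lra.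
pose F u := 2 / 3 * (cap2 s (u - a.1) / k + k * cap1 s (u - a.1)).
pose g u := 2 / 3 * (pos (s ^+ 2 - (u - a.1) ^+ 2) ^+ 2 / k + k * pos (s ^+ 2 - (u - a.1) ^+ 2)).
have cg : continuous g by rewrite /g; continuity.
have le11 : -1 <= 1 :> R by lra.
apply: (@le_trans _ _ (\int[mu]_(u in `[(-1)%R, 1%R]) (g u)%:E)%E).
  apply: ge0_le_integral => //.
  - by move=> u _; apply: column_ge0; exact: disc_ge0.
  - apply: measurable_funTS; apply: measurable_column; [exact: measurable_disc|exact: disc_ge0].
  - apply: measurable_funTS; apply/measurable_EFinP; exact: continuous_measurable_fun.
  - by move=> u /=; rewrite in_itv/= -ler_norml => u1; exact: column_disc_le.
have dF (u : R) : is_derive u 1 F (g u).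
  rewrite /F /g; have d1 := is_derive_cap1 a.1 u s0; have d2 := is_derive_cap2 a.1 u s0.
  apply: (is_derive1_eq (is_derive1M (is_derive1_cst _ _) (is_derive1D
     (is_derive1M d2 (is_derive1_cst k^-1 u)) (is_derive1M (is_derive1_cst k u) d1)))).
  by ring.
rewrite (integral_antiderivative le11 dF cg).
rewrite lee_fin /F.
have [_ h1 _ h2] := caps_bound (1 - a.1) s0; have [h3 _ h4 _] := caps_bound (-1 - a.1) s0.
have e : (5 / 100 : R) >= 2 / 3 * ((16 * s ^+ 5 / 15) / k + k * (4 * s ^+ 3 / 3)).
  rewrite /k (_ : _ / (9 / 10 * s) = 32 / 27 * s ^+ 4); last by rewrite /s; field; lra.
  by rewrite /s; lra.
apply: le_trans e; rewrite -mulrBr ler_pM2l; last by lra.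
have kV : 0 <= k^-1 by rewrite invr_ge0 ltW.
have g2 : (cap2 s (1 - a.1) - cap2 s (-1 - a.1)) * k^-1 <= 16 * s ^+ 5 / 15 * k^-1.
  by apply: ler_wpM2r => //; lra.
have g1 : k * (cap1 s (1 - a.1) - cap1 s (-1 - a.1)) <= k * (4 * s ^+ 3 / 3).
  by apply: ler_wpM2l; [exact: ltW|lra].
lra.
Qed.

End disc_bound.

(** * Positivity and finiteness of the energy *)

Section energy_gt0.
Context {R : realType}.
Local Notation mu := (@lebesgue_measure R).
Implicit Types (u v : R).

Let integral_ge_box (g : R -> \bar R) (x0 del e : R) : measurable_fun setT g ->
  (forall x, (0 <= g x)%E) -> 0 <= del -> 0 <= e ->
  (forall x, x0 - del <= x <= x0 + del -> (e%:E <= g x)%E) ->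
  ((e * (2 * del))%:E <= \int[mu]_x g x)%E.
Proof.
move=> mg g0 del0 e0 ge.
apply: (@le_trans _ _ (\int[mu]_(x in `[(x0 - del)%R, (x0 + del)%R]) g x)%E); last first.
  by apply: ge0_subset_integral.
apply: (@le_trans _ _ (\int[mu]_(x in `[(x0 - del)%R, (x0 + del)%R]) e%:E)%E).
  rewrite integral_cst//= lebesgue_measure_itv /= lte_fin.
  case: ltP => h; rewrite ?mule0 ?lee_fin.
    by rewrite le_eqVlt; apply/orP; left; apply/eqP; ring.
  have del0' : del <= 0 by lra.
  by apply: mulr_ge0_le0 => //; lra.
by apply: ge0_le_integral => //; exact: measurable_funTS.
Qed.

Lemma energy_gt0 (f : plane R -> R) (u0 v0 del e : R) :
  measurable_fun setT f -> (forall z, 0 <= f z) -> 0 < del -> 0 < e ->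
  (forall u v, u0 - del <= u <= u0 + del -> v0 - del <= v <= v0 + del ->
    `|u| + `|v| <= 1 /\ e <= f (u, v)) ->
  (0 < energy f)%E.
Proof.
move=> mf f0 del0 e0 h; rewrite energyE//.
apply: (@lt_le_trans _ _ (e * (2 * del) * (2 * del))%:E).
  by rewrite lte_fin !mulr_gt0.
apply: (@integral_ge_box _ u0); [exact: measurable_column|exact: column_ge0|exact: ltW|
  by rewrite !mulr_ge0 ?ltW//|].
move=> u hu; rewrite column_dia.
apply: (@integral_ge_box _ v0); [|by move=> v; exact: dia_fun_ge0|exact: ltW|exact: ltW|].
  by apply: (measurableT_comp (measurable_dia_fun mf)); exact: measurable_pair1.
move=> v hv; have [d le] := h u v hu hv.
by rewrite /dia_fun patchE mem_set// lee_fin.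
Qed.

(** The factor [4] is the area of the square around the diamond; this is enough for finiteness and
    for terms of order [t ^ 2]. *)
Lemma energy_le_cst (f : plane R -> R) (k : R) : measurable_fun setT f ->
  (forall z, 0 <= f z) -> 0 <= k -> (forall z, diamond z -> f z <= k) ->
  (energy f <= (4 * k)%:E)%E.
Proof.
move=> mf f0 k0 fk.
have cst (x k' : R) : 0 <= k' -> `|x| <= 1 ->
    (\int[mu]_(v in `[(- x)%R, x]) k'%:E <= (2 * k')%:E)%E.
  move=> k'0 x1; rewrite integral_cst//= lebesgue_measure_itv /= lte_fin.
  case: ltP => h; rewrite ?mule0 ?lee_fin ?mulr_ge0//.
  rewrite opprK mulrC ler_wpM2r//.
  by have := ler_norm x; lra.
rewrite (_ : 4 * k = 2 * (2 * k)); last by ring.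
apply: le_trans (@cst 1 (2 * k) _ _); rewrite ?mulr_ge0 ?normr1//.
apply: ge0_le_integral => //.
- by move=> u _; exact: column_ge0.
- exact: measurable_funTS (measurable_column mf f0).
move=> u /=; rewrite in_itv/= -ler_norml => u1.
apply: le_trans (@cst (1 - `|u|) k k0 _); last first.
  by rewrite ger0_norm; have := normr_ge0 u; lra.
apply: ge0_le_integral => //.
- by move=> v _; rewrite lee_fin.
- exact: measurable_funTS (measurable_section mf u).
- move=> v /=; rewrite in_itv/= -ler_norml => uv.
  by rewrite lee_fin fk// /diamond/=; lra.
Qed.

End energy_gt0.

(** * First variation of one axis centre *)

Section escape.
Context {R : realType}.
Local Notation mu := (@lebesgue_measure R).
Implicit Types (a b c d h u v t k : R).

Lemma pos_sub_opp (x : R) : x = pos x - pos (- x).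
Proof.
have [x0|x0] := lerP 0 x; last by rewrite le0_pos ?ge0_pos; lra.
by rewrite ge0_pos// le0_pos; lra.
Qed.

Lemma energyZ (f : plane R -> R) k : measurable_fun setT f -> (forall z, 0 <= f z) ->
  0 <= k -> energy (fun z => k * f z) = (k%:E * energy f)%E.
Proof.
move=> mf f0 k0.
have mk : measurable_fun setT (fun z => k * f z) by exact: measurable_funM.
rewrite !energy_fubini//; last by move=> z; exact: mulr_ge0.
rewrite -ge0_integralZl//.
- apply: eq_integral => z _; rewrite /dia_fun !patchE /=.
  by case: ifPn; rewrite ?mule0.
- exact: measurable_dia_fun.
- by move=> z _; exact: dia_fun_ge0.
Qed.

Lemma energy_flip (f : plane R -> R) : measurable_fun setT f -> (forall z, 0 <= f z) ->
  energy (fun z => f (z.1, - z.2)) = energy f.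
Proof.
move=> mf f0.
have ms : measurable_fun setT (fun z : plane R => f (z.2, z.1)).
  by apply: (measurableT_comp mf); exact: measurable_swap.
have mr : measurable_fun setT (fun z : plane R => f (z.2, - z.1)).
  apply: (measurableT_comp mf); apply/measurable_fun_pairP; split; rewrite /comp /=.
    exact: measurable_snd.
  by apply: measurableT_comp => //; exact: measurable_fst.
rewrite (energy_swap mf f0) (energy_reflect ms (fun z => f0 (z.2, z.1))).
exact: esym (energy_swap mr (fun z => f0 (z.2, - z.1))).
Qed.

Lemma affine_near (al be ga u0 v0 : R) : 0 < al + be * u0 + ga * v0 ->
  \forall e \near (0:R)^'+, forall u v, u0 - e <= u <= u0 + e -> v0 - e <= v <= v0 + e ->
    0 < al + be * u + ga * v.
Proof.
set X := al + _ + _ => X0.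
have K0 : 0 < `|be| + `|ga| + 1 by have := normr_ge0 be; have := normr_ge0 ga; lra.
near=> e => u v; rewrite -!ler_distlC => hu hv.
have eX : e * (`|be| + `|ga| + 1) < X by rewrite -ltr_pdivlMr//; near: e; apply: nbhs_right_lt; rewrite divr_gt0.
have e0 : 0 < e by near: e; exact: nbhs_right_gt.
have -> : al + be * u + ga * v = X + be * (u - u0) + ga * (v - v0) by rewrite /X; ring.
have h1 : - (be * (u - u0)) <= `|be| * e.
  by rewrite (le_trans (ler_norm _))// normrN normrM ler_wpM2l// distrC.
have h2 : - (ga * (v - v0)) <= `|ga| * e.
  by rewrite (le_trans (ler_norm _))// normrN normrM ler_wpM2l// distrC.
lra.
Unshelve. all: by end_near. Qed.

Lemma sqdist_flip (x y u v : R) : sqdist (x, y) (u, - v) = sqdist (x, - y) (u, v).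
Proof. by rewrite /sqdist /=; congr (_ + _); ring. Qed.

Let shrink_le (F G A B K T : \bar R) : (F + A)%E \is a fin_num ->
  (F <= G)%E -> (A + K <= B)%E -> (G + B <= F + (T + A))%E -> (K <= T)%E.
Proof.
move=> fin h1 h2 h3; rewrite -(leeD2lE _ _ fin) -addeA (le_trans (leeD h1 h2))//.
by rewrite (le_trans h3)// -addeA (addeC A).
Qed.

(** To first order in [t], moving a centre adds [2 t A] and removes [2 t B], the upper and lower
    moments of its cell; [C] is the part of [B] not matched by the reflection of [A]. Reflection
    cancels [A] against [B], and optimality leaves [2 t * energy C <= 4 t ^ 2]. *)
Lemma variation_le (f g A B C : plane R -> R) t :
  measurable_fun setT f -> measurable_fun setT g -> measurable_fun setT A ->
  measurable_fun setT B -> measurable_fun setT C ->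
  (forall z, 0 <= f z) -> (forall z, 0 <= g z) -> (forall z, 0 <= A z) ->
  (forall z, 0 <= B z) -> (forall z, 0 <= C z) ->
  energy f \is a fin_num -> energy A \is a fin_num -> 0 < t ->
  (forall z, g z + 2 * t * B z <= f z + (t ^+ 2 + 2 * t * A z)) ->
  (forall z, A (z.1, - z.2) + C z <= B z) ->
  (energy f <= energy g)%E -> (energy C <= (2 * t)%:E)%E.
Proof.
move=> mf mg mA mB mC f0 g0 A0 B0 C0 finf finA t0 vary flip fg.
have k0 : 0 <= 2 * t by lra.
have tt : 0 <= t ^+ 2 by exact: sqr_ge0.
have kf0 (w : plane R -> R) : (forall z, 0 <= w z) -> forall z, 0 <= 2 * t * w z.
  by move=> w0 z; exact: mulr_ge0.
have mk (w : plane R -> R) : measurable_fun setT w -> measurable_fun setT (fun z => 2 * t * w z).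
  by move=> mw; exact: measurable_funM.
have mkA := mk A mA; have mkB := mk B mB; have kA0 := kf0 A A0; have kB0 := kf0 B B0.
have mAf : measurable_fun setT (fun z : plane R => A (z.1, - z.2)).
  apply: (measurableT_comp mA); apply/measurable_fun_pairP; split; rewrite /comp /=.
    exact: measurable_fst.
  by apply: measurableT_comp => //; exact: measurable_snd.
have step1 : (energy g + energy (fun z => 2 * t * B z)%R
    <= energy f + ((4 * t ^+ 2)%:E + energy (fun z => 2 * t * A z)%R))%E.
  rewrite -(energyD mg mkB g0 kB0).
  have mtA : measurable_fun setT (fun z => t ^+ 2 + 2 * t * A z) by exact: measurable_funD.
  have tA0 z : 0 <= t ^+ 2 + 2 * t * A z by exact: addr_ge0.
  apply: (@le_trans _ _ (energy (fun z => f z + (t ^+ 2 + 2 * t * A z))%R)%E).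
    by apply: le_energy; [exact: measurable_funD|exact: measurable_funD|
      move=> z; exact: addr_ge0|move=> z _; exact: vary].
  rewrite (energyD mf mtA f0 tA0) leeD2l//.
  rewrite (energyD (measurable_cst (t ^+ 2)) mkA (fun=> tt) kA0) leeD2r//.
  by apply: energy_le_cst => //; exact: measurable_cst.
have step2 : (energy (fun z => 2 * t * A z)%R + (2 * t)%:E * energy C
    <= energy (fun z => 2 * t * B z)%R)%E.
  rewrite -(energyZ mC C0 k0) -(energy_flip mkA kA0).
  rewrite -(energyD (mk _ mAf) (mk _ mC) (fun z => kA0 (z.1, - z.2)) (kf0 C C0)).
  apply: le_energy; [|exact: mkB| |].
  - by apply: measurable_funD; exact: mk.
  - by move=> z; apply: addr_ge0; [exact: kA0|exact: kf0].
  by move=> z _; rewrite -mulrDr ler_wpM2l.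
have fin2 : (energy f + energy (fun z => 2 * t * A z)%R)%E \is a fin_num.
  by rewrite fin_numD finf (energyZ mA A0 k0) fin_numM.
have kC : ((2 * t)%:E * energy C <= (4 * t ^+ 2)%:E)%E := shrink_le fin2 fg step2 step1.
rewrite -(@lee_pmul2l _ (2 * t)%:E)// ?lte_fin; last by lra.
by apply: le_trans kC _; rewrite -EFinM lee_fin; lra.
Qed.

(* Lowering (b, 0) by t changes the energy by at most t^2 times a constant plus 2 t times the
   integral of v over its cell.  For d < c and c + d <= a + b the upper half of the cell reflects
   into the lower half, so by optimality no point of the lower half reflects outside the cell. *)
Lemma no_escape a b c d h u0 v0 : a < b -> 0 < h -> d < c -> c + d <= a + b ->
  (forall t, (energy (min4 (a, 0) (b, 0) (c, h) (d, - h))%R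
              <= energy (min4 (a, 0) (b, t) (c, h) (d, - h))%R)%E) ->
  a + b < 2 * u0 -> v0 < 0 -> `|u0| - v0 < 1 ->
  0 < c ^+ 2 + h ^+ 2 - b ^+ 2 + 2 * (b - c) * u0 - 2 * h * v0 ->
  0 < d ^+ 2 + h ^+ 2 - b ^+ 2 + 2 * (b - d) * u0 + 2 * h * v0 ->
  ~ 0 < - (c ^+ 2 + h ^+ 2 - b ^+ 2) + - (2 * (b - c)) * u0 + - (2 * h) * v0.
Proof.
move=> ab h0 dc cdab opt um v0n dia k1p k2p k1n.
pose p : plane R := (a, 0); pose q : plane R := (b, 0).
pose r : plane R := (c, h); pose s : plane R := (d, - h).
pose f := min4 p q r s.
pose cell z := sqdist q z < Num.min (Num.min (sqdist p z) (sqdist r z)) (sqdist s z).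
pose A z := if cell z then pos z.2 else 0.
pose B z := if cell z then pos (- z.2) else 0.
(* A point nearer to [(c, -h)] than to [(b, 0)] has a reflection nearer to [(c, h)], hence outside
   the cell. *)
pose C z := if cell z then (if sqdist (c, - h) z < sqdist q z then pos (- z.2) else 0) else 0.
have mcell : measurable_fun setT cell.
  apply: measurable_fun_ltr; first exact: measurable_sqdist.
  by apply: measurable_minr; [apply: measurable_minr|]; exact: measurable_sqdist.
have mpos : measurable_fun setT (fun z : plane R => pos z.2).
  by apply: (measurableT_comp (@measurable_pos R)); exact: measurable_snd.
have mneg : measurable_fun setT (fun z : plane R => pos (- z.2)).
  apply: (measurableT_comp (@measurable_pos R)).
  by apply: measurableT_comp => //; exact: measurable_snd.
have mA : measurable_fun setT A by exact: measurable_fun_ifT.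
have mB : measurable_fun setT B by exact: measurable_fun_ifT.
have mC : measurable_fun setT C.
  apply: measurable_fun_ifT => //; apply: measurable_fun_ifT => //.
  by apply: measurable_fun_ltr; exact: measurable_sqdist.
have A0 z : 0 <= A z by rewrite /A; case: ifP => _ //; exact: pos_ge0.
have B0 z : 0 <= B z by rewrite /B; case: ifP => _ //; exact: pos_ge0.
have C0 z : 0 <= C z by rewrite /C; do 2 case: ifP => _ //; exact: pos_ge0.
have flip z : A (z.1, - z.2) + C z <= B z.
  case: z => u v /=; rewrite /A /B /C /=.
  have [v1|v1] := leP 0 v.
    rewrite (le0_pos (x := - v)); last by rewrite oppr_le0.
    by rewrite !if_same addr0.
  have v2 : 0 <= - v by rewrite oppr_ge0 ltW.
  rewrite (ge0_pos v2).
  have [/= c1|c1] := boolP (cell (u, - v)).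
    have c2 : cell (u, v).
      move: c1; rewrite /cell !lt_min !sqdist_flip !oppr0 -!andbA.
      move=> /and3P[c1 c2 c3]; rewrite c1 /=; move: c1 c2 c3; rewrite /sqdist /=.
      move=> c1 c2 c3.
      clear - c1 c2 c3 ab h0 dc cdab v1.
      (* Such a point lies to the right of the bisector, hence of [(c + d) / 2], where [(c, -h)] is
         nearer than [(d, -h)]. As the reflection beats [(c, h)], the point beats [(c, -h)] and
         therefore [(d, -h)]. *)
      have um' : 0 < (b - a) * (2 * u - (a + b)) by lra.
      rewrite pmulr_rgt0 in um'; last by lra.
      have h1 : 0 < (c - d) * (2 * u - (c + d)) by apply: mulr_gt0; lra.
      have h2 : 0 < h * (- v) by apply: mulr_gt0; lra.
      by apply/andP; split; lra.
    rewrite c2; case: ifPn => [|_]; last by rewrite addr0.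
    move: c1; rewrite /cell !lt_min !sqdist_flip !oppr0 => /andP[/andP[_ c1] _].
    by move=> /(lt_trans c1); rewrite ltxx.
  rewrite add0r; case: ifP => // _; case: ifP => // _.
have abs1 z : diamond z -> `|z.1| <= 1 /\ `|z.2| <= 1.
  move=> z1; split; apply: le_trans z1; first by rewrite lerDl.
  by rewrite lerDr.
have mf : measurable_fun setT f by exact: measurable_min4.
have f0 z : 0 <= f z by exact: min4_ge0.
have finf : energy f \is a fin_num.
  rewrite ge0_fin_numE; last by apply: integral_ge0 => u _; exact: column_ge0.
  apply: (@le_lt_trans _ _ (4 * ((1 + `|b|) ^+ 2 + 1))%:E); last by rewrite ltry.
  have b2 : 0 <= (1 + `|b|) ^+ 2 + 1 by apply: addr_ge0 => //; exact: sqr_ge0.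
  apply: energy_le_cst => //.
  move=> [u v] /abs1 /= [u1 v1]; rewrite /f /min4 !ge_min /sqdist /= subr0.
  apply/orP; left; apply/orP; right; apply: lerD.
    rewrite -(real_normK (num_real (u - b))) ler_sqr ?nnegrE ?normr_ge0 ?addr_ge0//.
    by rewrite (le_trans (ler_normB _ _))// lerD2r.
  by rewrite -(real_normK (num_real v)) exprn_ile1.
have finA : energy A \is a fin_num.
  rewrite ge0_fin_numE; last by apply: integral_ge0 => u _; exact: column_ge0.
  apply: (@le_lt_trans _ _ (4 * 1)%:E); last by rewrite ltry.
  apply: (energy_le_cst mA A0 ler01) => -[u v] /abs1 /= [_ v1]; rewrite /A; case: ifP => _ //.
  by apply: pos_le => //; exact: le_trans (ler_norm _) v1.
have small t : 0 < t -> (energy C <= (2 * t)%:E)%E.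
  move=> t0; pose g := min4 p (b, - t) r s.
  apply: (variation_le mf (measurable_min4 p (b, - t) r s) mA mB mC f0
    (min4_ge0 p (b, - t) r s) A0 B0 C0 finf finA t0 _ flip (opt (- t))).
  move=> [u v]; rewrite /A /B /=; have tt := sqr_ge0 t.
  have := lexx (g (u, v)); rewrite {2}/g le_min4 => /and4P[gp gq gr gs].
  case: ifPn => [c1|c1]; last first.
    rewrite !mulr0 !addr0; apply: (@le_trans _ _ (f (u, v))); last by rewrite lerDl.
    rewrite le_min4 gp gr gs /= andbT.
    by move: c1; rewrite -leNgt !ge_min => /orP[/orP[]|] ->; rewrite ?orbT.
  have -> : f (u, v) = sqdist q (u, v).
    move: c1; rewrite /cell !lt_min -andbA => /and3P[c1 c2 c3].
    apply/le_anti; rewrite le_min4 lexx (ltW c1) (ltW c2) (ltW c3) !andbT.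
    by rewrite /f /min4 !ge_min lexx orbT.
  apply: (@le_trans _ _ (sqdist (b, - t) (u, v) + 2 * t * pos (- v))); first by rewrite lerD2r.
  have vE := pos_sub_opp v; have tv : t * v = t * pos v - t * pos (- v) by rewrite -mulrBr -vE.
  by rewrite /sqdist /=; clear - tv; lra.
have n1 := ler_norm u0; have n2 := ler_norm (- u0); rewrite normrN in n2.
have C1 : (0 < energy C)%E.
  have F1 := @affine_near 1 (- 1) 1 u0 v0 ltac:(lra).
  have F2 := @affine_near 1 1 1 u0 v0 ltac:(lra).
  have F3 := @affine_near (v0 / 2) 0 (- 1) u0 v0 ltac:(lra).
  have m0 : 0 < (b - a) * (2 * u0 - (a + b)) by apply: mulr_gt0; lra.
  have F4 := @affine_near (a ^+ 2 - b ^+ 2) (2 * (b - a)) 0 u0 v0 ltac:(lra).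
  have F5 := @affine_near (c ^+ 2 + h ^+ 2 - b ^+ 2) (2 * (b - c)) (- (2 * h)) u0 v0 ltac:(lra).
  have F6 := @affine_near (d ^+ 2 + h ^+ 2 - b ^+ 2) (2 * (b - d)) (2 * h) u0 v0 ltac:(lra).
  have F7 := affine_near k1n.
  have [e [e0 [{}F1 [{}F2 [{}F3 [{}F4 [{}F5 [{}F6 {}F7]]]]]]]] := filter_ex
    (filterI (nbhs_right_gt (0 : R)) (filterI F1 (filterI F2 (filterI F3
      (filterI F4 (filterI F5 (filterI F6 F7))))))).
  have ev : 0 < - v0 / 2 by lra.
  apply: (@energy_gt0 _ C u0 v0 e (- v0 / 2) mC C0 e0 ev) => u v hu hv.
  have {}F1 := F1 u v hu hv; have {}F2 := F2 u v hu hv; have {}F3 := F3 u v hu hv.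
  have {}F4 := F4 u v hu hv; have {}F5 := F5 u v hu hv; have {}F6 := F6 u v hu hv.
  have {}F7 := F7 u v hu hv.
  split.
    clear - F1 F2 F3 v0n; rewrite (ler0_norm (x := v)); last by lra.
    rewrite -lerBrDr ler_norml; apply/andP; split; lra.
  rewrite /C; have -> : cell (u, v).
    rewrite /cell !lt_min /sqdist /=; clear - F4 F5 F6; apply/andP; split; last by lra.
    by apply/andP; split; lra.
  have -> : sqdist (c, - h) (u, v) < sqdist q (u, v).
    by rewrite /sqdist /=; clear - F7; lra.
  by clear - F3 v0n; rewrite /= ge0_pos; lra.
have Cfin : energy C \is a fin_num.
  rewrite ge0_fin_numE; last exact: ltW.
  by apply: (@le_lt_trans _ _ (2 * 1)%:E); [exact: small|rewrite ltry].
have x0 : 0 < fine (energy C) by rewrite fine_gt0// C1 -ge0_fin_numE// ltW.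
(* With [t] a quarter of [energy C] the bound says that [energy C] is at most its own half. *)
have := small (fine (energy C) / 4) ltac:(lra).
by rewrite -{1}(fineK Cfin) lee_fin; lra.
Qed.

End escape.

(** * Configurations with [c != d] *)

Section crossing.
Context {R : realType}.
Local Notation mu := (@lebesgue_measure R).
Implicit Types (a b c d h u v m : R) (f : plane R -> R).

(** The second moment of the tip [u > m] of the diamond about [(b, 0)] is least for
    [1 - b = 2 / 3 * (1 - m)], the centroid of this triangle; completing the square removes [b]. *)
Lemma columns_ge_tail f b m : measurable_fun setT f -> (forall z, 0 <= f z) -> 0 <= m <= 1 ->
  (forall u v, m < u < 1 -> - (1 - u) < v < 1 - u -> (u - b) ^+ 2 + v ^+ 2 <= f (u, v)) ->
  columns_ge f m 1 (2 / 9 * (1 - m) ^+ 4).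
Proof.
move=> mf f0 /andP[m0 m1] h.
pose G u := - ((1 - b) ^+ 2 * (1 - u) ^+ 2 - 4 / 3 * (1 - b) * (1 - u) ^+ 3 + 2 / 3 * (1 - u) ^+ 4).
pose g u := 2 * (u - b) ^+ 2 * (1 - u) + 2 / 3 * (1 - u) ^+ 3.
have dG (u : R) : is_derive u 1 G (g u) by rewrite /G /g; derive1; field.
have cg : continuous g by rewrite /g; continuity.
have col u : m < u < 1 -> ((g u)%:E <= column f u)%E.
  move=> mu1; have /andP[u0 u1] := mu1.
  pose F v := (u - b) ^+ 2 * v + v ^+ 3 / 3.
  have dF (v : R) : is_derive v 1 F ((u - b) ^+ 2 + v ^+ 2) by rewrite /F; derive1; field.
  have cF : continuous (fun v => (u - b) ^+ 2 + v ^+ 2) by continuity.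
  have nu : `|u| = u by apply: ger0_norm; lra.
  have u11 : -1 <= u <= 1 by apply/andP; split; lra.
  have le v : - (1 - `|u|) < v < 1 - `|u| -> (u - b) ^+ 2 + v ^+ 2 <= f (u, v).
    by rewrite nu; exact: h.
  apply: le_trans (column_ge mf f0 u11 dF cF le); rewrite nu /F /g lee_fin.
  by rewrite le_eqVlt; apply/orP; left; apply/eqP; field.
have := columns_ge_antiderivative mf f0 m1 dG cg col.
apply: le_trans; rewrite lee_fin /G -subr_ge0.
rewrite [X in 0 <= X](_ : _ = ((1 - m) * (1 - b - 2 / 3 * (1 - m))) ^+ 2); last by field.
exact: sqr_ge0.
Qed.

Lemma column_ge_cst f k u : measurable_fun setT f -> (forall z, 0 <= f z) -> -1 <= u <= 1 ->
  (forall v, - (1 - `|u|) < v < 1 - `|u| -> k <= f (u, v)) ->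
  ((2 * k * (1 - `|u|))%:E <= column f u)%E.
Proof.
move=> mf f0 u1 le.
have dF (v : R) : is_derive v 1 (fun v => k * v) k by derive1; ring.
have cF : continuous (fun _ : R => k) by continuity.
apply: le_trans (column_ge mf f0 u1 dF cF le).
by rewrite lee_fin le_eqVlt; apply/orP; left; apply/eqP; ring.
Qed.

(** [2 - (1 - m) ^ 2] is the area of the diamond to the left of [m]. *)
Lemma columns_ge_cst f k m : measurable_fun setT f -> (forall z, 0 <= f z) -> 0 <= m <= 1 ->
  (forall u v, -1 < u < m -> - (1 - `|u|) < v < 1 - `|u| -> k <= f (u, v)) ->
  columns_ge f (-1) m (k * (2 - (1 - m) ^+ 2)).
Proof.
move=> mf f0 /andP[m0 m1] le.
have -> : k * (2 - (1 - m) ^+ 2) =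
  k * (1 + 0) ^+ 2 - k * (1 + - 1) ^+ 2 + (- k * (1 - m) ^+ 2 - - k * (1 - 0) ^+ 2) by ring.
have h10 : -1 <= 0 :> R by lra.
apply: (columns_ge_cat mf f0 h10 m0).
  apply: (@columns_ge_antiderivative _ f mf f0 (fun u => k * (1 + u) ^+ 2)
    (fun u => 2 * k * (1 + u))); [exact: h10|by derive1; ring|by continuity|].
  move=> u /andP[u1 u2].
  have nu : `|u| = - u by apply: ltr0_norm.
  have := @column_ge_cst f k u mf f0 ltac:(apply/andP; split; lra)
    (fun v => le u v ltac:(apply/andP; split; lra)).
  by rewrite nu opprK.
apply: (@columns_ge_antiderivative _ f mf f0 (fun u => - k * (1 - u) ^+ 2)
  (fun u => 2 * k * (1 - u))); [by lra|by derive1; ring|by continuity|].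
move=> u /andP[u1 u2].
have nu : `|u| = u by apply: gtr0_norm.
have := @column_ge_cst f k u mf f0 ltac:(apply/andP; split; lra)
  (fun v => le u v ltac:(apply/andP; split; lra)).
by rewrite nu.
Qed.

(** [15 / 100] pays for three discs of energy at most [5 / 100] each. *)
Lemma energy_gt_cover f g (p q r : plane R) x : measurable_fun setT f -> (forall z, 0 <= f z) ->
  g = (fun z => f z + (disc (21 / 50) p z + (disc (21 / 50) q z + disc (21 / 50) r z))) ->
  1 / 6 + 15 / 100 < x -> (x%:E <= energy g)%E -> ((1 / 6)%:E < energy f)%E.
Proof.
move=> mf f0 -> hx.
have mD (a : plane R) := @measurable_disc R (21 / 50) a.
have D0 (a z : plane R) := @disc_ge0 R (21 / 50) a z.
rewrite !energyD//; [|exact: measurable_funD|by move=> z; exact: addr_ge0|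
  by apply: measurable_funD => //; exact: measurable_funD|
  by move=> z; rewrite !addr_ge0].
move=> h; rewrite ltNge; apply/negP => le.
have := le_trans h (leeD le (leeD (energy_disc_le p) (leeD (energy_disc_le q) (energy_disc_le r)))).
by rewrite -!EFinD lee_fin; lra.
Qed.

(** The zero is a convex combination of [u1] and [u2], so it inherits their bounds. It plays the
    part of the intermediate value theorem along the axis. *)
Lemma affine_no_root (A B u1 u2 m : R) : m < u1 -> m < u2 -> -1 < u1 < 1 -> -1 < u2 < 1 ->
  A + B * u1 < 0 -> 0 < A + B * u2 ->
  exists u, [/\ m < u, -1 < u < 1 & A + B * u = 0].
Proof.
move=> m1 m2 /andP[a1 b1] /andP[a2 b2] k1 k2.
pose la := (A + B * u2) / ((A + B * u2) - (A + B * u1)).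
have den : 0 < (A + B * u2) - (A + B * u1) by lra.
have la0 : 0 < la by apply: divr_gt0.
have la1 : 0 < 1 - la.
  have -> : 1 - la = - (A + B * u1) / ((A + B * u2) - (A + B * u1)) by rewrite /la; field; lra.
  by apply: divr_gt0 => //; lra.
have e : A + B * (la * u1 + (1 - la) * u2) = 0 by rewrite /la; field; lra.
exists (la * u1 + (1 - la) * u2).
clearbody la; clear den.
have conv x : x < u1 -> x < u2 -> x < la * u1 + (1 - la) * u2.
  rewrite -subr_gt0 => x1; rewrite -subr_gt0 => x2.
  by have := mulr_gt0 la0 x1; have := mulr_gt0 la1 x2; lra.
have conv' x : u1 < x -> u2 < x -> la * u1 + (1 - la) * u2 < x.
  rewrite -subr_gt0 => x1; rewrite -subr_gt0 => x2.
  by have := mulr_gt0 la0 x1; have := mulr_gt0 la1 x2; lra.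
by split=> //; [exact: conv|rewrite conv// conv'].
Qed.

(** On one column, [k1 - 2 h v] and [k2 + 2 h v] are the advantages of [(b, 0)] over [(c, h)] and
    [(d, -h)]. If the cell meets the column without filling it, some lower point of the cell has its
    reflection outside, which the hypothesis forbids. *)
Lemma column_dichotomy (T h k1 k2 : R) : 0 < h -> 0 < T -> k1 < k2 ->
  (forall v, - T < v -> v < 0 -> 0 < k1 - 2 * h * v -> 0 < k2 + 2 * h * v ->
    ~ 0 < - k1 - 2 * h * v) ->
  2 * h * T <= k1 \/
  (k1 < 0 /\ forall v, - T < v < T -> k1 <= 2 * h * v \/ k2 <= - (2 * h * v)).
Proof.
move=> h0 T0 kk esc; have [|k1T] := lerP (2 * h * T) k1; first by left.
have h2 : 0 < 2 * h by lra.
have k1n : k1 < 0.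
  rewrite ltNge; apply/negP => k10.
  (* The point [v = - M / (2 h)] beats [(d, -h)] since [M < k2], while its reflection loses to
     [(c, h)] since [k1 < M]. *)
  have [M [M1 M2 M3]] : exists M, [/\ k1 < M, M < k2 & M < 2 * h * T].
    exists ((k1 + Num.min k2 (2 * h * T)) / 2).
    by have [h1|h1] := lerP k2 (2 * h * T); split; lra.
  have [y yE] : exists y, M = 2 * h * y by exists (M / (2 * h)); field; lra.
  rewrite yE in M1 M2 M3.
  have hy0 : 0 < 2 * h * y by lra.
  have y0 : 0 < y by rewrite pmulr_rgt0 in hy0.
  have yT : y < T by rewrite ltr_pM2l in M3.
  by apply: (esc (- y)); rewrite ?mulrN ?opprK; lra.
right; split=> // v /andP[v1 v2].
have [|e1] := lerP k1 (2 * h * v); first by left.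
have [|e2] := lerP k2 (- (2 * h * v)); first by right.
have hv0 : 2 * h * v < 0 by lra.
have v0 : v < 0 by rewrite pmulr_rlt0 in hv0.
have hv : 0 < h * - v by apply: mulr_gt0; lra.
by exfalso; apply: (esc v v1 v0) => //; rewrite mulrN in hv; lra.
Qed.

(* By continuity along the axis, the cell of (b, 0) is all of u > (a + b) / 2 or adds nothing to
   the other three cells.  Elsewhere f and three discs of radius 21/50 dominate (21/50)^2. *)
Lemma crossing_bound a b c d h : a < b -> 0 < h -> d < c -> c + d <= a + b ->
  (forall t, (energy (min4 (a, 0) (b, 0) (c, h) (d, - h))%R
              <= energy (min4 (a, 0) (b, t) (c, h) (d, - h))%R)%E) ->
  ((1 / 6)%:E < energy (min4 (a, 0) (b, 0) (c, h) (d, - h))%R)%E.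
Proof.
move=> ab h0 dc cdab opt.
have esc := no_escape ab h0 dc cdab opt.
pose p : plane R := (a, 0); pose r : plane R := (c, h); pose s : plane R := (d, - h).
pose f := min4 p (b, 0) r s.
rewrite -/p -/r -/s -/f.
have mf : measurable_fun setT f by exact: measurable_min4.
have f0 z : 0 <= f z by exact: min4_ge0.
pose D z := disc (21 / 50) p z + (disc (21 / 50) r z + disc (21 / 50) s z).
pose g z := f z + D z.
have mg : measurable_fun setT g.
  by do 3 (apply: measurable_funD; first try exact: measurable_disc; try exact: mf); exact: measurable_disc.
have D0 z : 0 <= D z by rewrite /D !addr_ge0// disc_ge0.
have g0 z : 0 <= g z by rewrite /g addr_ge0.
have cover := @energy_gt_cover f g p r s _ mf f0 erefl.
(* The radius is tuned: the last case yields [2 k - 9 / 8 * k ^ 2], which exceeds the required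
   [1 / 6 + 15 / 100] by only about [0.001]. *)
pose k : R := (21 / 50) ^+ 2.
(* Where [(b, 0)] is not the unique nearest centre, [f] is the squared distance to one of the
   others, and the disc around that one supplies the difference to [k]. *)
have gk z : [|| sqdist p z <= sqdist (b, 0) z, sqdist r z <= sqdist (b, 0) z
    | sqdist s z <= sqdist (b, 0) z] -> k <= g z.
  have dk (o : plane R) : k - sqdist o z <= disc (21 / 50) o z by exact: pos_ge.
  have f3 : Num.min (Num.min (sqdist p z) (sqdist r z)) (sqdist s z) <= f z ->
      k <= g z.
    have dp := dk p; have dr := dk r; have ds := dk s.
    have ep := disc_ge0 (21 / 50) p z; have er := disc_ge0 (21 / 50) r z.
    have es := disc_ge0 (21 / 50) s z.
    rewrite /g /D !ge_min => /orP[/orP[]|] ?; lra.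
  move=> q1; apply: f3; rewrite le_min4 !ge_min !lexx !orbT /= andbT -orbA //.
pose A := c ^+ 2 + h ^+ 2 - b ^+ 2; pose B := 2 * (b - c).
pose k2 u := d ^+ 2 + h ^+ 2 - b ^+ 2 + 2 * (b - d) * u.
have key u : -1 < u < 1 -> a + b < 2 * u -> 2 * h * (1 - `|u|) <= A + B * u \/
    (A + B * u < 0 /\ forall v, - (1 - `|u|) < v < 1 - `|u| -> k <= g (u, v)).
  rewrite -ltr_norml => u1 um.
  have T0 : 0 < 1 - `|u| by rewrite subr_gt0.
  have kk : A + B * u < k2 u.
    clear - dc cdab um.
    have : 0 < (c - d) * (2 * u - (c + d)) by apply: mulr_gt0; lra.
    by rewrite /A /B /k2; lra.
  have [] := @column_dichotomy (1 - `|u|) h (A + B * u) (k2 u) h0 T0 kk _; [|by left|].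
    move=> v v1 v2 e1 e2 e3.
    by apply: (esc u v um v2) => //; rewrite /A /B /k2 in e1 e2 e3; clear - v1 e1 e2 e3; lra.
  move=> [k1 gap]; right; split => // v v1; apply: gk.
  have := gap v v1; rewrite /A /B /k2 /sqdist /= => -[]h1; apply/orP; right; apply/orP;
    [left|right]; clear - h1; lra.
have left_gk u v : 2 * u <= a + b -> k <= g (u, v).
  move=> um; apply: gk; apply/orP; left; rewrite /sqdist /=.
  clear - ab um; have : 0 <= (b - a) * (a + b - 2 * u) by apply: mulr_ge0; lra.
  lra.
have [m1|m1] := lerP 2 (a + b).
  apply: (cover (k * (2 - (1 - 1) ^+ 2))); first by rewrite /k; lra.
  apply: columns_ge_cst => //; first by apply/andP; split; lra.
  by move=> u v /andP[u1 u2] _; apply: left_gk; clear - m1 u2; lra.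
(* If [A + B u] is negative on one column beyond the bisector, no such column is filled by the cell:
   otherwise this affine function would vanish between the two, and [key] admits neither alternative
   there. *)
have [[u1 [u11 um1 k1n]]|full] := pselect (exists u, [/\ -1 < u < 1, a + b < 2 * u & A + B * u < 0]).
  apply: (cover (k * (2 - (1 - 1) ^+ 2))); first by rewrite /k; lra.
  apply: columns_ge_cst => //; first by apply/andP; split; lra.
  move=> u v u2 hv.
  have [um|um] := lerP (2 * u) (a + b); first exact: left_gk.
  have [k1p|[_]] := key u u2 um; last exact.
  exfalso.
  have hT : 0 < 2 * h * (1 - `|u|).
    by rewrite !mulr_gt0// subr_gt0 ltr_norml.
  have mu1 : (a + b) / 2 < u1 by clear - um1; lra.
  have mu : (a + b) / 2 < u by clear - um; lra.
  have [w [w1 w2 w3]] := affine_no_root mu1 mu u11 u2 k1n (lt_le_trans hT k1p).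
  have mw : a + b < 2 * w by clear - w1; lra.
  have [|[]] := key w w2 mw; rewrite w3 ?ltxx//.
  by rewrite leNgt !mulr_gt0// subr_gt0 ltr_norml.
have all_far u : -1 < u < 1 -> a + b < 2 * u -> 2 * h * (1 - `|u|) <= A + B * u.
  by move=> u1 u2; have [|[k1 _]] := key u u1 u2 => //; case: full; exists u.
pose m : R := Num.max 0 ((a + b) / 2).
have m01 : 0 <= m <= 1 by rewrite /m le_max lexx ge_max ler01 /=; lra.
have tail u v : m < u < 1 -> - (1 - u) < v < 1 - u -> (u - b) ^+ 2 + v ^+ 2 <= f (u, v).
  rewrite gt_max -andbA => /and3P[u1 u2 u3] /andP[v1 v2].
  have nu : `|u| = u by exact: gtr0_norm.
  have um : a + b < 2 * u by clear - u2; lra.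
  have u11 : -1 < u < 1 by rewrite u3 andbT; clear - u1; lra.
  have kf := all_far u u11 um; rewrite nu /A /B in kf.
  clear - kf ab h0 dc cdab um v1 v2.
  have h1 : 0 < (c - d) * (2 * u - (c + d)) by apply: mulr_gt0; lra.
  have h2 : 0 < h * (1 - u - v) by apply: mulr_gt0; lra.
  have h3 : 0 < h * (1 - u + v) by apply: mulr_gt0; lra.
  have h4 : 0 < (b - a) * (2 * u - (a + b)) by apply: mulr_gt0; lra.
  rewrite /f le_min4 /sqdist /=.
  by apply/and4P; split; lra.
(* When the bisector lies to the left of the centre, the right half alone costs [2 / 9 > 1 / 6]. *)
have [m0|m0] := lerP (a + b) 0.
  have mE : m = 0 by rewrite /m max_l//; lra.
  have := columns_ge_tail mf f0 m01 tail; rewrite mE => T.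
  have z0 : columns_ge f (-1) 0 0.
    by apply: integral_ge0 => u _; exact: column_ge0.
  by apply: lt_le_trans (energy_ge_halves mf f0 z0 T); rewrite lte_fin; lra.
have mE : m = (a + b) / 2 by rewrite /m max_r//; lra.
have fg z : f z <= g z by rewrite /g lerDl.
have tg u v (u1 : m < u < 1) (v1 : - (1 - u) < v < 1 - u) :
  (u - b) ^+ 2 + v ^+ 2 <= g (u, v) := le_trans (tail u v u1 v1) (fg (u, v)).
have G1 := columns_ge_tail mg g0 m01 tg.
have lg u v : -1 < u < m -> - (1 - `|u|) < v < 1 - `|u| -> k <= g (u, v).
  by move=> /andP[_ u1] _; apply: left_gk; lra.
have G2 := columns_ge_cst mg g0 m01 lg.
have /andP[m2 m3] := m01.
apply: (cover _ _ (columns_ge_cat mg g0 _ _ G2 G1)) => //; last by lra.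
(* In terms of [W] the bound is [k (2 - W) + 2 / 9 * W ^ 2], least at [W = 9 / 4 * k]. *)
set W := (1 - m) ^+ 2.
have -> : (1 - m) ^+ 4 = W ^+ 2 by rewrite /W; ring.
have := sqr_ge0 (W - 9 / 4 * k); rewrite /k; clearbody W; lra.
Qed.

End crossing.

(** * Reduction of crossed configurations by symmetry *)

Section across.
Context {R : realType}.
Implicit Types (a b c d h : R) (p q r s z : plane R).

Definition point_opp z : plane R := (- z.1, - z.2).
Definition point_flip z : plane R := (z.1, - z.2).

Lemma min4_flip p q r s z :
  min4 (point_flip p) (point_flip q) (point_flip r) (point_flip s) z =
  min4 p q r s (z.1, - z.2).
Proof.
rewrite /min4 /sqdist /=.
have e (x y : R) : (y - - x) ^+ 2 = (- y - x) ^+ 2 by ring.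
by rewrite !e.
Qed.

Lemma min4_opp p q r s z :
  min4 (point_opp p) (point_opp q) (point_opp r) (point_opp s) z =
  min4 p q r s (- z.1, - z.2).
Proof.
rewrite /min4 /sqdist /=.
have e (x y : R) : (y - - x) ^+ 2 = (- y - x) ^+ 2 by ring.
by rewrite !e.
Qed.

Lemma energy_min4_flip p q r s :
  energy (min4 (point_flip p) (point_flip q) (point_flip r) (point_flip s)) =
  energy (min4 p q r s).
Proof.
rewrite -(energy_flip (measurable_min4 p q r s) (min4_ge0 p q r s)).
by congr energy; apply/funext => z; exact: min4_flip.
Qed.

Lemma energy_min4_opp p q r s :
  energy (min4 (point_opp p) (point_opp q) (point_opp r) (point_opp s)) =
  energy (min4 p q r s).
Proof.
rewrite -[RHS]energy_min4_flip [RHS]energy_reflect; [|exact: measurable_min4|exact: min4_ge0].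
by congr energy; apply/funext => z; rewrite min4_flip min4_opp.
Qed.

Lemma min4C12 p q r s : min4 p q r s = min4 q p r s.
Proof. by apply/funext => z; rewrite /min4 [Num.min (sqdist p z) _]minC. Qed.

Lemma min4C34 p q r s : min4 p q r s = min4 p q s r.
Proof. by apply/funext => z; rewrite /min4 [Num.min (sqdist r z) _]minC. Qed.

(** Reflection in the axis exchanges [c] and [d], so [d < c] may be assumed. The point reflection
    keeps this order and reverses the comparison of [c + d] with [a + b]. *)
Lemma across_crossed a b c d h : a < b -> 0 < h -> c != d ->
  (forall p q r s, (energy (min4 (a, 0) (b, 0) (c, h) (d, - h))%R <= energy (min4 p q r s))%E) ->
  ((1 / 6)%:E < energy (min4 (a, 0) (b, 0) (c, h) (d, - h))%R)%E.
Proof.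
wlog dc : c d / d < c.
  move=> th ab h0 cd; move: (cd); rewrite neq_lt => /orP[dc|dc]; last exact: th.
  have e : energy (min4 (a, 0) (b, 0) (c, h) (d, - h)) = energy (min4 (a, 0) (b, 0) (d, h) (c, - h)).
    by rewrite -energy_min4_flip min4C34 /point_flip /= !oppr0 opprK.
  have dc' : d != c by rewrite eq_sym.
  by rewrite e; exact: th dc ab h0 dc'.
move=> ab h0 _; have [m1|m1] := lerP (c + d) (a + b).
  by move=> opt; apply: crossing_bound => // t; exact: opt.
have -> : energy (min4 (a, 0) (b, 0) (c, h) (d, - h)) =
    energy (min4 (- b, 0) (- a, 0) (- d, h) (- c, - h)).
  by rewrite -energy_min4_opp min4C34 min4C12 /point_opp /= !oppr0 opprK.
by move=> opt; apply: crossing_bound => //; lra.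
Qed.

Lemma across_bound a b c d h : -1 <= a -> a < b -> b <= 1 -> 0 < h -> `|c| + h <= 1 ->
  (forall p q r s, (energy (min4 (a, 0) (b, 0) (c, h) (d, - h))%R <= energy (min4 p q r s))%E) ->
  (energy (min4 (a, 0) (b, 0) (c, h) (d, - h))%R <= (1 / 6)%:E)%E ->
  [/\ a = - (1 / 2), b = 1 / 2, c = 0, d = 0 & h = 1 / 2].
Proof.
move=> a1 ab b1 h0 ch opt; have [<-|cd] := eqVneq c d.
  by have [|[-> -> -> ->]] := diagonal_bound a1 ab b1 h0 ch; first by rewrite ltNge => /negbTE ->.
by have := across_crossed ab h0 cd opt; rewrite ltNge => /negbTE ->.
Qed.

End across.

(** * Two centres on the line [y = 1 / 2] *)

Section horizontal.
Context {R : realType}.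
Local Notation mu := (@lebesgue_measure R).
Local Notation U := (@uniform_square R).
Implicit Types (a b c d t k : R) (f : plane R -> R).

Lemma integral_squareE f : measurable_fun setT f -> (forall z, 0 <= f z) ->
  (\int[U]_z (f z)%:E =
   \int[mu]_(x in `[0%R, 1%R]) \int[mu]_(y in `[0%R, 1%R]) (f (x, y))%:E)%E.
Proof.
move=> mf f0; have mfE : measurable_fun setT (EFin \o f) by exact/measurable_EFinP.
rewrite (@integral_uniform_square R (EFin \o f) mfE); last by move=> z; rewrite lee_fin.
rewrite [RHS]integral_mkcond; apply: eq_integral => x _; rewrite patchE.
case: ifPn => [|]; rewrite ?inE ?notin_setE /= in_itv/= => hx.
  rewrite [RHS]integral_mkcond; apply: eq_integral => y _; rewrite !patchE /=.
  have -> // : ((x, y) \in @unit_square R) = (y \in `[0, 1]%classic).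
  apply/idP/idP; rewrite !inE /= in_itv/=; first by case.
  by move=> hy; split.
rewrite integral0_eq// => y _; rewrite patchE ifN//.
by rewrite notin_setE /=; case.
Qed.

(** The integrand is the gain of [(c, 1 / 2 + t)] or [(c, 1 / 2 - t)] over the line. At the nearer
    horizontal edge it equals the positive part of [s ^ 2 - (x - c) ^ 2] with [s ^ 2 = t (1 - t)],
    so integrating in [y] first leaves the square of a parabolic cap over [4 t]. *)
Lemma gain_le t k c : 0 < t <= 1 / 2 -> k = 2 * t \/ k = - (2 * t) ->
  (\int[U]_z (pos (k * (z.2 - 1 / 2) - t ^+ 2 - (z.1 - c) ^+ 2))%:E <= (2 / 100)%:E)%E.
Proof.
move=> /andP[t0 t2] kE.
pose g (z : plane R) := pos (k * (z.2 - 1 / 2) - t ^+ 2 - (z.1 - c) ^+ 2).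
have mg : measurable_fun setT g.
  apply: (measurableT_comp (@measurable_pos R)).
  apply: measurable_funB.
    by apply: measurable_funB => //; apply: measurable_funM => //; apply: measurable_funB => //;
       exact: measurable_snd.
  by apply: measurable_funX; apply: measurable_funB => //; exact: measurable_fst.
have g0 z : 0 <= g z by exact: pos_ge0.
rewrite (@integral_squareE g)//.
have k0 : k != 0 by case: kE => ->; [rewrite gt_eqF//|rewrite oppr_eq0 gt_eqF//]; lra.
pose s := Num.sqrt (t * (1 - t)).
have tt : 0 <= t * (1 - t) by apply: mulr_ge0; lra.
have s0 : 0 <= s by exact: sqrtr_ge0.
have s2 : s ^+ 2 = t * (1 - t) by rewrite sqr_sqrtr.
have inner x : (\int[mu]_(y in `[0%R, 1%R]) (g (x, y))%:E =
    (pos (s ^+ 2 - (x - c) ^+ 2) ^+ 2 * (4 * t)^-1)%:E)%E.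
  pose F y := pos (k * (y - 1 / 2) - t ^+ 2 - (x - c) ^+ 2) ^+ 2 * (2 * k)^-1.
  have dF (y : R) : is_derive y 1 F (pos (k * (y - 1 / 2) - t ^+ 2 - (x - c) ^+ 2)).
    by rewrite /F; derive1; field.
  have cF : continuous (fun y : R => pos (k * (y - 1 / 2) - t ^+ 2 - (x - c) ^+ 2)) by continuity.
  rewrite (integral_antiderivative (ler01 : 0 <= 1 :> R) dF cF) /F s2; congr EFin.
  have x0 := sqr_ge0 (x - c); have t20 := sqr_ge0 t.
  case: kE => ->.
    rewrite [X in _ - X * _](_ : _ = 0); last by rewrite le0_pos ?expr0n//=; lra.
    rewrite mul0r subr0; congr (pos _ ^+ 2 * _^-1); [|ring].
    by field.
  rewrite [X in X * _ - _](_ : _ = 0); last by rewrite le0_pos ?expr0n//=; lra.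
  rewrite mul0r sub0r mulrN invrN mulrN opprK; congr (pos _ ^+ 2 * _^-1); [|ring].
  by field.
under eq_integral do rewrite inner.
have t4 : 0 <= (4 * t)^-1 by rewrite invr_ge0; lra.
under eq_integral do rewrite EFinM.
rewrite ge0_integralZr//; last 2 first.
- apply: measurable_funTS; apply/measurable_EFinP; apply: continuous_measurable_fun.
  by continuity.
- by move=> x _; rewrite lee_fin sqr_ge0.
have c2 := integral_cap2_le c s0 (ler01 : 0 <= 1 :> R).
apply: (@le_trans _ _ ((16 * s ^+ 5 / 15)%:E * ((4 * t)^-1)%:E)%E).
  by apply: lee_wpmul2r => //; rewrite lee_fin.
rewrite -EFinM lee_fin ler_pdivrMr; last by lra.
have -> : 2 / 100 * (4 * t) = 16 / 15 * (3 / 40 * t) by field.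
rewrite [leLHS](_ : _ = 16 / 15 * s ^+ 5); last by field.
rewrite ler_pM2l; last by lra.
(* Squaring removes the root in [s] and leaves [t ^ 3 (1 - t) ^ 5 <= (3 / 40) ^ 2]; the maximum, at
   [t = 3 / 8], is about [0.00503] against [0.005625]. *)
rewrite -ler_sqr ?nnegrE ?exprn_ge0//; last by lra.
rewrite -exprM (_ : (5 * 2 = 2 * 5)%N)// exprM s2 exprMn.
have -> : (3 / 40 * t) ^+ 2 = t ^+ 2 * (3 / 40) ^+ 2 by ring.
rewrite (_ : t ^+ 5 * _ = t ^+ 2 * (t ^+ 3 * (1 - t) ^+ 5)); last by ring.
rewrite ler_pM2l; last by rewrite exprn_gt0.
rewrite -subr_ge0; apply: ltW.
box t t in (0 : R) (1 / 2 : R) (0 : R) (1 / 2 : R) with 30%N.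
Qed.

Lemma horizontal_bound a b c d t : 0 < t <= 1 / 2 ->
  ((1 / 24)%:E < \int[U]_z (min4 (a, 1 / 2) (b, 1 / 2) (c, 1 / 2 + t) (d, 1 / 2 - t) z)%:E)%E.
Proof.
move=> t0.
pose f := min4 (a, 1 / 2) (b, 1 / 2) (c, 1 / 2 + t) (d, 1 / 2 - t).
pose g k c (z : plane R) := pos (k * (z.2 - 1 / 2) - t ^+ 2 - (z.1 - c) ^+ 2).
have g1 := gain_le c t0 (or_introl erefl); have g2 := gain_le d t0 (or_intror erefl).
have mf : measurable_fun setT f by exact: measurable_min4.
have f0 z : 0 <= f z by exact: min4_ge0.
have mg k x : measurable_fun setT (g k x).
  apply: (measurableT_comp (@measurable_pos R)).
  apply: measurable_funB.
    by apply: measurable_funB => //; apply: measurable_funM => //; apply: measurable_funB => //;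
       exact: measurable_snd.
  by apply: measurable_funX; apply: measurable_funB => //; exact: measurable_fst.
have g0 k x z : 0 <= g k x z by exact: pos_ge0.
pose w (z : plane R) := (z.2 - 1 / 2) ^+ 2.
have mw : measurable_fun setT w.
  by apply: measurable_funX; apply: measurable_funB => //; exact: measurable_snd.
have w0 z : 0 <= w z by exact: sqr_ge0.
have wE : (\int[U]_z (w z)%:E = (1 / 12)%:E)%E.
  rewrite integral_squareE//.
  have inner x : (\int[mu]_(y in `[0%R, 1%R]) (w (x, y))%:E = (1 / 12)%:E)%E.
    pose F (y : R) := (y - 1 / 2) ^+ 3 / 3.
    have dF (y : R) : is_derive y 1 F ((y - 1 / 2) ^+ 2) by rewrite /F; derive1; field.
    have cF : continuous (fun y : R => (y - 1 / 2) ^+ 2) by continuity.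
    by rewrite (integral_antiderivative (ler01 : 0 <= 1 :> R) dF cF) /F; congr EFin; field.
  under eq_integral do rewrite inner.
  by rewrite integral_cst//= lebesgue_measure_itv /= lte_fin ltr01 oppr0 adde0 mule1.
have total : ((1 / 12)%:E <= \int[U]_z (f z)%:E + (\int[U]_z (g (2 * t) c z)%:E +
    \int[U]_z (g (- (2 * t)) d z)%:E))%E.
  have mgE k x : measurable_fun setT (EFin \o g k x) by exact/measurable_EFinP.
  have g0E k x z : (0 <= (g k x z)%:E)%E by rewrite lee_fin.
  rewrite -(ge0_integralD U measurableT (fun z _ => g0E (2 * t) c z) (mgE (2 * t) c)
    (fun z _ => g0E (- (2 * t)) d z) (mgE (- (2 * t)) d)).
  have mfE : measurable_fun setT (EFin \o f) by exact/measurable_EFinP.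
  rewrite -ge0_integralD//=; last 3 first.
  - by move=> z _; rewrite lee_fin.
  - by move=> z _; rewrite lee_fin addr_ge0.
  - by apply/measurable_EFinP; exact: measurable_funD.
  rewrite -wE; apply: ge0_le_integral => //.
  - by move=> z _; rewrite lee_fin.
  - exact/measurable_EFinP.
  - by apply/measurable_EFinP; apply: measurable_funD => //; exact: measurable_funD.
  move=> [x y] _; rewrite -!EFinD lee_fin /w /=.
  have gp := pos_ge (2 * t * (y - 1 / 2) - t ^+ 2 - (x - c) ^+ 2).
  have gm := pos_ge (- (2 * t) * (y - 1 / 2) - t ^+ 2 - (x - d) ^+ 2).
  have gp0 := g0 (2 * t) c (x, y); have gm0 := g0 (- (2 * t)) d (x, y).
  have x1 := sqr_ge0 (x - a); have x2 := sqr_ge0 (x - b).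
  move: gp0 gm0; rewrite /g /= => gp0 gm0.
  rewrite -lerBlDr le_min4 /sqdist /=.
  by apply/and4P; split; lra.
rewrite ltNge; apply/negP => le.
(* [1 / 12 - 2 * (2 / 100) = 13 / 300], which exceeds [1 / 24]. *)
have := le_trans total (leeD le (leeD g1 g2)).
by rewrite -!EFinD lee_fin; lra.
Qed.

End horizontal.

(** * Distortion of at most four points *)

Section distortion4.
Context {R : realType}.
Local Notation U := (@uniform_square R).
Local Notation J := (@unit_square R).
Implicit Types (a p q r s z : plane R) (alpha : {fset plane R}).

(** The points may coincide, so all nonempty sets of at most four points are covered. *)
Definition mean4 p q r s : \bar R := (\int[U]_z (min4 p q r s z)%:E)%E.

Lemma le_bigmin_seq (x : \bar R) (t : seq (plane R)) (F : plane R -> \bar R) :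
  (x <= \big[Order.min/+oo]_(a <- t) F a)%E = all (fun a => x <= F a)%E t.
Proof. by elim: t => [|a t IH] /=; rewrite ?big_nil ?leey// big_cons le_min IH. Qed.

Lemma bigmin_fset4 p q r s z :
  (\big[Order.min/+oo]_(a <- [fset p; q; r; s]%fset) (Defs.edist z a ^+ 2)%:E)%E
  = (min4 p q r s z)%:E.
Proof.
have lower (x y : \bar R) : (forall t, (t <= x) = (t <= y))%E -> x = y.
  by move=> e; apply/le_anti; rewrite -e lexx e lexx.
apply: lower => t; rewrite le_bigmin_seq /min4 !EFin_min !le_min -!edist_sqr.
apply/allP/idP => [h|/andP[/andP[h1 h2] /andP[h3 h4]] a].
  by rewrite !h// !inE eqxx ?orbT.
by rewrite !inE -!orbA => /or4P[] /eqP->.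
Qed.

Lemma distortion_fset4 p q r s : distortion U [fset p; q; r; s]%fset = mean4 p q r s.
Proof. by apply: eq_integral => z _; exact: bigmin_fset4. Qed.

Lemma fset4_of_card alpha : (#|` alpha| <= 4)%N -> alpha != fset0 ->
  exists p q r s, alpha = [fset p; q; r; s]%fset.
Proof.
move=> c4 n0.
have mem a : (a \in alpha) = (a \in enum_fset alpha) by [].
have ext p q r s : (forall a, (a \in alpha) = [|| a == p, a == q, a == r | a == s]) ->
    exists p q r s, alpha = [fset p; q; r; s]%fset.
  by move=> h; exists p, q, r, s; apply/fsetP => a; rewrite h !inE -!orbA.
have [] : (size (enum_fset alpha) <= 4)%N /\ enum_fset alpha <> [::].
  split=> // e; move/negP: n0; apply; apply/eqP/cardfs0_eq.
  by rewrite -[RHS]/(size (Nil (plane R))) -e.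
case: (enum_fset alpha) mem => [|p [|q [|r [|s [|//]]]]] mem _ // _.
- by apply: (ext p p p p) => a; rewrite mem !inE !orbb.
- by apply: (ext p q q q) => a; rewrite mem !inE !orbb.
- by apply: (ext p q r r) => a; rewrite mem !inE !orbb.
- by apply: (ext p q r s) => a; rewrite mem !inE.
Qed.

(** The empty set competes in the infimum and has to be excluded. *)
Lemma distortion_fset0 : distortion U fset0 = +oo%E.
Proof.
rewrite /distortion.
under eq_integral do rewrite big_nil.
by rewrite integral_cst// [X in (_ * X)%E]probability_setT mule1.
Qed.

Lemma mean4_ge0 p q r s : (0 <= mean4 p q r s)%E.
Proof. by apply: integral_ge0 => z _; rewrite lee_fin min4_ge0. Qed.

Lemma min4_unrot p q r s z : min4 p q r s (unrot z) = 2^-1 * min4 (rot p) (rot q) (rot r) (rot s) z.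
Proof.
have e a : sqdist a (unrot z) = 2^-1 * sqdist (rot a) z.
  by rewrite -{2}(unrotK z) sqdist_rot; field.
by rewrite /min4 !e !minr_pMr.
Qed.

Lemma mean4_energy p q r s :
  mean4 p q r s = (4^-1%:E * energy (min4 (rot p) (rot q) (rot r) (rot s)))%E.
Proof.
rewrite /mean4 energy_square; [|exact: measurable_min4|exact: min4_ge0].
have -> : min4 p q r s \o unrot = fun z => 2^-1 * min4 (rot p) (rot q) (rot r) (rot s) z.
  by apply/funext => z /=; exact: min4_unrot.
rewrite energyZ; [|exact: measurable_min4|exact: min4_ge0|by []].
by rewrite muleA -EFinM; congr (_%:E * _)%E; field.
Qed.

Definition swap_point z : plane R := (z.2, z.1).
Definition mirror_point z : plane R := (1 - z.1, z.2).

Lemma rot_swap z : rot (swap_point z) = point_flip (rot z).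
Proof. by rewrite /rot /point_flip /=; congr pair; ring. Qed.

Lemma mean4_swap p q r s :
  mean4 (swap_point p) (swap_point q) (swap_point r) (swap_point s) = mean4 p q r s.
Proof. by rewrite !mean4_energy !rot_swap energy_min4_flip. Qed.

Lemma rot_mirror z : rot (mirror_point z) = swap_point (rot z).
Proof. by rewrite /rot /swap_point /=; congr pair; ring. Qed.

Lemma mean4_mirror p q r s :
  mean4 (mirror_point p) (mirror_point q) (mirror_point r) (mirror_point s) = mean4 p q r s.
Proof.
have sw a z : sqdist (swap_point a) z = sqdist a (z.2, z.1) by rewrite /sqdist /= addrC.
suff e (p' q' r' s' : plane R) :
    energy (min4 (swap_point p') (swap_point q') (swap_point r') (swap_point s')) =
    energy (min4 p' q' r' s') by rewrite !mean4_energy !rot_mirror e.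
rewrite [RHS](energy_swap (measurable_min4 p' q' r' s') (min4_ge0 p' q' r' s')).
by congr energy; apply/funext => z; rewrite /min4 !sw.
Qed.

Definition clamp (x : R) : R := Num.max 0 (Num.min x 1).
Definition clamp_point z : plane R := (clamp z.1, clamp z.2).

Lemma clamp_itv x : 0 <= clamp x <= 1.
Proof. by rewrite /clamp le_max lexx ge_max ler01 ge_min lexx orbT. Qed.

Lemma clamp_id x : 0 <= x <= 1 -> clamp x = x.
Proof. by move=> /andP[x0 x1]; rewrite /clamp min_l// max_r. Qed.

Lemma clamp_cases x : [\/ x <= 0 /\ clamp x = 0, 1 <= x /\ clamp x = 1
  | 0 <= x <= 1 /\ clamp x = x].
Proof.
have [x0|x0] := lerP x 0.
  by constructor 1; split=> //; rewrite /clamp max_l// ge_min x0.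
have [x1|x1] := lerP 1 x; first by constructor 2; split=> //; rewrite /clamp min_r// max_r.
by constructor 3; split; rewrite ?clamp_id//; apply/andP; split; lra.
Qed.

Lemma clamp_inner x : 0 < clamp x < 1 -> clamp x = x.
Proof. by have [[_ ->]|[_ ->]|[_ ->]] := clamp_cases x => //; lra. Qed.

Lemma sqdist_clamp a z : J z -> sqdist (clamp_point a) z <= sqdist a z.
Proof.
case: a z => [a1 a2] [x y] [/= /andP[x0 x1] /andP[y0 y1]]; rewrite /sqdist /=.
have near (c t : R) : 0 <= t -> t <= 1 -> (t - clamp c) ^+ 2 <= (t - c) ^+ 2.
  move=> t0 t1; have [[c0 ->]|[c1 ->]|[_ ->]] := clamp_cases c => //.
    have : 0 <= - c * (2 * t - c) by apply: mulr_ge0; lra.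
    lra.
  have : 0 <= (c - 1) * (c - t + (1 - t)) by apply: mulr_ge0; lra.
  lra.
by apply: lerD; exact: near.
Qed.

Lemma le_integral_square (f g : plane R -> R) : measurable_fun setT f -> measurable_fun setT g ->
  (forall z, 0 <= f z) -> (forall z, 0 <= g z) -> (forall z, J z -> f z <= g z) ->
  (\int[U]_z (f z)%:E <= \int[U]_z (g z)%:E)%E.
Proof.
move=> mf mg f0 g0 fg.
have mu : measurable_fun setT (@unrot R).
  apply/measurable_fun_pairP; split; rewrite /comp /unrot /=;
    apply: measurable_funM => //.
  + by apply: measurable_funB; [apply: measurable_funD => //; exact: measurable_fst|exact: measurable_snd].
  + by apply: measurable_funD; [apply: measurable_funD => //; exact: measurable_fst|exact: measurable_snd].
rewrite (energy_square mf f0) (energy_square mg g0) lee_pmul2l ?lte_fin ?invr_gt0//.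
apply: le_energy; [exact: measurableT_comp|exact: measurableT_comp|by move=> z; exact: f0|].
by move=> z; rewrite diamond_unrot => /fg.
Qed.

Lemma mean4_clamp p q r s :
  (mean4 (clamp_point p) (clamp_point q) (clamp_point r) (clamp_point s) <= mean4 p q r s)%E.
Proof.
apply: le_integral_square; [exact: measurable_min4|exact: measurable_min4|exact: min4_ge0|
  exact: min4_ge0|move=> z zJ].
set m := min4 _ _ _ _ z; have : m <= m by [].
rewrite {2}/m le_min4 => /and4P[h1 h2 h3 h4]; rewrite le_min4.
by apply/and4P; split; [apply: le_trans h1 _|apply: le_trans h2 _|apply: le_trans h3 _|
  apply: le_trans h4 _]; exact: sqdist_clamp.
Qed.

(** For coordinates in the unit interval, [|2 t - c - c'| <= 2], so each of the two coordinates
    contributes at most [2 e] to the change of a squared distance. *)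
Lemma mean4_lipschitz p q r s p' q' r' s' (e : R) : 0 <= e ->
  (forall a a', (a, a') \in [:: (p, p'); (q, q'); (r, r'); (s, s')] ->
    [/\ J a, J a', `|a.1 - a'.1| <= e & `|a.2 - a'.2| <= e]) ->
  (mean4 p q r s <= mean4 p' q' r' s' + (4 * e)%:E)%E.
Proof.
move=> e0 h.
have near a a' z : (a, a') \in [:: (p, p'); (q, q'); (r, r'); (s, s')] -> J z ->
    sqdist a z <= sqdist a' z + 4 * e.
  move=> /h[]; case: a a' z => [a b] [a' b'] [x y] /= [/= a0 b0] [/= a'0 b'0] h1 h2 [/= x0 y0].
  rewrite /sqdist /=.
  have one (t c c' : R) : 0 <= t <= 1 -> 0 <= c <= 1 -> 0 <= c' <= 1 -> `|c - c'| <= e ->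
      (t - c) ^+ 2 <= (t - c') ^+ 2 + 2 * e.
    move=> /andP[t0 t1] /andP[c0 c1] /andP[c'0 c'1]; rewrite ler_norml => /andP[d1 d2].
    have [cc|cc] := lerP c c'.
      have : 0 <= (c' - c) * (2 - (2 * t - c - c')) by apply: mulr_ge0; lra.
      lra.
    have : 0 <= (c - c') * (2 - (c + c' - 2 * t)) by apply: mulr_ge0; lra.
    lra.
  have := one x a a' x0 a0 a'0 h1; have := one y b b' y0 b0 b'0 h2; lra.
have mU : measurable_fun setT (fun z => (min4 p' q' r' s' z)%:E).
  by apply/measurable_EFinP; exact: measurable_min4.
have -> : (mean4 p' q' r' s' + (4 * e)%:E =
    \int[U]_z (min4 p' q' r' s' z + 4 * e)%:E)%E.
  under [RHS]eq_integral do rewrite EFinD.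
  rewrite ge0_integralD//.
  - by rewrite integral_cst// [X in (_ * X)%E]probability_setT mule1.
  - by move=> z _; rewrite lee_fin min4_ge0.
  - by move=> z _; rewrite lee_fin mulr_ge0.
apply: le_integral_square; [exact: measurable_min4|
  by apply: measurable_funD => //; exact: measurable_min4|exact: min4_ge0|
  by move=> z; rewrite addr_ge0 ?min4_ge0// mulr_ge0|move=> z zJ].
set m := min4 p q r s z; have : m <= m by [].
rewrite {2}/m le_min4 => /and4P[h1 h2 h3 h4]; rewrite -lerBlDr le_min4 !lerBlDr.
by apply/and4P; split; [apply: le_trans h1 _|apply: le_trans h2 _|apply: le_trans h3 _|
  apply: le_trans h4 _]; apply: near; rewrite // !inE eqxx ?orbT.
Qed.

End distortion4.

(** * Existence of a minimiser in the square *)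

Section minimizer.
Context {R : realType}.
Local Notation U := (@uniform_square R).
Local Notation J := (@unit_square R).
Implicit Types (a p q r s z : plane R).

Lemma unit_square_clamp a : J (clamp_point a).
Proof. by split; exact: clamp_itv. Qed.

Lemma clamp_lipschitz (x y : R) : `|clamp x - clamp y| <= `|x - y|.
Proof.
wlog xy : x y / x <= y.
  move=> th; case/orP: (le_total x y); first exact: th.
  by rewrite distrC (distrC x); exact: th.
have e : `|x - y| = y - x by rewrite distrC ger0_norm//; lra.
rewrite e; have [[x0 ->]|[x1 ->]|[/andP[x0 x1] ->]] := clamp_cases x;
  have [[y0 ->]|[y1 ->]|[/andP[y0 y1] ->]] := clamp_cases y;
  by rewrite ler_norml; apply/andP; split; lra.
Qed.

Lemma mean4_fin p q r s : J p -> mean4 p q r s \is a fin_num.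
Proof.
move=> [/andP[p0 p1] /andP[p2 p3]]; rewrite ge0_fin_numE ?mean4_ge0//.
apply: (@le_lt_trans _ _ (\int[U]_z (2 : R)%:E)%E); last first.
  by rewrite integral_cst// [X in (_ * X)%E]probability_setT mule1 ltry.
apply: (@le_integral_square _ _ (fun=> 2)) => //; [exact: measurable_min4|exact: min4_ge0|].
move=> z [/andP[z0 z1] /andP[z2 z3]]; rewrite /min4 !ge_min; apply/orP; left; apply/orP; left.
have one (t c : R) : 0 <= t -> t <= 1 -> 0 <= c -> c <= 1 -> (t - c) ^+ 2 <= 1.
  move=> t0 t1 c0 c1; rewrite -(real_normK (num_real _)) exprn_ile1// ler_norml.
  by apply/andP; split; lra.
by rewrite (_ : 2 = 1 + 1) // lerD ?one.
Qed.

(** Composition with [clamp_point] gives a finite continuous objective on all row vectors of length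
    eight, which attains its minimum on the unit cube. Clamping a competitor does not increase its
    distortion and moves it into the cube. *)
Lemma mean4_has_min : exists p q r s, [/\ J p, J q, J r & J s] /\
  forall p' q' r' s', (mean4 p q r s <= mean4 p' q' r' s')%E.
Proof.
pose pt k (x : 'rV[R]_8) : plane R :=
  clamp_point (x ord0 (inord k.*2), x ord0 (inord k.*2.+1)).
pose F x := fine (mean4 (pt 0%N x) (pt 1%N x) (pt 2%N x) (pt 3%N x)).
have ptJ k x : J (pt k x) by exact: unit_square_clamp.
have FE x : (F x)%:E = mean4 (pt 0%N x) (pt 1%N x) (pt 2%N x) (pt 3%N x).
  by rewrite /F fineK// mean4_fin.
have lip (x y : 'rV[R]_8) (e : R) : 0 <= e -> (forall i, `|x ord0 i - y ord0 i| <= e) -> F x <= F y + 4 * e.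
  move=> e0 h; rewrite -lee_fin EFinD !FE; apply: mean4_lipschitz => // a a'.
  by rewrite !inE => /or4P[]/eqP[-> ->]; split=> //;
    apply: le_trans (clamp_lipschitz _ _) (h _).
have Fc : continuous F.
  move=> x; have xf : Filter (nbhs x) by exact: nbhs_filter.
  apply/cvgrPdist_le => e e0; near=> y.
  have h i : `|x ord0 i - y ord0 i| <= e / 4.
    move: i; near: y; apply: filter_forall => i.
    have e4 : 0 < e / 4 by lra.
    by have /cvgrPdist_le/(_ _ e4) := @coord_continuous R 1 8 ord0 i x.
  have h' i : `|y ord0 i - x ord0 i| <= e / 4 by rewrite distrC.
  have := lip x y (e / 4) ltac:(lra) h; have := lip y x (e / 4) ltac:(lra) h'.
  by rewrite ler_norml => *; apply/andP; split; lra.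
pose K := [set x : 'rV[R]_8 | forall i, `[0, 1]%classic (x ord0 i)].
have K0 : K !=set0.
  by exists (const_mx 0) => i; rewrite /= mxE in_itv /= lexx ler01.
have Kc : compact K := @rV_compact R 8 (fun=> `[0, 1]%classic) (fun=> @segment_compact R 0 1).
have [c _ cmin] := compact_EVT_min K0 Kc (continuous_subspaceT Fc).
exists (pt 0%N c), (pt 1%N c), (pt 2%N c), (pt 3%N c); split=> // p q r s.
apply: le_trans (mean4_clamp p q r s); rewrite -FE.
pose l := [:: clamp p.1; clamp p.2; clamp q.1; clamp q.2; clamp r.1; clamp r.2;
  clamp s.1; clamp s.2].
pose x : 'rV[R]_8 := \row_i l`_i.
have xK : x \in K.
  rewrite inE => i /=; rewrite mxE in_itv /=.
  have : l`_i \in l by rewrite mem_nth.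
  by rewrite !inE => /or4P[/eqP->|/eqP->|/eqP->|/or4P[/eqP->|/eqP->|/eqP->|/orP[]/eqP->]];
    exact: clamp_itv.
apply: (@le_trans _ _ (F x)%:E); first by rewrite lee_fin cmin.
rewrite FE le_eqVlt; apply/orP; left; apply/eqP.
have clampK y : clamp (clamp y) = clamp y by rewrite clamp_id// clamp_itv.
by rewrite /pt /clamp_point !mxE !inordK//= !clampK.
Unshelve. all: by end_near. Qed.

End minimizer.

(** * Value and uniqueness of the grid among diagonal configurations *)

Section grid.
Context {R : realType}.
Local Notation mu := (@lebesgue_measure R).
Local Notation U := (@uniform_square R).
Local Notation J := (@unit_square R).
Implicit Types (a p q r s z : plane R).

Definition grid_points : seq (plane R) :=
  [:: (1 / 4, 1 / 4); (3 / 4, 3 / 4); (3 / 4, 1 / 4); (1 / 4, 3 / 4)].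

(* The squared distance from x to the nearer of 1/4 and 3/4. *)
Let near_quarter (x : R) := (x - 1 / 2) ^+ 2 - pos (x - 1 / 2) + (x - 1 / 2) / 2 + 1 / 16.

Let near_quarterE x : near_quarter x = (x - 1 / 4) ^+ 2 \/ near_quarter x = (x - 3 / 4) ^+ 2.
Proof.
rewrite /near_quarter; have [x0|x0] := lerP x (1 / 2).
  by left; rewrite le0_pos; [field|lra].
by right; rewrite ge0_pos; [field|lra].
Qed.

Let near_quarter_le x : near_quarter x <= (x - 1 / 4) ^+ 2 /\ near_quarter x <= (x - 3 / 4) ^+ 2.
Proof.
have := pos_ge0 (x - 1 / 2); have := pos_ge (x - 1 / 2); rewrite /near_quarter => h1 h2.
by split; lra.
Qed.

Let integral_near_quarter :
  (\int[mu]_(y in `[0%R, 1%R]) (near_quarter y)%:E = (1 / 48)%:E)%E.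
Proof.
pose F (y : R) := (y - 1 / 2) ^+ 3 / 3 - pos (y - 1 / 2) ^+ 2 / 2 + (y - 1 / 2) ^+ 2 / 4 + y / 16.
have dF (y : R) : is_derive y 1 F (near_quarter y).
  by rewrite /F /near_quarter; derive1; field.
have cF : continuous near_quarter by rewrite /near_quarter; continuity.
rewrite (integral_antiderivative (ler01 : 0 <= 1 :> R) dF cF) /F.
rewrite (ge0_pos (x := 1 - 1 / 2)); last by lra.
by rewrite (le0_pos (x := 0 - 1 / 2)); [congr EFin; field|lra].
Qed.

(** The grid is the product of two copies of [{1/4, 3/4}], so the minimum splits into one term per
    coordinate, each with integral [1 / 48]. *)
Lemma mean4_grid :
  @mean4 R (1 / 4, 1 / 4) (3 / 4, 3 / 4) (3 / 4, 1 / 4) (1 / 4, 3 / 4) = (1 / 24)%:E.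
Proof.
rewrite /mean4 integral_squareE; [|exact: measurable_min4|exact: min4_ge0].
have near0 x : 0 <= near_quarter x by have [->|->] := near_quarterE x; exact: sqr_ge0.
have mnear : measurable_fun setT (EFin \o near_quarter).
  apply/measurable_EFinP; apply: continuous_measurable_fun.
  by rewrite /near_quarter; continuity.
have fE x y : @min4 R (1 / 4, 1 / 4) (3 / 4, 3 / 4) (3 / 4, 1 / 4) (1 / 4, 3 / 4) (x, y) =
    near_quarter x + near_quarter y.
  apply/le_anti/andP; split.
    rewrite /min4 !ge_min /sqdist /=.
    by have [->|->] := near_quarterE x; have [->|->] := near_quarterE y; rewrite lexx ?orbT.
  have [x1 x3] := near_quarter_le x; have [y1 y3] := near_quarter_le y.
  by rewrite le_min4 /sqdist /=; apply/and4P; split; apply: lerD.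
have cstE (k : R) : (\int[mu]_(y in `[0%R, 1%R]) k%:E = k%:E)%E.
  by rewrite integral_cst//= lebesgue_measure_itv /= lte_fin ltr01 oppr0 adde0 mule1.
have addE (k : R) : 0 <= k ->
    (\int[mu]_(y in `[0%R, 1%R]) (k + near_quarter y)%:E = (k + 1 / 48)%:E)%E.
  move=> k0; under eq_integral do rewrite EFinD.
  rewrite ge0_integralD//=; last 2 first.
  - by move=> y _; rewrite lee_fin.
  - exact: measurable_funTS.
  by rewrite cstE integral_near_quarter.
have inner x : (\int[mu]_(y in `[0%R, 1%R])
    (@min4 R (1 / 4, 1 / 4) (3 / 4, 3 / 4) (3 / 4, 1 / 4) (1 / 4, 3 / 4) (x, y))%R%:E
    = (1 / 48 + near_quarter x)%:E)%E.
  by under eq_integral do rewrite fE; rewrite addE// addrC.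
under eq_integral do rewrite inner.
by rewrite addE; [congr EFin; field|lra].
Qed.

Lemma diagonal_case p q r s : J p -> J q -> J r -> J s -> p != q ->
  p.1 = p.2 -> q.1 = q.2 -> r.1 - r.2 = - (s.1 - s.2) -> r.1 != r.2 ->
  (forall p' q' r' s', (mean4 p q r s <= mean4 p' q' r' s')%E) ->
  (mean4 p q r s <= (1 / 24)%:E)%E ->
  [:: p; q; r; s] =i grid_points.
Proof.
wlog pq : p q / p.1 < q.1.
  move=> th Jp Jq Jr Js pq pd qd rs rd.
  have [qp|qp|e] := ltgtP p.1 q.1; first by apply: th.
    rewrite /mean4 min4C12 => opt le z.
    by rewrite -(th q p)// 1?eq_sym// !inE orbCA.
  by case/eqP: pq; apply: injective_projections; rewrite -?pd -?qd.
wlog rr : r s / r.1 < r.2.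
  move=> th Jp Jq Jr Js pq' pd qd rs rd.
  have [sr|sr|e] := ltgtP r.1 r.2; first by apply: th.
    rewrite /mean4 min4C34 => opt le z.
    rewrite -(th s r)//; [by rewrite !inE [(z == s) || _]orbC|lra|by rewrite rs opprK|].
    by rewrite lt_eqF//; lra.
  by case/eqP: rd.
case: p q r s pq rr => [p1 p2] [q1 q2] [r1 r2] [s1 s2] /= pq rr Jp Jq Jr Js _ pd qd rs _.
move=> opt le.
have dia (z : plane R) : J z -> diamond (rot z) by rewrite diamond_unrot rotK.
have sE : s1 - s2 = r2 - r1 by lra.
have [/andP[p10 p11] _] := Jp; have [/andP[q10 q11] _] := Jq.
have := @across_bound R (2 * p1 - 1) (2 * q1 - 1) (r1 + r2 - 1) (s1 + s2 - 1) (r2 - r1).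
have <- : rot (p1, p2) = (2 * p1 - 1, 0) by rewrite /rot /= -pd; congr pair; ring.
have <- : rot (q1, q2) = (2 * q1 - 1, 0) by rewrite /rot /= -qd; congr pair; ring.
have <- : rot (s1, s2) = (s1 + s2 - 1, - (r2 - r1)) by rewrite /rot /= -sE opprB.
rewrite -[(r1 + r2 - 1, r2 - r1)]/(rot (r1, r2)) => bound.
have [|||||||h1 h2 h3 h4 h5] := bound.
- by rewrite /= in p10; lra.
- by lra.
- by rewrite /= in q11; lra.
- by lra.
- have /= := dia _ Jr; rewrite /diamond /= (ger0_norm (x := r2 - r1)) //; lra.
- move=> p' q' r' s'.
  have := opt (unrot p') (unrot q') (unrot r') (unrot s').
  by rewrite !mean4_energy !unrotK lee_pmul2l// lte_fin invr_gt0.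
- move: le; rewrite mean4_energy.
  rewrite (_ : (1 / 24)%:E = 4^-1%:E * (1 / 6)%:E)%E; last by rewrite -EFinM; congr EFin; field.
  by rewrite lee_pmul2l// lte_fin invr_gt0.
move=> z; rewrite !inE; have -> : p1 = 1 / 4 by lra.
have -> : p2 = 1 / 4 by lra.
have -> : q1 = 3 / 4 by lra.
have -> : q2 = 3 / 4 by lra.
have -> : r1 = 1 / 4 by lra.
have -> : r2 = 3 / 4 by lra.
have -> : s1 = 3 / 4 by lra.
have -> : s2 = 1 / 4 by lra.
by rewrite [(z == (1 / 4, 3 / 4)) || _]orbC.
Qed.

End grid.

(** * The four lines of symmetry *)

Section lines.
Context {R : realType}.
Local Notation J := (@unit_square R).
Implicit Types (a b c : R) (p q r s x y z : plane R).

(** The infimum is attained at the orthogonal projection [foot]; Lagrange's identity writes the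
    excess of any other squared distance, times [a ^ 2 + b ^ 2], as a square. *)
Lemma dist_to_line a b c x : 0 < a ^+ 2 + b ^+ 2 ->
  dist_to_set x (line (a, b, c)) ^+ 2 * (a ^+ 2 + b ^+ 2) = line_form (a, b, c) x ^+ 2.
Proof.
set n := _ + _ => n0; pose k := line_form (a, b, c) x / n.
pose foot : plane R := (x.1 - k * a, x.2 - k * b).
have fl : line (a, b, c) foot.
  by rewrite /line /line_form /foot /k /line_form /n /=; field; rewrite gt_eqF.
have foot_le y : line (a, b, c) y -> Defs.edist x foot <= Defs.edist x y.
  rewrite /line /line_form /= => yl.
  rewrite -ler_sqr ?nnegrE ?sqrtr_ge0// !edist_sqr /sqdist /=.
  have kE : k * n = a * (x.1 - y.1) + b * (x.2 - y.2).
    by rewrite /k divfK ?gt_eqF// /line_form /=; lra.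
  rewrite -(ler_pM2r n0).
  have -> : ((x.1 - (x.1 - k * a)) ^+ 2 + (x.2 - (x.2 - k * b)) ^+ 2) * n = (k * n) ^+ 2.
    by rewrite /n; ring.
  rewrite kE -subr_ge0.
  rewrite [leRHS](_ : _ = (a * (x.2 - y.2) - b * (x.1 - y.1)) ^+ 2); last by rewrite /n; ring.
  exact: sqr_ge0.
have -> : dist_to_set x (line (a, b, c)) = Defs.edist x foot.
  apply/le_anti/andP; split.
    apply: ge_inf; last by exists foot.
    by exists 0 => _ [y _ <-]; exact: sqrtr_ge0.
  apply: lb_le_inf; first by exists (Defs.edist x foot); exists foot.
  by move=> _ [y yl <-]; exact: foot_le.
rewrite edist_sqr /sqdist /foot /=.
transitivity ((k * n) ^+ 2); first by rewrite /n; ring.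
by rewrite /k divfK// gt_eqF.
Qed.

Lemma opposite_equidistant a b c r s : 0 < a ^+ 2 + b ^+ 2 ->
  opposite_sides (a, b, c) r s ->
  dist_to_set r (line (a, b, c)) = dist_to_set s (line (a, b, c)) ->
  line_form (a, b, c) r = - line_form (a, b, c) s /\ line_form (a, b, c) r != 0.
Proof.
move=> n0 op de; have := dist_to_line c r n0; rewrite de dist_to_line// => /eqP.
rewrite eqf_sqr; case: op => /andP[h1 h2] /orP[] /eqP h; split; rewrite ?neq_lt ?h1 ?h2 ?orbT//; lra.
Qed.

Lemma mirror_pointK : involutive (@mirror_point R).
Proof. by case=> x y; rewrite /mirror_point /=; congr pair; ring. Qed.

Lemma horizontal_case p q r s : J r -> J s -> p.2 = 1 / 2 -> q.2 = 1 / 2 ->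
  r.2 - 1 / 2 = - (s.2 - 1 / 2) -> r.2 != 1 / 2 -> ((1 / 24)%:E < mean4 p q r s)%E.
Proof.
wlog rr : r s / 1 / 2 < r.2.
  move=> th Jr Js pd qd rs rd; have [sr|sr|e] := ltgtP (1 / 2) r.2; first by apply: th.
    rewrite /mean4 min4C34; apply: th => //; [lra|lra|].
    by rewrite gt_eqF//; lra.
  by rewrite e eqxx in rd.
case: p q r s rr => [p1 p2] [q1 q2] [r1 r2] [s1 s2] /= rr [_ /= /andP[_ r21]] _ -> -> rs _.
have -> : r2 = 1 / 2 + (r2 - 1 / 2) by ring.
have -> : s2 = 1 / 2 - (r2 - 1 / 2) by lra.
by apply: horizontal_bound; apply/andP; split; lra.
Qed.

(** [mirror_point] carries the second diagonal to the first, preserving the grid, and [swap_point]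
    carries [x_1 = 1 / 2] to [x_2 = 1 / 2]; the two lines parallel to the sides contradict the bound
    [1 / 24]. *)
Lemma two_on_two_across_grid l p q r s : l \in @square_symmetry_lines R ->
  J p -> J q -> J r -> J s -> p != q -> line l p -> line l q -> opposite_sides l r s ->
  dist_to_set r (line l) = dist_to_set s (line l) ->
  (forall p' q' r' s', (mean4 p q r s <= mean4 p' q' r' s')%E) ->
  (mean4 p q r s <= (1 / 24)%:E)%E ->
  [:: p; q; r; s] =i @grid_points R.
Proof.
have n0 (a b : R) : (a, b) \in [:: (1, -1); (1, 1); (1, 0); (0, 1)] -> 0 < a ^+ 2 + b ^+ 2.
  by rewrite !inE => /or4P[]/eqP[-> ->]; lra.
rewrite /square_symmetry_lines !inE => /or4P[]/eqP-> Jp Jq Jr Js pq lp lq op de opt le.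
all: have [] := opposite_equidistant (n0 _ _ _) op de; rewrite ?inE ?eqxx ?orbT //.
all: move: lp lq; rewrite /line /line_form /= => lp lq rs rd.
- apply: diagonal_case => //; [lra|lra|lra|].
  by apply: contra_neq rd => ->; lra.
- have e z : (z \in [:: p; q; r; s]) = (mirror_point z \in map (@mirror_point R) [:: p; q; r; s]).
    by rewrite mem_map//; exact: inv_inj mirror_pointK.
  have g z : (mirror_point z \in @grid_points R) = (z \in @grid_points R).
    have gE : @grid_points R = map (@mirror_point R) [:: (3 / 4, 1 / 4); (1 / 4, 3 / 4);
        (1 / 4, 1 / 4); (3 / 4, 3 / 4)].
      by rewrite /mirror_point /grid_points /=; congr [:: (_, _); (_, _); (_, _); (_, _)]; field.
    rewrite {1}gE mem_map; last exact: inv_inj mirror_pointK.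
    by rewrite !inE; do 4 case: (z == _).
  have inJ z : J z -> J (mirror_point z).
    by case: z => x y [/= /andP[x0 x1] y0]; split => //=; apply/andP; split; lra.
  move=> z; rewrite e -g; apply: diagonal_case; try exact: inJ.
  - by rewrite (inj_eq (inv_inj mirror_pointK)).
  - by rewrite /=; lra.
  - by rewrite /=; lra.
  - by rewrite /=; lra.
  - by apply: contra_neq rd => /= ?; lra.
  - by move=> p' q' r' s'; rewrite mean4_mirror.
  - by rewrite mean4_mirror.
- exfalso; move: le; apply/negP; rewrite -ltNge -mean4_swap.
  have inJ z : J z -> J (swap_point z) by case: z => x y [].
  apply: horizontal_case; try exact: inJ; rewrite /=; [lra|lra|lra|].
  by apply: contra_neq rd => ?; lra.
- exfalso; move: le; apply/negP; rewrite -ltNge.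
  apply: horizontal_case => //; [lra|lra|lra|].
  by apply: contra_neq rd => ?; lra.
Qed.

End lines.

(** * Optimal sets of four-means *)

Section optimal.
Context {R : realType}.
Local Notation U := (@uniform_square R).
Local Notation J := (@unit_square R).
Implicit Types (p q r s : plane R) (alpha : {fset plane R}).

Lemma card_fset4_le p q r s : (#|` [fset p; q; r; s]%fset| <= 4)%N.
Proof.
have -> : [fset p; q; r; s]%fset = [fset x in [:: p; q; r; s]]%fset.
  by apply/fsetP => z; rewrite !inE -!orbA orbF.
by rewrite card_fseq (leq_trans (size_undup _)).
Qed.

Lemma quantization_error_mean4 p q r s :
  (forall p' q' r' s', (mean4 p q r s <= mean4 p' q' r' s')%E) ->
  quantization_error U 4 = mean4 p q r s.
Proof.
move=> opt; apply/le_anti/andP; split.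
  apply: ereal_inf_lbound; exists [fset p; q; r; s]%fset; last exact: distortion_fset4.
  exact: card_fset4_le.
apply/ereal_infP => _ [alpha /= c4 <-].
have [->|n0] := eqVneq alpha fset0; first by rewrite distortion_fset0 leey.
have [p' [q' [r' [s' ->]]]] := fset4_of_card c4 n0.
by rewrite distortion_fset4.
Qed.

Lemma optimal_meansP alpha : optimal_means U 4 alpha ->
  exists p q r s, alpha = [fset p; q; r; s]%fset /\
  forall p' q' r' s', (mean4 p q r s <= mean4 p' q' r' s')%E.
Proof.
have [p [q [r [s [[Jp _ _ _] opt]]]]] := @mean4_has_min R.
move=> [c4]; rewrite (quantization_error_mean4 opt) => e.
have n0 : alpha != fset0.
  apply/eqP => a0; move: e; rewrite a0 distortion_fset0 => e.
  by have := mean4_fin q r s Jp; rewrite -e fin_numE eqxx andbF.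
have [p' [q' [r' [s' aE]]]] := fset4_of_card c4 n0.
exists p', q', r', s'; split=> //.
by rewrite -distortion_fset4 -aE e.
Qed.

Lemma optimal_means_fset4 p q r s :
  (forall p' q' r' s', (mean4 p q r s <= mean4 p' q' r' s')%E) ->
  optimal_means U 4 [fset p; q; r; s]%fset.
Proof.
move=> opt; split; last by rewrite distortion_fset4 (quantization_error_mean4 opt).
exact: card_fset4_le.
Qed.

Lemma fset4_eq p q r s p' q' r' s' : [:: p; q; r; s] =i [:: p'; q'; r'; s'] ->
  [fset p; q; r; s]%fset = [fset p'; q'; r'; s']%fset.
Proof. by move=> e; apply/fsetP => z; have := e z; rewrite !inE -!orbA. Qed.

Hypothesis hsym : forall alpha, optimal_means U 4 alpha ->
  exists2 l, l \in square_symmetry_lines R & two_on_two_across l alpha.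

Let grid : {fset plane R} :=
  [fset (1 / 4, 1 / 4); (3 / 4, 3 / 4); (3 / 4, 1 / 4); (1 / 4, 3 / 4)]%fset.

Lemma optimal_in_square_grid alpha : optimal_means U 4 alpha ->
  (forall a, a \in alpha -> J a) -> alpha = grid.
Proof.
move=> oa inJ; have [l lin [p [q [r [s [aE pq [lp lq] op de]]]]]] := hsym oa.
have [p1 [q1 [r1 [s1 [aE1 opt1]]]]] := optimal_meansP oa.
(* The enumeration given by the symmetry hypothesis need not be the one known to minimise, but both
   describe [alpha] and have the same distortion. *)
have opt p' q' r' s' : (mean4 p q r s <= mean4 p' q' r' s')%E.
  by rewrite -distortion_fset4 -aE aE1 distortion_fset4.
have Ja a : a \in [:: p; q; r; s] -> J a.
  by move=> h; apply: inJ; rewrite aE !inE -!orbA; move: h; rewrite !inE.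
rewrite aE; apply: fset4_eq.
apply: (two_on_two_across_grid lin _ _ _ _ pq lp lq op de opt);
  try by apply: Ja; rewrite !inE eqxx ?orbT.
by rewrite -mean4_grid.
Qed.

Lemma grid_optimal : optimal_means U 4 grid /\ quantization_error U 4 = (1 / 24)%:E.
Proof.
have [p [q [r [s [[Jp Jq Jr Js] opt]]]]] := @mean4_has_min R.
have ga : [fset p; q; r; s]%fset = grid.
  apply: optimal_in_square_grid; first exact: optimal_means_fset4.
  by move=> a; rewrite !inE -!orbA => /or4P[]/eqP->.
split; first by rewrite -ga; exact: optimal_means_fset4.
by rewrite (quantization_error_mean4 opt) -distortion_fset4 ga distortion_fset4 mean4_grid.
Qed.

Lemma optimal_grid alpha : optimal_means U 4 alpha -> alpha = grid.
Proof.
move=> /optimal_meansP[p [q [r [s [-> opt]]]]].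
have cg : [fset clamp_point p; clamp_point q; clamp_point r; clamp_point s]%fset = grid.
  apply: optimal_in_square_grid.
    by apply: optimal_means_fset4 => *; exact: le_trans (mean4_clamp p q r s) (opt _ _ _ _).
  by move=> a; rewrite !inE -!orbA => /or4P[]/eqP->; exact: unit_square_clamp.
have inner a : clamp_point a \in grid -> clamp_point a = a.
  move=> ag; have {ag} [c1 c2] : 0 < clamp a.1 < 1 /\ 0 < clamp a.2 < 1.
    by move: ag; rewrite !inE -!orbA /clamp_point => /or4P[]/eqP[-> ->]; split;
       apply/andP; split; lra.
  by rewrite /clamp_point (clamp_inner c1) (clamp_inner c2) -surjective_pairing.
rewrite -cg.
rewrite (inner p); last by rewrite -cg !inE eqxx.
rewrite (inner q); last by rewrite -cg !inE eqxx !orbT.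
rewrite (inner r); last by rewrite -cg !inE eqxx !orbT.
by rewrite (inner s) // -cg !inE eqxx !orbT.
Qed.

End optimal.

Unset Implicit Arguments.

Theorem theorem3p7p1 (R : realType)
    (hsym : forall alpha : {fset plane R},
      optimal_means (@uniform_square R) 4 alpha ->
      exists2 l : R * R * R, l \in square_symmetry_lines R
        & two_on_two_across l alpha) :
  let grid : {fset plane R} :=
    [fset (1 / 4, 1 / 4); (3 / 4, 3 / 4); (3 / 4, 1 / 4); (1 / 4, 3 / 4)]%fset in
  [/\ optimal_means (@uniform_square R) 4 grid,
      (forall alpha : {fset plane R},
        optimal_means (@uniform_square R) 4 alpha -> alpha = grid)
    & (`|quantization_error (@uniform_square R) 4 - ((416 * 10 ^+ 3 + 667) / 10 ^+ 7)%:E|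
        < (10 ^- 7)%:E)%E].
Proof.
have [og qE] := grid_optimal hsym.
split=> //; first by move=> alpha; exact: optimal_grid.
(* The decimal value exceeds [1 / 24] by [1 / (3 * 10 ^ 7)]. *)
by rewrite qE -EFinB abse_EFin lte_fin ltr_norml; apply/andP; split; lra.
Qed.
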